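(* Let $q\in(0,\infty)$, $r\in\mathbb N_0$, and let $K\subset\mathbb R^d$, $d\in\{1,2,3\}$, be an element (a bounded Lipschitz domain) satisfying the piecewise star-shapedness assumption stated in the context, with boundary subdivision $\{F_i\}_{i=1}^{n_K}$, sub-elements $K_{F_i}$ and fields $\mathbf m_i$. Then, for each $i=1,\dots,n_K$ and each polynomial $v\in\mathcal P_r(K)$, $$\int_{F_i}|v|^q\,\mathrm ds\le2^{q+1}C_{\mathrm{inv},d}\,\frac{2r^2+1}{\min_{F_i}(\mathbf m_i\cdot\mathbf n)}\int_{K_{F_i}}|v|^q\,\mathrm d\mathbf x,$$ where $C_{\mathrm{inv},d}=1,4,8$ for $d=1,2,3$, respectively.
   Context: Piecewise star-shapedness assumption: $K$ is a Lipschitz domain and $\partial K$ is subdivided into mutually exclusive sets $\{F_i\}_{i=1}^{n_K}$ such that, for each $i$, there exist a point $\mathbf x_i^0\in K$ and a sub-element $K_{F_i}\subset K$ (depending on $\mathbf x_i^0$), with $F_i$ contained in the boundary of $K_{F_i}$ and the rest of the boundary of $K_{F_i}$ consisting of $d$ planar faces meeting at $\mathbf x_i^0$, such that (1) $K_{F_i}$ is star-shaped with respect to $\mathbf x_i^0$; (2) $\mathbf m_i(\mathbf x)\cdot\mathbf n(\mathbf x)>0$ on $F_i$, where $\mathbf m_i(\mathbf x)=\mathbf x-\mathbf x_i^0$ and $\mathbf n$ is the outward unit normal to $F_i$. The quantity $\min_{F_i}(\mathbf m_i\cdot\mathbf n)$ is assumed positive. The pieces $F_i$ may be curved and may contain several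 faces of $K$. $\mathcal P_r(K)$ denotes the real polynomials of total degree at most $r$. *)

(* Defs.v *)
From HB Require Import structures.
From mathcomp Require Import all_boot all_order all_algebra.
(* The notations of mpoly clash with those of MathComp-Analysis. *)
From mathcomp Require Import -(notations) mpoly.
From mathcomp Require Import all_classical all_reals all_analysis.
From mathcomp Require Import measurable_realfun.
Set Implicit Arguments.
Unset Strict Implicit.
Unset Printing Implicit Defensive.
Import Order.TTheory GRing.Theory Num.Theory.
Import numFieldNormedType.Exports.
Local Open Scope classical_set_scope.
Local Open Scope ring_scope.

Definition borel_rV (R : realType) (n : nat) :=
  g_sigma_algebraType (@open 'rV[R]_n).

Definition cons_rV (R : realType) (n : nat)
  (p : measurableTypeR R * borel_rV R n) : borel_rV R n.+1 :=
  row_mx (p.1%:M : 'rV[R]_1) (p.2 : 'rV[R]_n).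

(* n-fold product of the one-dimensional Lebesgue measure. *)
Fixpoint lebesgue_rV (R : realType) (n : nat) :
    set (borel_rV R n) -> \bar R :=
  match n with
  | 0 => @dirac _ (borel_rV R 0) (0 : 'rV[R]_0) R
  | m.+1 =>
      pushforward (@lebesgue_measure R \x @lebesgue_rV R m)%E (@cons_rV R m)
  end.
Arguments lebesgue_rV R n : clear implicits.

Definition uncons_rV (R : realType) (n : nat) (x : borel_rV R n.+1) :
    measurableTypeR R * borel_rV R n :=
  ((x : 'rV[R]_n.+1) 0 0, \row_j (x : 'rV[R]_n.+1) 0 (lift 0 j)).

Lemma cons_rVK (R : realType) (n : nat) : cancel (@cons_rV R n) (@uncons_rV R n).
Proof.
move=> [a b]; congr pair; rewrite /cons_rV /=.
  by rewrite mxE; case: splitP => // j _; rewrite ord1 mxE.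
apply/rowP => j; rewrite mxE -(rshift1 j).
by rewrite (row_mxEr (a%:M : 'rV[R]_1) (b : 'rV[R]_n)).
Qed.

Lemma uncons_rVK (R : realType) (n : nat) : cancel (@uncons_rV R n) (@cons_rV R n).
Proof.
move=> x; apply/rowP => j; rewrite /cons_rV /uncons_rV mxE /=.
case: splitP => k.
  by rewrite ord1 mxE => j0; congr (x _ _); apply: val_inj.
by rewrite mxE => jk; congr (x _ _); apply: val_inj.
Qed.

Lemma measurable_uncons_rV (R : realType) (n : nat) :
  measurable_fun setT (@uncons_rV R n).
Proof.
apply/measurable_fun_pair.
  apply: (measurability _ (RGenOpens.measurableE R)).
  move=> _ [_ [a [b ->] <-]]; rewrite setTI; apply: sub_gen_smallest.
  by apply: open_comp; [move=> x _; exact: coord_continuous|exact: interval_open].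
apply: (@measurability _ _ _ (borel_rV R n) setT _ (@open 'rV[R]_n) erefl) => //.
move=> _ [U oU <-]; rewrite setTI; apply: sub_gen_smallest.
apply: (@open_comp 'rV[R]_n.+1 'rV[R]_n) => // x _.
move=> A /nbhs_ballP[e e0 eA]; apply/nbhs_ballP; exists e => //= y [_ xy].
by apply: eA; split => // i j; rewrite !mxE; exact: xy.
Qed.

Lemma measurable_cons_rV (R : realType) (n : nat) :
  measurable_fun setT (@cons_rV R n).
Proof.
apply: (@measurability _ _ _ (borel_rV R n.+1) setT _ (@open 'rV[R]_n.+1) erefl) => //.
move=> _ [U oU <-]; rewrite setTI.
pose box (c : rat * 'rV[rat]_n * nat) : set (measurableTypeR R * borel_rV R n) :=
  ball (ratr c.1.1 : R) c.2.+1%:R^-1 `*`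
  ball (map_mx (@ratr R) c.1.2 : 'rV[R]_n) c.2.+1%:R^-1.
have mbox c : measurable (box c).
  apply: measurableX; first exact: measurable_ball.
  by apply: sub_gen_smallest; exact: ball_open.
rewrite (_ : _ @^-1` _ =
    \bigcup_c (if `[< box c `<=` @cons_rV R n @^-1` U >] then box c else set0)); last first.
  apply/seteqP; split=> [[a b] /= Uab|p [c _]]; last by case: asboolP => // cU; exact: cU.
  have /nbhs_ballP[e /= e0 eU] : nbhs (cons_rV (a, b) : 'rV[R]_n.+1) U.
    exact: open_nbhs_nbhs.
  have [k ke] : exists k : nat, k.+1%:R^-1 < e / 2 :> R.
    by have [k _ kP] := near_infty_natSinv_lt (PosNum (divr_gt0 e0 (ltr0n _ 2)));
      exists k; exact: (kP k (leqnn k)).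
  have k0 : 0 < k.+1%:R^-1 :> R by rewrite invr_gt0.
  have app (x : R) : exists q : rat, `|ratr q - x| < k.+1%:R^-1.
    have /rat_in_itvoo[q /itvP qx] : x - k.+1%:R^-1 < x + k.+1%:R^-1.
      by rewrite ltrD2l gtrN.
    by exists q; rewrite ltr_distl !qx.
  have [qa qaP] := app a.
  have [qb qbP] := choice (fun j => app ((b : 'rV[R]_n) 0 j)).
  exists (qa, \row_j qb j, k) => //; rewrite asboolT; last first.
    move=> [a' b'] [/= aa' [_ bb']]; apply: eU; split => // i j.
    rewrite /cons_rV !mxE; case: splitP => l _.
      rewrite (ord1 l) ord1 !mxE /= !mulr1n /ball/=.
      rewrite (le_lt_trans (ler_distD (ratr qa) _ _))// [ltRHS]splitr.
      by rewrite ltrD// (lt_trans _ ke)// distrC.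
    rewrite ord1 /ball/=.
    rewrite (le_lt_trans (ler_distD (ratr (qb l)) _ _))// [ltRHS]splitr.
    have bl : `|ratr (qb l) - b' 0 l| < k.+1%:R^-1.
      by have := bb' 0 l; rewrite !mxE.
    by rewrite ltrD// (lt_trans _ ke)// distrC; exact: qbP.
  split=> /=; first by rewrite /ball/=.
  by split => // i j; rewrite !mxE ord1; exact: qbP.
by apply: countable_bigcupT_measurable => // c; case: asboolP.
Qed.

Lemma sigma_finite_measure_of d (T : measurableType d) (R : realType)
    (f : set T -> \bar R) :
  f set0 = 0%E -> (forall A, 0 <= f A)%E -> semi_sigma_additive f ->
  sigma_finite setT f ->
  exists mu : {sigma_finite_measure set T -> \bar R}, (mu : set _ -> _) = f.
Proof.
move=> f0 f_ge0 f_sigma f_sf.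
pose fM := isMeasure.Build _ _ _ f f0 f_ge0 f_sigma.
pose fm : {measure set T -> \bar R} := HB.pack f fM.
pose fS := Measure_isSigmaFinite.Build _ _ _ fm f_sf.
by exists (HB.pack_for {sigma_finite_measure set T -> \bar R} f fM fS).
Qed.

Lemma lebesgue_rV_sigma_finite_measure (R : realType) (n : nat) :
  exists mu : {sigma_finite_measure set (borel_rV R n) -> \bar R},
    (mu : set _ -> _) = @lebesgue_rV R n.
Proof.
elim: n => [|n [mu muE]] /=.
  by exists (@dirac _ (borel_rV R 0) (0 : 'rV[R]_0) R).
rewrite -muE.
have nu_sf : sigma_finite setT
    (pushforward (@lebesgue_measure R \x mu)%E (@cons_rV R n)).
  have /sigma_finiteP[F [TF ndF Foo]] := sigma_finiteT (@lebesgue_measure R).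
  have /sigma_finiteP[G [TG ndG Goo]] := sigma_finiteT mu.
  exists (fun k => @uncons_rV R n @^-1` (F k `*` G k)).
    rewrite -preimage_bigcup (_ : \bigcup_i _ = setT) ?preimage_setT//.
    rewrite -setXTT TF TG; apply/seteqP; split=> [p [k _ [Fp Gp]]|p].
      by split; exists k.
    move=> [[i _ Fp] [j _ Gp]]; exists (maxn i j) => //; split.
      by move: p.1 Fp; exact/subsetPset/ndF/leq_maxl.
    by move: p.2 Gp; exact/subsetPset/ndG/leq_maxr.
  move=> k; have [mF Fk] := Foo k; have [mG Gk] := Goo k; split.
    rewrite -[X in measurable X]setTI; apply: measurable_uncons_rV => //.
    exact: measurableX.
  rewrite /pushforward -comp_preimage.
  rewrite (_ : _ \o _ = id); last by apply/funext => p /=; exact: cons_rVK.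
  by rewrite preimage_id product_measure1E// lte_mul_pinfty// ge0_fin_numE.
have [nu nuE] : exists nu : {measure set (borel_rV R n.+1) -> \bar R},
    (nu : set _ -> _) =
    pushforward (@lebesgue_measure R \x mu)%E (@cons_rV R n).
  exists (measure_function_pushforward__canonical__measure_function_Measure
    [the {measure set _ -> \bar R} of (@lebesgue_measure R \x mu)%E]
    (@measurable_cons_rV R n)).
  by [].
apply: sigma_finite_measure_of; rewrite -?nuE//.
- exact: measure_semi_sigma_additive.
- by rewrite nuE.
Qed.

Section lebesgue_rV_measure.
Context (R : realType) (n : nat).

Let lebesgue_rV0 : lebesgue_rV R n set0 = 0%E.
Proof.
by have [mu <-] := lebesgue_rV_sigma_finite_measure R n; exact: measure0.
Qed.

Let lebesgue_rV_ge0 A : (0 <= lebesgue_rV R n A)%E.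
Proof.
by have [mu <-] := lebesgue_rV_sigma_finite_measure R n; exact: measure_ge0.
Qed.

Let lebesgue_rV_sigma_additive : semi_sigma_additive (lebesgue_rV R n).
Proof.
have [mu <-] := lebesgue_rV_sigma_finite_measure R n.
exact: measure_semi_sigma_additive.
Qed.

HB.instance Definition _ := isMeasure.Build _ _ _ (lebesgue_rV R n)
  lebesgue_rV0 lebesgue_rV_ge0 lebesgue_rV_sigma_additive.

Let lebesgue_rV_sigma_finite : sigma_finite setT (lebesgue_rV R n).
Proof.
by have [mu <-] := lebesgue_rV_sigma_finite_measure R n; exact: sigma_finiteT.
Qed.

HB.instance Definition _ := Measure_isSigmaFinite.Build _ _ _
  (lebesgue_rV R n) lebesgue_rV_sigma_finite.

End lebesgue_rV_measure.

Definition dotv (R : realType) (n : nat) (x y : 'rV[R]_n) : R :=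
  \sum_j x 0 j * y 0 j.

(* The library norm `|x| on row vectors is the sup norm. *)
Definition enorm (R : realType) (n : nat) (x : 'rV[R]_n) : R :=
  Num.sqrt (dotv x x).

Definition boundary (T : topologicalType) (A : set T) : set T :=
  closure A `\` interior A.

Definition unit_ball_volume (R : realType) (s : nat) : R :=
  fine (lebesgue_rV R s [set x | enorm (x : 'rV[R]_s) <= 1]).

Definition ediam (R : realType) (n : nat) (C : set 'rV[R]_n) : R :=
  sup [set enorm (p.1 - p.2) | p in C `*` C].

(* For s = 0 every nonempty set has weight 1, so that the 0-dimensional
   Hausdorff measure is the counting measure. *)
Definition hausdorff_weight (R : realType) (s n : nat) (C : set 'rV[R]_n) : R :=
  if C == set0 then 0 else unit_ball_volume R s * (ediam C / 2) ^+ s.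

Definition hausdorff_cover (R : realType) (n : nat) (delta : R)
    (A : set 'rV[R]_n) : set ((set 'rV[R]_n)^nat) :=
  [set C | A `<=` \bigcup_k C k /\
           forall k x y, C k x -> C k y -> enorm (x - y) <= delta].

(* The s-dimensional Hausdorff measure on R^n, normalised so that it agrees
   with s-dimensional surface area. *)
Definition hausdorff_measure (R : realType) (s n : nat)
    (A : set (borel_rV R n)) : \bar R :=
  ereal_sup [set ereal_inf
      [set (\sum_(0 <= k <oo) (hausdorff_weight s (C k))%:E)%E
        | C in hausdorff_cover delta A]
    | delta in [set delta : R | 0 < delta]].

Definition surface_measure (R : realType) (n : nat) :
    set (borel_rV R n.+1) -> \bar R :=
  @hausdorff_measure R n n.+1.

(* After the rigid motion y |-> y *m Q and within distance rho of x, K is the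
   strict hypograph of phi; the distinguished coordinate is coordinate 0. *)
Definition lipschitz_chart (R : realType) (n : nat) (K : set 'rV[R]_n.+1)
    (x : 'rV[R]_n.+1) (Q : 'M[R]_n.+1) (rho : R) (phi : 'rV[R]_n -> R) : Prop :=
  [/\ Q *m Q^T = 1%:M, 0 < rho, lipschitz phi &
      forall y, enorm (y - x) < rho ->
        (K y <-> (y *m Q) 0 0 < phi (col' 0 (y *m Q)))].

Definition lipschitz_domain (R : realType) (n : nat) (K : set 'rV[R]_n.+1) :
    Prop :=
  [/\ open K, connected K, bounded_set K, K !=set0 &
      forall x, boundary K x ->
        exists Q rho phi, lipschitz_chart K x Q rho phi].

Definition grad (R : realType) (n : nat) (phi : 'rV[R]_n -> R)
    (z : 'rV[R]_n) : 'rV[R]_n :=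
  \row_j 'D_(delta_mx 0 j) phi z.

(* In the coordinates of a chart, K lies below the graph of phi and its outward
   normal is (1, - grad phi), normalised. It exists where the graph has a
   tangent plane, i.e. almost everywhere on the boundary. *)
Definition outward_unit_normal (R : realType) (n : nat) (K : set 'rV[R]_n.+1)
    (x nu : 'rV[R]_n.+1) : Prop :=
  boundary K x /\
  exists Q rho phi, lipschitz_chart K x Q rho phi /\
    let z := col' 0 (x *m Q) in
    let w : 'rV[R]_n.+1 := row_mx (1%:M : 'rV[R]_1) (- grad phi z) in
    differentiable phi z /\ nu = (enorm w)^-1 *: (w *m Q^T).

(* A face is a regular closed subset of a hyperplane. *)
Definition planar_face (R : realType) (n : nat) (P : set 'rV[R]_n.+1) : Prop :=
  exists (a : 'rV[R]_n.+1) (c : R),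
    let H := [set y | dotv a y = c] in
    [/\ a != 0, P `<=` H &
        P = closure [set y | P y /\ \forall z \near y, H z -> P z]].

(* The centre may lie on the boundary of the set A, hence outside A. *)
Definition star_shaped (R : realType) (n : nat) (A : set 'rV[R]_n)
    (x0 : 'rV[R]_n) : Prop :=
  forall y (t : R), A y -> 0 < t <= 1 -> A (x0 + t *: (y - x0)).

Definition m_dot_n (R : realType) (n : nat) (K F : set 'rV[R]_n.+1)
    (x0 : 'rV[R]_n.+1) : set R :=
  [set s | exists x nu,
     [/\ F x, outward_unit_normal K x nu & s = dotv (x - x0) nu]].

Definition min_m_dot_n (R : realType) (n : nat) (K F : set 'rV[R]_n.+1)
    (x0 : 'rV[R]_n.+1) : R :=
  inf (m_dot_n K F x0).

Definition sub_element (R : realType) (n : nat) (K F KF : set 'rV[R]_n.+1)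
    (x0 : 'rV[R]_n.+1) : Prop :=
  [/\ open KF, KF `<=` K, star_shaped KF x0 &
      F `<=` boundary KF /\
      exists P : 'I_n.+1 -> set 'rV[R]_n.+1,
        [/\ injective P, forall j, planar_face (P j), forall j, P j x0 &
            boundary KF = F `|` \bigcup_j P j]].

Definition piecewise_star_shaped (R : realType) (n nK : nat)
    (K : set 'rV[R]_n.+1) (F KF : 'I_nK -> set 'rV[R]_n.+1)
    (x0 : 'I_nK -> 'rV[R]_n.+1) : Prop :=
  [/\ boundary K = \bigcup_i F i,
      trivIset setT F,
      forall i, measurable (F i : set (borel_rV R n.+1)) &
      forall i,
        [/\ K (x0 i),
            sub_element K (F i) (KF i) (x0 i),
            forall s, m_dot_n K (F i) (x0 i) s -> 0 < s &
            0 < min_m_dot_n K (F i) (x0 i)]].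

Definition total_degree_le (R : realType) (n r : nat) (v : mpoly.mpoly n R) :
    Prop :=
  (mpoly.msize v <= r.+1)%N.

Definition poly_eval (R : realType) (n : nat) (v : mpoly.mpoly n R)
    (x : 'rV[R]_n) : R :=
  mpoly.meval (fun j => x 0 j) v.

Definition C_inv (R : realType) (d : nat) : R :=
  match d with 1 => 1 | 2 => 4 | _ => 8 end.

(* Main.v *)
(* Write a point z of K_F as z = x0 + t (y - x0), where y is the point at which the
   ray from x0 through z leaves K_F and t lies in ]0, 1]. By dilation, Lebesgue
   measure on K_F becomes the product of (n+1) t^n dt and the measure nu, where
   nu(B) is the volume of the union of the rays that leave K_F in B.

   On F, surface measure is at most (n+1) nu / min(m.n). At a point of F off the
   planar faces where the outward normal exists, the boundary lies between two thin
   cones around the tangent plane, so nu of a ball of radius rho around it is almost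
   the volume of the cone from x0 over a tangent disc of radius rho; a Vitali
   covering turns this into a bound for Hausdorff measure. The remaining points of
   F project to null sets in the charts: by Rademacher's theorem, needed only for
   functions of at most two variables, and because F meets the hyperplanes through
   x0 transversally.

   On a ray, p(t) = v (x0 + t (y - x0)) is a polynomial of degree at most r, and a
   Remez-type inequality gives |p(1)| <= 2 |p(t)| on a subset of [a, 1] of length at
   least (1 - a) / (4 r^2 + 2). Hence the integral of |v|^q over K_F is at least
   2^-q (n+1) a^n (1 - a) / (4 r^2 + 2) times the integral of |v|^q against nu. *)
From HB Require Import structures.
Require Import Defs.
From mathcomp Require Import all_boot all_order all_algebra.
From mathcomp Require Import -(notations) mpoly.
From mathcomp Require Import all_classical all_reals all_analysis.
From mathcomp Require Import perm measurable_realfun.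
From mathcomp Require Import ring lra zify.
Set Implicit Arguments.
Unset Strict Implicit.
Unset Printing Implicit Defensive.
Import Order.TTheory GRing.Theory Num.Theory.
Import numFieldNormedType.Exports.
Local Open Scope classical_set_scope.
Local Open Scope ring_scope.

(** * Lebesgue measure on row vectors *)

(** [surface_measure] is a bare set function; it enters only through its value on the empty set and
    through upper bounds on Borel subsets of F. These bounds come from packings: if all finite
    families of disjoint balls centred on a set, with radii below a pointwise threshold, satisfy sum
    rho^n <= T, then the Hausdorff measure of the set is at most omega_n T.

    The main obstacle is that the normal belongs to K while the rays live in K_F. The inclusion of
    K_F in K places K_F on one side of the tangent plane only up to a thin cone; that K_F fills this
    side near the point has to be derived from star-shapedness and from the fact that, off the
    planar faces, the boundary of K_F is part of the boundary of K.

    Origin of the constants: the factor n+1 in the surface bound cancels against the radial density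
    (n+1) t^n; 2^(q+1) is 2^q from the factor 2 in the Remez inequality times the 2 in 4 r^2 + 2 = 2
    (2 r^2 + 1); C_inv is 1 / (a^n (1 - a)), with a = 0 for d = 1 and a = 1/2 for d = 2, 3. *)

Lemma ex_pushforward_measure d1 d2 (T1 : measurableType d1)
    (T2 : measurableType d2) (R : realType) (mu : {measure set T1 -> \bar R})
    (f : T1 -> T2) :
  measurable_fun setT f ->
  exists nu : {measure set T2 -> \bar R},
    forall A, nu A = mu (f @^-1` A).
Proof.
move=> mf.
by exists (measure_function_pushforward__canonical__measure_function_Measure
  mu mf).
Qed.

Lemma measurable_affine (R : realType) (c b : R) :
  measurable_fun setT
    (fun x : measurableTypeR R => c * x + b : measurableTypeR R).
Proof. by apply: measurable_funD => //; exact: measurable_funM. Qed.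

(** Uniqueness reduces this to intervals ]u, v]; for negative c the preimage is closed at the other
    end, hence two computations. *)
Lemma lebesgue_measure_affine (R : realType) (c b : R) (A : set R) :
  c != 0 -> measurable A ->
  @lebesgue_measure R ((fun x => c * x + b) @^-1` A) =
  (`|c|^-1%:E * @lebesgue_measure R A)%E.
Proof.
move=> c0 mA.
have mf := measurable_affine c b.
have [nu nuE] := ex_pushforward_measure (@lebesgue_measure R) mf.
have c_gt0 : 0 < `|c| by rewrite normr_gt0.
have k0 : 0 <= `|c| by [].
suff -> : @lebesgue_measure R A = (`|c|%:E * nu A)%E.
  by rewrite nuE muleA -EFinM mulVf ?gt_eqF// mul1e.
have := @lebesgue_measure_unique R (mscale (NngNum k0) nu).
move=> /(_ _ A mA); apply => X [[u v] _ <-].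
rewrite /= /mscale/= nuE.
have litv := @lebesgue_measure_itv R.
have [c_pos|c_neg|] := ltgtP 0 c; last by move=> c00; rewrite -c00 eqxx in c0.
- rewrite (_ : _ @^-1` _ = [set` `](u - b) / c, (v - b) / c]]).
    rewrite litv [X in (_ * X)%E](litv `](u - b) / c, (v - b) / c])/= !lte_fin ltr_pM2r ?invr_gt0// ltrD2r.
    case: ifPn => _; last by rewrite mule0.
    by rewrite -!EFinD -EFinM; congr EFin; rewrite gtr0_norm//; field.
  apply/seteqP; split => x /=; rewrite !in_itv/= ltr_pdivrMr// ler_pdivlMr//;
    by rewrite ltrBlDr lerBrDr [x * c]mulrC.
- rewrite (_ : _ @^-1` _ = [set` `[(v - b) / c, (u - b) / c[]).
    rewrite litv [X in (_ * X)%E](litv `[(v - b) / c, (u - b) / c[)/= !lte_fin ltr_nM2r ?invr_lt0// ltrD2r.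
    case: ifPn => _; last by rewrite mule0.
    by rewrite -!EFinD -EFinM; congr EFin; rewrite ltr0_norm//; field.
  apply/seteqP; split => x /=; rewrite !in_itv/= ltr_ndivlMr// ler_ndivrMr//;
    by rewrite ltrBlDr lerBrDr [x * c]mulrC andbC.
Qed.

Lemma lebesgue_rVE (R : realType) (n : nat) (A : set (borel_rV R n.+1)) :
  lebesgue_rV R n.+1 A =
  (\int[@lebesgue_measure R]_a
     lebesgue_rV R n [set b | A (cons_rV (a, b))])%E.
Proof.
rewrite /= /pushforward /product_measure1 /=.
apply: eq_integral => a _ /=; congr (lebesgue_rV _ _ _).
by apply/seteqP; split => b; rewrite /xsection/= inE.
Qed.

Lemma measurable_rV_coord (R : realType) (n : nat) (j : 'I_n) :
  measurable_fun setT (fun x : borel_rV R n => (x : 'rV[R]_n) 0 j : measurableTypeR R).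
Proof.
apply: (measurability _ (RGenOpens.measurableE R)).
move=> _ [_ [a [b ->] <-]]; rewrite setTI; apply: sub_gen_smallest.
by apply: open_comp; [move=> x _; exact: coord_continuous|exact: interval_open].
Qed.

Lemma measurable_funP_rV (R : realType) (n : nat) d (T : measurableType d)
    (f : T -> borel_rV R n) :
  (forall j, measurable_fun setT (fun x => (f x : 'rV[R]_n) 0 j : measurableTypeR R)) ->
  measurable_fun setT f.
Proof.
elim: n f => [|n IH] f mf.
  rewrite (_ : f = cst (0 : 'rV[R]_0)); first exact: measurable_cst.
  by apply/funext => x; apply/rowP => -[].
rewrite (_ : f = @cons_rV R n \o (fun x => uncons_rV (f x))); last first.
  by apply/funext => x /=; rewrite uncons_rVK.
apply: measurableT_comp; first exact: measurable_cons_rV.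
apply/measurable_fun_pair => /=.
  exact: (mf 0).
apply: IH => j.
by under eq_fun do rewrite mxE; exact: mf.
Qed.

Lemma open_measurable_rV (R : realType) (n : nat) (A : set 'rV[R]_n) :
  open A -> measurable (A : set (borel_rV R n)).
Proof. by move=> oA; exact: sub_gen_smallest. Qed.

Lemma closed_measurable_rV (R : realType) (n : nat) (A : set 'rV[R]_n) :
  closed A -> measurable (A : set (borel_rV R n)).
Proof.
move=> cA; rewrite -[A]setCK; apply: measurableC.
by apply: open_measurable_rV; exact: closed_openC.
Qed.

Lemma continuous_measurable_rV (R : realType) (n m : nat)
    (f : 'rV[R]_n -> 'rV[R]_m) :
  continuous f -> measurable_fun setT (f : borel_rV R n -> borel_rV R m).
Proof.
move=> cf.
apply: (@measurability _ _ _ (borel_rV R m) setT _ (@open 'rV[R]_m) erefl) => //.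
move=> _ [U oU <-]; rewrite setTI; apply: sub_gen_smallest.
by apply: open_comp => // x _; exact: cf.
Qed.

Lemma ge0_integral_lebesgue_affine (R : realType) (c b : R)
    (f : R -> \bar R) : c != 0 ->
  measurable_fun setT f -> (forall x, 0 <= f x)%E ->
  (\int[@lebesgue_measure R]_x f (c * x + b)%R =
   `|c|^-1%:E * \int[@lebesgue_measure R]_x f x)%E.
Proof.
move=> c0 mf f0.
have mg := measurable_affine c b.
have := ge0_integral_pushforward mg (@lebesgue_measure R) measurableT mf (fun x _ => f0 x).
rewrite preimage_setT => <-.
have k0 : 0 <= `|c|^-1 by rewrite invr_ge0.
rewrite -(@ge0_integral_mscale _ _ R (@lebesgue_measure R) setT measurableT (NngNum k0) f)//.
apply: eq_measure_integral => A mA _.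
by rewrite /pushforward [RHS]/= /mscale/= -(lebesgue_measure_affine b).
Qed.

Lemma lebesgue_rV_affine (R : realType) (n : nat) (c : R) (b : 'rV[R]_n)
    (A : set (borel_rV R n)) :
  c != 0 -> measurable A ->
  lebesgue_rV R n ((fun x : 'rV[R]_n => c *: x + b) @^-1` A) =
  ((`|c| ^- n)%:E * lebesgue_rV R n A)%E.
Proof.
move=> c0; elim: n b A => [|n IH] b A mA.
  rewrite expr0 invr1 mul1e /= (_ : _ @^-1` _ = A)//.
  by apply/seteqP; split => x /=; rewrite (_ : c *: x + b = x) //;
    apply/rowP => -[].
have mAa a : measurable ([set y | A (cons_rV (a, y))] : set (borel_rV R n)).
  rewrite -[X in measurable X]setTI.
  have : measurable_fun setT (fun y : borel_rV R n => cons_rV (a, y)).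
    apply: measurableT_comp; first exact: measurable_cons_rV.
    by apply/measurable_fun_pair.
  exact.
rewrite !lebesgue_rVE.
pose g a := lebesgue_rV R n [set y | A (cons_rV (a, y))].
have mg : measurable_fun setT (g : measurableTypeR R -> \bar R).
  have := @measurable_fun_xsection _ _ (measurableTypeR R) (borel_rV R n) R
    (lebesgue_rV R n) (@cons_rV R n @^-1` A).
  rewrite (_ : _ \o _ = g).
    apply; rewrite -[X in measurable X]setTI.
    exact: measurable_cons_rV.
  by apply/funext => a /=; congr (lebesgue_rV _ _ _);
    apply/seteqP; split => y; rewrite /xsection/= inE.
pose b' : 'rV[R]_n := \row_j b 0 (lift 0 j).
transitivity ((`|c| ^- n)%:E * \int[@lebesgue_measure R]_a g (c * a + b 0 0)%R)%E.
  rewrite -ge0_integralZl//.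
  - apply: eq_integral => a _; rewrite -(IH b')//; congr (lebesgue_rV _ _ _).
    apply/seteqP; split => y /=; congr A; apply/rowP => j;
    rewrite /cons_rV !mxE /=; case: splitP => k jk;
    by rewrite ?mxE ?ord1/= ?mulr1n; congr (_ + b _ _); apply/val_inj;
      rewrite /= ?jk ?ord1.
  - exact: (measurableT_comp mg (measurable_affine _ _)).
rewrite ge0_integral_lebesgue_affine// muleA -EFinM exprS invfM.
by rewrite [X in (X%:E * _)%E]mulrC.
Qed.

(** * Euclidean geometry *)

Section euclidean.
Context (R : realType) (n : nat).
Implicit Types x y z : 'rV[R]_n.

Lemma dotvC x y : dotv x y = dotv y x.
Proof. by apply: eq_bigr => j _; rewrite mulrC. Qed.

Lemma dotvDl x y z : dotv (x + y) z = dotv x z + dotv y z.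
Proof. by rewrite -big_split/=; apply: eq_bigr => j _; rewrite mxE mulrDl. Qed.

Lemma dotvZl (a : R) x y : dotv (a *: x) y = a * dotv x y.
Proof. by rewrite mulr_sumr; apply: eq_bigr => j _; rewrite mxE mulrA. Qed.

Lemma dotvNl x y : dotv (- x) y = - dotv x y.
Proof. by rewrite -scaleN1r dotvZl mulN1r. Qed.

Lemma dotvDr x y z : dotv z (x + y) = dotv z x + dotv z y.
Proof. by rewrite dotvC dotvDl !(dotvC z). Qed.

Lemma dotvZr (a : R) x y : dotv x (a *: y) = a * dotv x y.
Proof. by rewrite dotvC dotvZl dotvC. Qed.

Lemma dotvNr x y : dotv x (- y) = - dotv x y.
Proof. by rewrite dotvC dotvNl dotvC. Qed.

Lemma dotvBl x y z : dotv (x - y) z = dotv x z - dotv y z.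
Proof. by rewrite dotvDl dotvNl. Qed.

Lemma dotvBr x y z : dotv z (x - y) = dotv z x - dotv z y.
Proof. by rewrite dotvDr dotvNr. Qed.

Lemma dot0v x : dotv 0 x = 0.
Proof. by rewrite -(scale0r 0) dotvZl mul0r. Qed.

Lemma dotv_ge0 x : 0 <= dotv x x.
Proof. by apply: sumr_ge0 => j _; rewrite -expr2 sqr_ge0. Qed.

Lemma enorm_ge0 x : 0 <= enorm x. Proof. exact: sqrtr_ge0. Qed.

Lemma enorm_sqr x : enorm x ^+ 2 = dotv x x.
Proof. by rewrite sqr_sqrtr// dotv_ge0. Qed.

Lemma enorm0 : enorm (0 : 'rV[R]_n) = 0.
Proof. by rewrite /enorm dot0v sqrtr0. Qed.

Lemma coord_le_enorm x j : `|x 0 j| <= enorm x.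
Proof.
rewrite -ler_sqr ?nnegrE ?enorm_ge0 ?normr_ge0// enorm_sqr real_normK ?num_real//.
rewrite /dotv (bigD1 j)//= -expr2 lerDl; apply: sumr_ge0 => i _.
by rewrite -expr2 sqr_ge0.
Qed.

Lemma enorm_eq0 x : enorm x = 0 -> x = 0.
Proof.
move=> x0; apply/rowP => j; rewrite mxE; apply/eqP; rewrite -normr_le0 -x0.
exact: coord_le_enorm.
Qed.

Lemma enormZ (a : R) x : enorm (a *: x) = `|a| * enorm x.
Proof.
rewrite /enorm dotvZl dotvZr mulrA -expr2 sqrtrM ?sqr_ge0//.
by rewrite sqrtr_sqr.
Qed.

Lemma enormN x : enorm (- x) = enorm x.
Proof. by rewrite -scaleN1r enormZ normrN1 mul1r. Qed.

Lemma enormB x y : enorm (x - y) = enorm (y - x).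
Proof. by rewrite -enormN opprB. Qed.

Lemma cauchy_schwarz_dotv x y : `|dotv x y| <= enorm x * enorm y.
Proof.
have [->|y0] := eqVneq y 0.
  by rewrite dotvC dot0v normr0 mulr_ge0// enorm_ge0.
have ey : 0 < enorm y.
  rewrite lt_neqAle enorm_ge0 andbT eq_sym.
  by apply: contra y0 => /eqP /enorm_eq0 ->.
have := dotv_ge0 (enorm y ^+ 2 *: x - dotv x y *: y).
rewrite dotvBl !dotvBr !dotvZl !dotvZr -!enorm_sqr (dotvC y x).
set a := enorm x; set b := enorm y; set c := dotv x y => H.
rewrite -ler_sqr ?nnegrE ?mulr_ge0 ?enorm_ge0 ?normr_ge0//.
rewrite real_normK ?num_real//.
have : 0 <= b ^+ 2 * ((a * b) ^+ 2 - c ^+ 2).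
  by apply: le_trans H _; rewrite le_eqVlt; apply/orP; left; apply/eqP; ring.
by rewrite pmulr_rge0 ?exprn_gt0// subr_ge0.
Qed.

Lemma ler_enormD x y : enorm (x + y) <= enorm x + enorm y.
Proof.
rewrite -ler_sqr ?nnegrE ?addr_ge0 ?enorm_ge0// enorm_sqr dotvDl !dotvDr.
have := le_trans (ler_norm _) (cauchy_schwarz_dotv x y).
rewrite -!enorm_sqr (dotvC y x) sqrrD; lra.
Qed.

Lemma ler_enormB x y z : enorm (x - z) <= enorm (x - y) + enorm (y - z).
Proof. by rewrite -[x - z](subrKA y) ler_enormD. Qed.

Lemma ler_dist_enorm x y : `|enorm x - enorm y| <= enorm (x - y).
Proof.
rewrite ler_norml; move: (ler_enormB x y 0) (ler_enormB y x 0).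
by rewrite !subr0 (enormB y x); lra.
Qed.

Lemma norm_le_enorm x : `|x| <= enorm x.
Proof.
rewrite [leLHS]mx_normrE bigmax_le ?enorm_ge0// => -[i j] _ /=.
by rewrite ord1 coord_le_enorm.
Qed.

Lemma coord_le_norm x j : `|x 0 j| <= `|x|.
Proof. by rewrite [leRHS]mx_normrE (le_bigmax _ (fun i => `|x i.1 i.2|) (0, j)). Qed.

Lemma enorm_le_norm x : enorm x <= n%:R * `|x|.
Proof.
rewrite -ler_sqr ?nnegrE ?mulr_ge0 ?enorm_ge0// enorm_sqr.
apply: (@le_trans _ _ (\sum_(j < n) `|x| ^+ 2)).
  apply: ler_sum => j _; rewrite -expr2 -real_normK ?num_real//.
  by rewrite ler_sqr ?nnegrE// coord_le_norm.
rewrite sumr_const card_ord -[leLHS]mulr_natl exprMn.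
rewrite ler_wpM2r ?sqr_ge0// -natrX ler_nat.
by case: (n) => // k; rewrite -{1}[k.+1]expn1 leq_pexp2l.
Qed.

Lemma ball_rVE x (e : R) y : ball x e y = (`|x - y| < e).
Proof. by rewrite mx_norm_ball. Qed.

Lemma nbhs_enormP x (A : set 'rV[R]_n) :
  nbhs x A <-> exists2 e, 0 < e & forall y, enorm (y - x) < e -> A y.
Proof.
split=> [/nbhs_ballP[e /= e0 eA]|[e e0 eA]].
  exists e => // y yx; apply: eA; rewrite ball_rVE distrC.
  exact: le_lt_trans (norm_le_enorm _) yx.
have k0 : 0 < n%:R + 1 :> R by rewrite ltr_wpDl.
apply/nbhs_ballP; exists (e / (n%:R + 1)); first by rewrite /= divr_gt0.
move=> y; rewrite ball_rVE distrC ltr_pdivlMr// => yx; apply: eA.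
apply: le_lt_trans (enorm_le_norm _) _; apply: le_lt_trans yx.
by rewrite mulrC ler_wpM2l// lerDl.
Qed.

Lemma open_enorm_ball x (e : R) : open [set y | enorm (y - x) < e].
Proof.
rewrite openE => y /= yx; apply/nbhs_enormP; exists (e - enorm (y - x)).
  by rewrite subr_gt0.
move=> z zy /=; apply: le_lt_trans (ler_enormB _ y _) _.
by rewrite -ltrBrDr.
Qed.

Lemma closed_enorm_ball x (e : R) : closed [set y | enorm (y - x) <= e].
Proof.
rewrite -openC openE => y /= /negP; rewrite -ltNge => yx.
apply/nbhs_enormP; exists (enorm (y - x) - e); first by rewrite subr_gt0.
move=> z zy /= zx; move: (ler_enormB y z x); rewrite (enormB y z); lra.
Qed.

Lemma enorm_lipschitz_continuous (f : 'rV[R]_n -> R) (k : R) :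
  (forall x y, `|f x - f y| <= k * enorm (x - y)) -> continuous f.
Proof.
move=> fk x A /nbhs_ballP[e /= e0 eA].
have k0 : 0 < `|k| + 1 by rewrite ltr_wpDl.
apply/nbhs_enormP; exists (e / (`|k| + 1)); first by rewrite divr_gt0.
move=> y; rewrite ltr_pdivlMr// => xy; apply: eA; rewrite /ball/=.
apply: le_lt_trans (fk _ _) _; apply: le_lt_trans xy.
rewrite enormB mulrC ler_wpM2l ?enorm_ge0//.
by rewrite (le_trans (ler_norm _))// lerDl.
Qed.

Lemma continuous_dotv x : continuous (dotv x).
Proof.
apply: (@enorm_lipschitz_continuous _ (enorm x)) => y z.
by rewrite -dotvBr cauchy_schwarz_dotv.
Qed.

End euclidean.

Lemma enorm_lipschitz_continuous_rV (R : realType) (n m : nat)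
    (f : 'rV[R]_n -> 'rV[R]_m) (k : R) :
  (forall x y, enorm (f x - f y) <= k * enorm (x - y)) -> continuous f.
Proof.
move=> fk x A /nbhs_enormP[e e0 eA].
have k0 : 0 < `|k| + 1 by rewrite ltr_wpDl.
apply/nbhs_enormP; exists (e / (`|k| + 1)); first by rewrite divr_gt0.
move=> y; rewrite ltr_pdivlMr// => xy; apply: eA.
apply: le_lt_trans (fk _ _) _; apply: le_lt_trans xy.
rewrite mulrC ler_wpM2l ?enorm_ge0//.
by rewrite (le_trans (ler_norm _))// lerDl.
Qed.

(** * Orthogonal maps and their effect on volume *)

Section orthogonal.
Context (R : realType) (n : nat) (Q : 'M[R]_n).
Hypothesis QQ : Q *m Q^T = 1%:M.

Lemma dotvE (x y : 'rV[R]_n) : dotv x y = (x *m y^T) 0 0.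
Proof. by rewrite mxE; apply: eq_bigr => j _; rewrite mxE. Qed.

Lemma dotv_orth (x y : 'rV[R]_n) : dotv (x *m Q) (y *m Q) = dotv x y.
Proof.
by rewrite !dotvE trmx_mul mulmxA -(mulmxA x) QQ mulmx1.
Qed.

Lemma enorm_orth (x : 'rV[R]_n) : enorm (x *m Q) = enorm x.
Proof. by rewrite /enorm dotv_orth. Qed.

Lemma orth_trK : Q^T *m Q = 1%:M.
Proof. exact: mulmx1C. Qed.

Lemma continuous_orth : continuous (fun x : 'rV[R]_n => x *m Q).
Proof.
apply: (@enorm_lipschitz_continuous_rV _ _ _ _ 1) => x y.
by rewrite -mulmxBl enorm_orth mul1r.
Qed.

(* The double integral of 1_A(xQ) 1_B(xQ + y) equals |A Q^T| |B|; after the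
   substitution y = z - xQ it also equals |B Q^T| |A|. *)
Lemma lebesgue_rV_orth_ratio (A B : set (borel_rV R n)) :
  measurable A -> measurable B ->
  (lebesgue_rV R n [set x : 'rV[R]_n | A (x *m Q)] * lebesgue_rV R n B =
   lebesgue_rV R n [set x : 'rV[R]_n | B (x *m Q)] * lebesgue_rV R n A)%E.
Proof.
move=> mA mB; pose L := lebesgue_rV R n.
have mQ : measurable_fun setT (fun x : borel_rV R n => (x : 'rV[R]_n) *m Q : borel_rV R n).
  by apply: (@continuous_measurable_rV _ _ _ (mulmx^~ Q)); exact: continuous_orth.
have mQA (C : set (borel_rV R n)) : measurable C -> measurable ([set x : 'rV[R]_n | C (x *m Q)] : set (borel_rV R n)).
  by move=> mC; rewrite -[X in measurable X]setTI; exact: mQ.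
have mlin (s : R) : measurable_fun setT
    (fun p : borel_rV R n * borel_rV R n => (p.1 : 'rV[R]_n) *m Q + s *: (p.2 : 'rV[R]_n) : borel_rV R n).
  apply: measurable_funP_rV => j.
  under eq_fun do rewrite !mxE.
  apply: measurable_funD.
    have := measurableT_comp (measurable_rV_coord j) (measurableT_comp mQ (@measurable_fst _ _ (borel_rV R n) (borel_rV R n))).
    by apply: eq_measurable_fun => p _ /=; rewrite mxE.
  apply: measurable_funM => //.
  exact: (measurableT_comp (measurable_rV_coord j) measurable_snd).
pose W (s : R) (C D : set (borel_rV R n)) : set (borel_rV R n * borel_rV R n) :=
  [set p | C ((p.1 : 'rV[R]_n) *m Q) /\
           D ((p.1 : 'rV[R]_n) *m Q + s *: (p.2 : 'rV[R]_n))].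
have mS2 (s : R) (C D : set (borel_rV R n)) : measurable C -> measurable D ->
   measurable (W s C D).
  move=> mC mD; apply: measurableI.
    rewrite -[X in measurable X]setTI.
    exact: (measurableT_comp mQ measurable_fst).
  by rewrite -[X in measurable X]setTI; exact: mlin.
have int1 (s : R) (C D : set (borel_rV R n)) : s != 0 -> `|s| = 1 -> measurable C -> measurable D ->
  (\int[L]_x L (xsection (W s C D) x) =
   L [set x : 'rV[R]_n | C (x *m Q)%R] * L D)%E.
  move=> s0 s1 mC mD.
  rewrite [RHS]muleC -integral_cst; last exact: mQA.
  rewrite [RHS]integral_mkcond; apply: eq_integral => x _.
  rewrite patchE; case: ifPn => [/set_mem/= Cx|/negP xC].
    transitivity (L ((fun y : 'rV[R]_n => s *: y + x *m Q) @^-1` D)).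
      congr (L _); apply/seteqP; split => y; rewrite /xsection/= inE/= addrC.
        by case.
      by [].
    by rewrite /L lebesgue_rV_affine// s1 expr1n invr1 mul1e.
  have Cx : ~ C (x *m Q) by move=> h; apply: xC; exact: mem_set.
  suff -> : xsection (W s C D) x = set0 by rewrite /L measure0.
  by apply/seteqP; split => y //; rewrite /xsection/= inE/= => -[].
have := int1 1 A B (oner_neq0 _) (normr1 _) mA mB.
rewrite -/L => <-.
have N1 : (-1 : R) != 0 by rewrite oppr_eq0 oner_neq0.
have := int1 (-1) B A N1 (normrN1 _) mB mA.
move=> <-.
have tonelli X : measurable X ->
    (\int[L]_x L (xsection X x) = \int[L]_y L (ysection X y))%E.
  move=> mX; have := indic_fubini_tonelli (lebesgue_rV R n) (lebesgue_rV R n) mX.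
  by rewrite indic_fubini_tonelli_FE// indic_fubini_tonelli_GE.
rewrite !tonelli; [|exact: mS2..]; apply: eq_integral => y _.
transitivity (L ((fun x : 'rV[R]_n => 1 *: x + y *m Q^T) @^-1` ysection (W (-1) B A) y)).
  have yK x : (1 *: x + y *m Q^T) *m Q = x *m Q + 1 *: y.
    by rewrite mulmxDl -mulmxA orth_trK mulmx1 !scale1r.
  have yKN x : (1 *: x + y *m Q^T) *m Q + (-1) *: y = x *m Q.
    by rewrite yK scale1r scaleN1r addrK.
  congr (L _); apply/seteqP; split => x; rewrite /ysection/= !in_setE/W/=.
    by rewrite yKN yK => -[].
  by rewrite yKN yK => -[].
rewrite /L lebesgue_rV_affine ?oner_neq0 ?normr1 ?expr1n ?invr1 ?mul1e//.
by apply: measurable_ysection; exact: mS2.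
Qed.

End orthogonal.

(** * Volumes of cubes and balls, rotation invariance *)

Section volumes.
Context (R : realType).

Lemma lebesgue_rV_cube (n : nat) (M : R) : 0 <= M ->
  lebesgue_rV R n [set x : 'rV[R]_n | forall j, `|x 0 j| <= M] =
  ((M *+ 2) ^+ n)%:E.
Proof.
move=> M0; elim: n => [|n IH].
  by rewrite expr0 /= diracE mem_set// => -[].
rewrite lebesgue_rVE.
transitivity (\int[@lebesgue_measure R]_(a in [set` `[(- M)%R, M]])
    (cst ((M *+ 2) ^+ n)%:E a))%E; last first.
  rewrite integral_cst//= lebesgue_measure_itv/= lte_fin.
  have [Mlt|] := ltP (- M) M.
    by rewrite -EFinD -EFinM opprK exprSr mulr2n.
  move=> MM; have -> : M = 0 by lra.
  by rewrite mul0rn exprS mul0r mule0.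
rewrite [RHS]integral_mkcond; apply: eq_integral => a _; rewrite patchE.
case: ifPn => [/set_mem/=|/negP aM].
  rewrite in_itv/= -ler_norml => aM; rewrite -IH; congr (lebesgue_rV _ _ _).
  apply/seteqP; split => b /= H j.
    have := H (rshift 1 j); rewrite /cons_rV /=.
    by rewrite (row_mxEr (a%:M : 'rV[R]_1) (b : 'rV[R]_n)).
  rewrite /cons_rV mxE; case: splitP => k _; last exact: H.
  by rewrite ord1 mxE eqxx mulr1n.
rewrite (_ : [set b | _] = set0) ?measure0//.
apply/seteqP; split => b //= /(_ 0) H; apply: aM; apply/mem_set => /=.
move: H; rewrite /cons_rV mxE; case: splitP => // k _.
by rewrite ord1 mxE eqxx mulr1n in_itv/= -ler_norml.
Qed.

Lemma measurable_enorm_ball (n : nat) (x : 'rV[R]_n) (e : R) :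
  measurable ([set y | enorm (y - x) <= e] : set (borel_rV R n)).
Proof. by apply: closed_measurable_rV; exact: closed_enorm_ball. Qed.

Lemma measurable_cube (n : nat) (M : R) :
  measurable ([set x : 'rV[R]_n | forall j, `|x 0 j| <= M] : set (borel_rV R n)).
Proof.
rewrite (_ : [set x : 'rV[R]_n | _] =
    \bigcap_(j in [set: 'I_n]) [set x : 'rV[R]_n | `|x 0 j| <= M]); last first.
  by apply/seteqP; split => x /= H j; [move=> _; exact: H|exact: (H j I)].
apply: closed_measurable_rV; apply: closed_bigI => j _.
rewrite -openC (_ : ~` _ = (fun x : 'rV[R]_n => `|x 0 j|) @^-1` [set y | M < y]).
  apply: open_comp; last exact: open_gt.
  move=> x _; apply: (@continuous_comp _ _ _ (fun y : 'rV[R]_n => y 0 j)).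
    exact: coord_continuous.
  exact: norm_continuous.
by apply/seteqP; split => x /=; rewrite ltNge => /negP.
Qed.

Lemma lebesgue_rV_enorm_bounded (n : nat) (A : set 'rV[R]_n) (M : R) :
  measurable (A : set (borel_rV R n)) -> (forall x, A x -> enorm x <= M) ->
  (lebesgue_rV R n A < +oo)%E.
Proof.
move=> mA AM.
have M0 : 0 <= Num.max M 0 by rewrite le_max lexx orbT.
have mc := @measurable_cube n (Num.max M 0).
apply: le_lt_trans (_ : _ <= lebesgue_rV R n [set x : 'rV[R]_n | forall j, `|x 0%R j| <= Num.max M 0%R]%R)%E _; last first.
  by rewrite lebesgue_rV_cube// ltry.
apply: le_measure; rewrite ?inE// => x Ax j /=.
by rewrite le_max (le_trans (coord_le_enorm _ _) (AM _ Ax)).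
Qed.

Lemma unit_ball_volumeE (n : nat) :
  lebesgue_rV R n [set x : 'rV[R]_n | enorm x <= 1] = (unit_ball_volume R n)%:E.
Proof.
rewrite /unit_ball_volume fineK// ge0_fin_numE//.
apply: (@lebesgue_rV_enorm_bounded _ _ 1) => //.
have := @measurable_enorm_ball n 0 1; congr measurable.
by apply/seteqP; split => x /=; rewrite subr0.
Qed.

Lemma lebesgue_rV_ball (n : nat) (x : 'rV[R]_n) (e : R) : 0 < e ->
  lebesgue_rV R n [set y | enorm (y - x) <= e] =
  (e ^+ n * unit_ball_volume R n)%:E.
Proof.
move=> e0.
have mB : measurable ([set y | enorm (y : 'rV[R]_n) <= 1] : set (borel_rV R n)).
  have := @measurable_enorm_ball n 0 1; congr measurable.
  by apply/seteqP; split => y /=; rewrite subr0.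
have e1 : e^-1 != 0 by rewrite invr_eq0 gt_eqF.
have := @lebesgue_rV_affine R n e^-1 (- (e^-1 *: x)) _ e1 mB.
rewrite unit_ball_volumeE -EFinM normfV exprVn invrK gtr0_norm// => <-.
congr (lebesgue_rV _ _ _); apply/seteqP; split => y /=;
  by rewrite -scalerBr enormZ normfV gtr0_norm// ler_pdivrMl// mulr1.
Qed.

(** The cube of side 2 has positive volume and lies in a ball of radius n+1, whose volume is a
    multiple of that of the unit ball. Unlike n, the radius n+1 is positive also when n = 0. *)
Lemma unit_ball_volume_gt0 (n : nat) : 0 < unit_ball_volume R n.
Proof.
rewrite lt_neqAle fine_ge0 ?measure_ge0// andbT; apply/negP => /eqP u0.
have k0 : 0 < (n.+1%:R : R) by [].
have : (lebesgue_rV R n [set x | (forall j, `|x 0 j| <= 1)%R] <=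
        lebesgue_rV R n [set y | (enorm ((y : 'rV[R]_n) - 0) <= n.+1%:R)%R])%E.
  apply: le_measure; rewrite ?inE//.
  - exact: measurable_cube.
  - exact: measurable_enorm_ball.
  move=> x /= x1; rewrite subr0 (le_trans (enorm_le_norm x))//.
  rewrite -[leRHS]mulr1 ler_pM// ?ler_nat//.
  by rewrite [leLHS]mx_normrE bigmax_le// => -[i j] _ /=; rewrite ord1.
rewrite lebesgue_rV_cube// lebesgue_rV_ball// -u0 mulr0 lee_fin leNgt.
by rewrite exprn_gt0.
Qed.

(** Take for B the unit ball, which Q preserves and whose volume is finite and positive: the ratio
    identity then cancels to the claim. *)
Lemma lebesgue_rV_orth (n : nat) (Q : 'M[R]_n) (A : set (borel_rV R n)) :
  Q *m Q^T = 1%:M -> measurable A ->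
  lebesgue_rV R n [set x : 'rV[R]_n | A (x *m Q)] = lebesgue_rV R n A.
Proof.
move=> QQ mA.
have := lebesgue_rV_orth_ratio QQ mA (measurable_enorm_ball (0 : 'rV[R]_n) 1).
have -> : [set x : 'rV[R]_n | [set y | enorm (y - 0) <= 1] (x *m Q)] =
    [set y | enorm (y - 0) <= 1].
  by apply/seteqP; split => y /=; rewrite !subr0 enorm_orth.
rewrite lebesgue_rV_ball// expr1n mul1r [RHS]muleC.
have w0 := unit_ball_volume_gt0 n.
move=> /(congr1 (fun t => t * (unit_ball_volume R n)^-1%:E)%E).
by rewrite -!muleA -!EFinM mulfV ?gt_eqF// !mule1.
Qed.

Lemma integral_exprn (n : nat) (T : R) : 0 < T ->
  (\int[@lebesgue_measure R]_(s in [set` `]0%R, T]]) (n.+1%:R * s ^+ n)%:E =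
   (T ^+ n.+1)%:E)%E.
Proof.
move=> T0.
have cf : continuous (fun s : R => n.+1%:R * s ^+ n).
  move=> x; apply: cvgM; first exact: cvg_cst.
  exact: exprn_continuous.
rewrite integral_itv_obnd_cbnd; last first.
  apply: measurable_funTS; apply/measurable_EFinP.
  exact: continuous_measurable_fun.
rewrite (@continuous_FTC2 _ _ (fun s : R => s ^+ n.+1))//.
- by rewrite expr0n/= sube0.
- by apply: continuous_subspaceT.
- split.
  + by move=> x _; exact: exprn_derivable.
  + apply: cvg_at_right_filter; exact: exprn_continuous.
  + apply: cvg_at_left_filter; exact: exprn_continuous.
- move=> x _; by rewrite exp_derive1.
Qed.

End volumes.

(** * Volumes of cones *)

Section cone.
Context (R : realType).

(** Q is the Householder reflection that exchanges nu with the first basis vector; when the two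
    coincide it degenerates and the identity takes its place. *)
Lemma exists_orth_first (n : nat) (nu : 'rV[R]_n.+1) : enorm nu = 1 ->
  exists2 Q : 'M[R]_n.+1, Q *m Q^T = 1%:M &
    forall x : 'rV[R]_n.+1, (x *m Q) 0 0 = dotv x nu.
Proof.
move=> nu1; pose e : 'rV[R]_n.+1 := delta_mx 0 0.
have xe (x : 'rV[R]_n.+1) : dotv x e = x 0 0.
  rewrite /dotv big_ord_recl big1 ?addr0 => [|j _]; first by rewrite mxE !eqxx mulr1.
  by rewrite mxE /= mulr0.
pose u := nu - e; pose c := dotv u u.
have [u0|u0] := eqVneq u 0.
  exists 1%:M; first by rewrite trmx1 mulmx1.
  by move=> x; rewrite mulmx1 -xe; move/eqP: u0; rewrite subr_eq0 => /eqP <-.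
have c0 : c != 0.
  apply: contra u0 => /eqP; rewrite /c -enorm_sqr => /eqP.
  by rewrite sqrf_eq0 => /eqP/enorm_eq0 ->.
have uuT : u *m u^T = c%:M.
  by apply/matrixP => i j; rewrite !ord1 -dotvE mxE eqxx mulr1n.
have Qsym : (1%:M - (2 / c) *: (u^T *m u))^T = 1%:M - (2 / c) *: (u^T *m u).
  by rewrite linearB/= trmx1 linearZ/= trmx_mul trmxK.
exists (1%:M - (2 / c) *: (u^T *m u)).
  rewrite Qsym; set k := 2 / c; set M := u^T *m u.
  have MM : M *m M = c *: M.
    by rewrite /M mulmxA -(mulmxA u^T) uuT mul_mx_scalar -scalemxAl.
  rewrite mulmxBr mulmx1 mulmxBl mul1mx -scalemxAl -scalemxAr MM !scalerA.
  have -> : k * k * c = k + k by rewrite /k; field.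
  rewrite scalerDl; move: (k *: M) => Z.
  by rewrite [X in _ - X](_ : _ = - Z) ?opprK ?subrK// opprD addrA subrr add0r.
move=> x; have -> : x *m (1%:M - (2 / c) *: (u^T *m u)) = x - (2 / c * dotv x u) *: u.
  rewrite mulmxBr mulmx1 -scalemxAr mulmxA [x *m u^T]mx11_scalar -dotvE.
  by rewrite mul_scalar_mx scalerA.
have cE : c = 2 - 2 * nu 0 0.
  rewrite /c /u dotvBl !dotvBr -enorm_sqr nu1 !xe (dotvC e) xe mxE !eqxx.
  by rewrite expr1n /=; ring.
have uE : u 0 0 = nu 0 0 - 1 by rewrite /u !mxE !eqxx.
have k : 2 / c * u 0 0 = -1.
  rewrite uE (_ : nu 0 0 - 1 = - (c / 2)); first by field.
  by rewrite cE; field.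
rewrite (_ : (x - _) 0 0 = x 0 0 - 2 / c * u 0 0 * dotv x u).
  by rewrite k /u dotvBr xe; ring.
by rewrite !mxE; ring.
Qed.

Lemma enorm_row_mx0 (n : nat) (y : 'rV[R]_n.+1) : y 0 0 = 0 ->
  enorm y = enorm (\row_j y 0 (lift 0 j)).
Proof.
move=> y0; rewrite /enorm /dotv big_ord_recl y0 mul0r add0r.
by congr Num.sqrt; apply: eq_bigr => j _; rewrite !mxE.
Qed.

(** An oblique cone with apex x0 over the disc of radius rho around x in the hyperplane normal to
    nu, cut off at the fraction T of its height. The vector inside the norm is automatically
    orthogonal to nu. *)
Definition cone (n : nat) (x0 x nu : 'rV[R]_n.+1) (rho T : R) : set 'rV[R]_n.+1 :=
  [set z | let s := dotv (z - x0) nu / dotv (x - x0) nu in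
    0 < s <= T /\ enorm (z - x0 - s *: (x - x0)) <= s * rho].

Lemma cons_rV0 (n : nat) (a : R) (b : 'rV[R]_n) : (cons_rV (a, b) : 'rV[R]_n.+1) 0 0 = a.
Proof. exact: (congr1 fst (cons_rVK (a, b))). Qed.

Lemma cons_rV_lift (n : nat) (a : R) (b : 'rV[R]_n) j :
  (cons_rV (a, b) : 'rV[R]_n.+1) 0 (lift 0 j) = b 0 j.
Proof.
have := congr1 snd (cons_rVK (a, b)) => /rowP /(_ j).
by rewrite mxE.
Qed.

Lemma measurable_cone (n : nat) (x0 x nu : 'rV[R]_n.+1) (rho T : R) :
  measurable (cone x0 x nu rho T : set (borel_rV R n.+1)).
Proof.
pose s (z : 'rV[R]_n.+1) := dotv (z - x0) nu / dotv (x - x0) nu.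
have kss y z : `|s y - s z| <= enorm nu / `|dotv (x - x0) nu| * enorm (y - z).
  rewrite /s -mulrBl -dotvBl opprB addrA subrK normrM normfV mulrAC.
  by rewrite ler_wpM2r ?invr_ge0// mulrC cauchy_schwarz_dotv.
have cs : continuous s by exact: enorm_lipschitz_continuous kss.
have ce : continuous (fun z : 'rV[R]_n.+1 => enorm (z - x0 - s z *: (x - x0)) - s z * rho).
  apply: (@enorm_lipschitz_continuous _ _ _ (1 + enorm nu / `|dotv (x - x0) nu| * (enorm (x - x0) + `|rho|))) => y z.
  have := kss y z; set k := _ / _; set e := enorm (y - z) => ksyz.
  rewrite [X in `|X|](_ : _ = (enorm (y - x0 - s y *: (x - x0)) - enorm (z - x0 - s z *: (x - x0))) - (s y - s z) * rho); last by ring.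
  apply: le_trans (ler_normB _ _) _; rewrite normrM.
  have r1 := ler_dist_enorm (y - x0 - s y *: (x - x0)) (z - x0 - s z *: (x - x0)).
  have e1 : y - x0 - s y *: (x - x0) - (z - x0 - s z *: (x - x0)) =
      (y - z) - (s y - s z) *: (x - x0).
    by apply/rowP => j; rewrite !mxE; ring.
  rewrite e1 in r1.
  have r2 := ler_enormD (y - z) (- ((s y - s z) *: (x - x0))).
  rewrite enormN enormZ -/e in r2.
  have r3 : `|s y - s z| * enorm (x - x0) <= k * e * enorm (x - x0).
    by rewrite ler_wpM2r ?enorm_ge0.
  have r4 : `|s y - s z| * `|rho| <= k * e * `|rho| by rewrite ler_wpM2r.
  lra.
rewrite (_ : cone _ _ _ _ _ = (s @^-1` [set t | 0 < t]) `&` (s @^-1` [set t | t <= T]) `&`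
   ((fun z : 'rV[R]_n.+1 => enorm (z - x0 - s z *: (x - x0)) - s z * rho) @^-1` [set t | t <= 0])).
  apply: measurableI; first apply: measurableI.
  - apply: open_measurable_rV; apply: open_comp; last exact: open_gt.
    by move=> z _; exact: cs.
  - apply: closed_measurable_rV; apply: closed_comp; last exact: closed_le.
    by move=> z _; exact: cs.
  - apply: closed_measurable_rV; apply: closed_comp; last exact: closed_le.
    by move=> z _; exact: ce.
apply/seteqP; split => z; rewrite /cone/= -/(s z) subr_le0.
  by move=> [/andP[-> ->] ->].
by move=> [[-> ->] ->].
Qed.

(** Cavalieri along the first coordinate: at the fraction s of the height the slice is a ball of
    radius s rho. *)
Lemma lebesgue_rV_cone_std (n : nat) (w0 w1 : 'rV[R]_n.+1) (rho T : R) :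
  0 < (w1 - w0) 0 0 -> 0 < rho -> 0 < T ->
  lebesgue_rV R n.+1 [set z : 'rV[R]_n.+1 |
    let s := (z - w0) 0 0 / (w1 - w0) 0 0 in
    0 < s <= T /\ enorm (z - w0 - s *: (w1 - w0)) <= s * rho] =
  ((w1 - w0) 0 0 * T ^+ n.+1 / n.+1%:R * rho ^+ n * unit_ball_volume R n)%:E.
Proof.
set h := (w1 - w0) 0 0 => h0 rho0 T0; rewrite lebesgue_rVE.
have sub3 (y u d : 'rV[R]_n.+1) (t : R) j :
    (y - u - t *: d) 0 j = y 0 j - u 0 j - t * d 0 j by rewrite !mxE.
pose V := rho ^+ n * unit_ball_volume R n.
have V0 : 0 < V by rewrite mulr_gt0 ?exprn_gt0 ?unit_ball_volume_gt0.
pose f (s : R) : \bar R := if 0 < s <= T then (s ^+ n * V)%:E else 0%E.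
transitivity (\int[@lebesgue_measure R]_a f (h^-1 * a + - (h^-1 * w0 0%R 0%R))%R)%E.
  apply: eq_integral => a _.
  have sE (b : 'rV[R]_n) : ((cons_rV (a, b) : 'rV[R]_n.+1) - w0) 0 0 / h =
      h^-1 * a + - (h^-1 * w0 0 0).
    by rewrite mxE [(- w0) 0 0]mxE cons_rV0; field; rewrite gt_eqF.
  set s := h^-1 * a + _; rewrite /f; case: ifPn => sT; last first.
    rewrite (_ : [set b | _] = set0) ?measure0//.
    by apply/seteqP; split => b //=; rewrite sE -/s (negbTE sT) => -[].
  pose c : 'rV[R]_n := \row_j (w0 + s *: (w1 - w0)) 0 (lift 0 j).
  have s0 : 0 < s by case/andP: sT.
  transitivity (lebesgue_rV R n [set b | enorm (b - c) <= s * rho]).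
    congr (lebesgue_rV _ _ _).
    have eqe b : enorm ((cons_rV (a, b) : 'rV[R]_n.+1) - w0 - s *: (w1 - w0)) = enorm (b - c).
      rewrite enorm_row_mx0; last first.
        by rewrite sub3 cons_rV0 -/h /s; field; rewrite gt_eqF.
      congr enorm; apply/rowP => j.
      by rewrite mxE sub3 cons_rV_lift !mxE; ring.
    apply/seteqP; split => b /=; rewrite sE -/s eqe; first by case.
    by move=> ?; split.
  by rewrite lebesgue_rV_ball ?mulr_gt0// exprMn mulrA.
have mf0 : measurable_fun setT (fun s : R => (s ^+ n * V)%:E : \bar R).
  apply/measurable_EFinP; apply: continuous_measurable_fun => s.
  by apply: cvgM; [exact: exprn_continuous|exact: cvg_cst].
have fE : f = (fun s : R => (s ^+ n * V)%:E) \_ [set` `]0, T]].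
  apply/funext => s; rewrite patchE /f; case: ifPn => [sT|/negP sT].
    by rewrite mem_set//= in_itv.
  by rewrite memNset//= in_itv.
rewrite (@ge0_integral_lebesgue_affine R h^-1 _ f) ?invr_eq0 ?gt_eqF//; last 2 first.
- by rewrite fE; apply/(measurable_restrictT _ _).1 => //; exact: measurable_funTS.
- move=> s; rewrite /f; case: ifPn => // /andP[s0 _].
  by rewrite lee_fin mulr_ge0 ?ltW// exprn_gt0.
rewrite fE -integral_mkcond.
transitivity (h%:E * \int[@lebesgue_measure R]_(s in [set` `]0%R, T]])
   ((V / n.+1%:R)%:E * (n.+1%:R * s ^+ n)%:E))%E.
  rewrite normfV invrK gtr0_norm//; congr (_ * _)%E.
  by apply: eq_integral => s _; rewrite -EFinM; congr EFin; field;
    rewrite addrC natr1.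
rewrite ge0_integralZl//; last 3 first.
- apply: measurable_funTS; apply/measurable_EFinP; apply: continuous_measurable_fun => s.
  by apply: cvgM; [exact: cvg_cst|exact: exprn_continuous].
- move=> s /=; rewrite in_itv/= => /andP[s0 _]; rewrite lee_fin.
  by rewrite mulr_ge0// exprn_ge0// ltW.
- by rewrite lee_fin divr_ge0// ltW.
rewrite integral_exprn// -!EFinM; congr EFin; rewrite /V; field.
by rewrite addrC natr1.
Qed.

Lemma lebesgue_rV_cone (n : nat) (x0 x nu : 'rV[R]_n.+1) (rho T : R) :
  enorm nu = 1 -> 0 < dotv (x - x0) nu -> 0 < rho -> 0 < T ->
  lebesgue_rV R n.+1 (cone x0 x nu rho T) =
  (dotv (x - x0) nu * T ^+ n.+1 / n.+1%:R * rho ^+ n * unit_ball_volume R n)%:E.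
Proof.
move=> nu1 h0 rho0 T0; have [Q QQ Qnu] := exists_orth_first nu1.
have QE : (x *m Q - x0 *m Q) 0 0 = dotv (x - x0) nu by rewrite -mulmxBl Qnu.
have := @lebesgue_rV_cone_std n (x0 *m Q) (x *m Q) rho T.
rewrite QE => <-//; set A := [set z | _].
have AE : cone x0 x nu rho T = [set z : 'rV[R]_n.+1 | A (z *m Q)].
  apply/seteqP; split => z; rewrite /cone /A /= -!mulmxBl Qnu scalemxAl -mulmxBl enorm_orth//.
rewrite AE lebesgue_rV_orth//.
have QK (z : 'rV[R]_n.+1) : z *m Q^T *m Q = z by rewrite -mulmxA orth_trK ?mulmx1.
have -> : A = [set z : 'rV[R]_n.+1 | cone x0 x nu rho T (z *m Q^T)].
  by rewrite AE; apply/seteqP; split => z /=; rewrite QK.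
have mQ : measurable_fun setT (fun x : borel_rV R n.+1 => (x : 'rV[R]_n.+1) *m Q^T : borel_rV R n.+1).
  apply: (@continuous_measurable_rV _ _ _ (mulmx^~ Q^T)); apply: continuous_orth.
  by rewrite trmxK orth_trK.
rewrite -[X in measurable X]setTI; apply: mQ => //; exact: measurable_cone.
Qed.

End cone.

(** * A covering bound for Hausdorff measure *)

Section hausdorff_packing.
Context (R : realType) (s m : nat).
Implicit Types (p q : 'rV[R]_m * R) (l : seq ('rV[R]_m * R)).

(** Disjointness of the two closed balls, expressed by centres and radii. *)
Definition far p q : bool := p.2 + q.2 < enorm (p.1 - q.1).

Lemma hausdorff_weight_ball (x : 'rV[R]_m) (e : R) : 0 < e ->
  hausdorff_weight s [set y | enorm (y - x) <= e] <= unit_ball_volume R s * e ^+ s.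
Proof.
move=> e0; rewrite /hausdorff_weight; case: ifPn => [_|_].
  by rewrite mulr_ge0 ?exprn_ge0 ?(ltW e0) ?(ltW (unit_ball_volume_gt0 _ _)).
rewrite ler_wpM2l ?(ltW (unit_ball_volume_gt0 _ _))//.
rewrite /ediam; set D := (X in sup X).
have Dub : ubound D (e + e).
  move=> _ [[y z] [/= ye ze] <-]; apply: le_trans (ler_enormB _ x _) _.
  by rewrite lerD// enormB.
have D0 : D 0.
  by exists (x, x); rewrite /= subrr enorm0//; split; rewrite ltW.
have D1 : 0 <= sup D by apply: sup_upper_bound => //; split; [exists 0|exists (e + e)].
have D2 : sup D <= e + e by apply: sup_le_ub => //; exists 0.
rewrite lerXn2r ?nnegrE ?divr_ge0 ?(ltW e0)//.
by rewrite ler_pdivrMr// mulr_natr mulr2n.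
Qed.

Lemma hausdorff_weight_ge0 (C : set 'rV[R]_m) : 0 <= hausdorff_weight s C.
Proof.
rewrite /hausdorff_weight; case: ifPn => // C0.
rewrite mulr_ge0 ?(ltW (unit_ball_volume_gt0 _ _))// exprn_ge0// divr_ge0//.
have /set0P[x Cx] := C0; rewrite /ediam; set D := (X in sup X).
have [Ds|/sup_out->//] := pselect (has_sup D).
apply: sup_upper_bound => //; exists (x, x) => //=.
by rewrite subrr enorm0.
Qed.

(** A largest available radius need not exist, but some available radius exceeds half the supremum.
    [None] records that no admissible ball is left. *)
Lemma greedy_choice (adm : set ('rV[R]_m * R)) (M : R) l :
  (forall p, adm p -> 0 < p.2 <= M) ->
  exists o : option ('rV[R]_m * R),
    if o is Some p then
      [/\ adm p, all (far p) l &
        forall q, adm q -> all (far q) l -> q.2 < 2 * p.2]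
    else forall q, adm q -> ~~ all (far q) l.
Proof.
move=> admM; have [[p0 [ap0 lp0]]|none] := pselect (exists p, adm p /\ all (far p) l); last first.
  by exists None => q aq; apply/negP => lq; apply: none; exists q.
pose D := [set q.2 | q in [set q | adm q /\ all (far q) l]].
have Dsup : has_sup D.
  split; first by exists p0.2, p0.
  by exists M => _ [q [aq _] <-]; have /andP[] := admM _ aq.
have D0 : 0 < sup D.
  apply: lt_le_trans (_ : p0.2 <= _); first by have /andP[] := admM _ ap0.
  by apply: sup_upper_bound => //; exists p0.
have [_ [p [ap lp] <-] ps] := @sup_adherent _ D (sup D / 2) ltac:(lra) Dsup.
exists (Some p); split => // q aq lq.
have : q.2 <= sup D by apply: sup_upper_bound => //; exists q.
lra.
Qed.

Variables (A : set 'rV[R]_m) (r0 : 'rV[R]_m -> R) (T : R).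
Hypothesis r0_gt0 : forall x, A x -> 0 < r0 x.
Hypothesis packing : forall l,
  (forall p, p \in l -> A p.1 /\ 0 < p.2 <= r0 p.1) -> pairwise far l ->
  \sum_(p <- l) p.2 ^+ s <= T.

(* Each chosen ball has more than half the largest radius still available, so a
   point missed by the first k balls lies in the tripling of a later one. *)
Lemma vitali_greedy (delta : R) : 0 < delta ->
  exists o : nat -> option ('rV[R]_m * R),
  let a i := if o i is Some p then p.2 ^+ s else 0 in
  [/\ forall i p, o i = Some p -> 0 < p.2 <= delta,
      forall k, \sum_(i < k) a i <= T &
      forall k x, A x -> exists i p, o i = Some p /\
        enorm (x - p.1) <= (if (i < k)%N then p.2 else 3 * p.2)].
Proof.
move=> delta0.
pose adm : set ('rV[R]_m * R) := [set p | A p.1 /\ 0 < p.2 <= r0 p.1 /\ p.2 <= delta].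
have admM p : adm p -> 0 < p.2 <= delta by move=> [_ [/andP[-> _] ->]].
have [g gP] := choice (fun l => @greedy_choice adm delta l admM).
pose L := fix L k := if k is k'.+1 then
  (if g (L k') is Some p then p :: L k' else L k') else [::].
pose o k := g (L k).
have LS k : L k.+1 = if o k is Some p then p :: L k else L k by [].
have Ladm k p : p \in L k -> adm p.
  elim: k => // k IH; rewrite LS; have := gP (L k); rewrite -/(o k).
  case: (o k) => // q [aq _ _]; rewrite inE => /predU1P[->//|]; exact: IH.
have Lfar k : pairwise far (L k).
  elim: k => // k IH; rewrite LS; have := gP (L k); rewrite -/(o k).
  by case: (o k) => // q [_ fq _] /=; rewrite fq.
pose a i := if o i is Some p then p.2 ^+ s else 0.
have sumL k : \sum_(i < k) a i = \sum_(p <- L k) p.2 ^+ s.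
  elim: k => [|k IH]; first by rewrite big_ord0 big_nil.
  rewrite big_ord_recr/= IH /a -/(o k); case: (o k) => [p|]; last by rewrite addr0.
  by rewrite big_cons addrC.
have sumT k : \sum_(i < k) a i <= T.
  rewrite sumL; apply: packing => // p /Ladm [Ap [pr _]]; split=> //.
have Lsub j k : (j <= k)%N -> {subset L j <= L k}.
  move=> jk; rewrite -(subnK jk); elim: (k - j)%N => // d IH p /IH.
  by rewrite addSn LS; case: (o _) => // q pL; rewrite inE pL orbT.
have oL i k p : o i = Some p -> (i < k)%N -> p \in L k.
  by move=> oi ik; apply: (Lsub i.+1) => //; rewrite LS oi mem_head.
exists o; split.
- move=> i p oi; apply: admM; apply: (Ladm i.+1); exact: oL oi _.
- exact: sumT.
- move=> k x Ax.
  have [[p pL xp]|xk] := pselect (exists2 p, p \in L k & enorm (x - p.1) <= p.2).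
    have [i [ik oi]] : exists i, (i < k)%N /\ o i = Some p.
      move: pL; elim: k => // k IH; rewrite LS.
      case ok : (o k) => [q|]; last by move=> /IH[i [ik oi]]; exists i; split => //; exact: ltnW.
      rewrite inE => /predU1P[->|/IH[i [ik oi]]]; first by exists k.
      by exists i; split => //; exact: ltnW.
    by exists i, p; rewrite ik.
  (* Finitely many closed balls miss x, so they miss it by a common margin d. *)
  have [d d0 dP] : exists2 d, 0 < d & forall p, p \in L k -> p.2 + d < enorm (x - p.1).
    have H p : p \in L k -> p.2 < enorm (x - p.1).
      by move=> pL; rewrite ltNge; apply/negP => xp; apply: xk; exists p.
    elim: (L k) H => [|p l IH] H; first by exists 1.
    have [d d0 dP] := IH (fun q ql => H q (@mem_behead _ (p :: l) q ql)).
    have Hp := H p (mem_head _ _).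
    exists (Num.min d ((enorm (x - p.1) - p.2) / 2)); first by rewrite lt_min d0/=; lra.
    move=> q; rewrite inE => /predU1P[->|ql].
      have : Num.min d ((enorm (x - p.1) - p.2) / 2) <= (enorm (x - p.1) - p.2) / 2 by rewrite ge_min lexx orbT.
      lra.
    have : Num.min d ((enorm (x - p.1) - p.2) / 2) <= d by rewrite ge_min lexx.
    by have := dP _ ql; lra.
  pose rho := Num.min (Num.min d delta) (r0 x).
  have rho0 : 0 < rho by rewrite !lt_min d0 delta0 r0_gt0.
  pose b : 'rV[R]_m * R := (x, rho).
  have ab : adm b by split => //=; rewrite rho0 /rho !ge_min !lexx !orbT.
  have bk : all (far b) (L k).
    apply/allP => p /dP; rewrite /far/=.
    have : rho <= d by rewrite /rho !ge_min lexx.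
    lra.
  (* If b stayed available forever, every chosen radius would exceed rho / 2, and the packing sums
     would outgrow T. *)
  have [N Nfar] : exists N, ~~ all (far b) (L N).
    apply: contrapT => /forallNP H.
    have bN N : all (far b) (L N) by apply/negPn/negP; exact: H.
    have aN N : (rho / 2) ^+ s <= a N.
      have := gP (L N); rewrite /a -/(o N); case: (o N) => [p|]; last first.
        by move=> /(_ b ab); rewrite bN.
      move=> [_ _ /(_ b ab (bN N))] /= rp; rewrite lerXn2r ?nnegrE//; lra.
    have e0 : 0 < (rho / 2) ^+ s by rewrite exprn_gt0// divr_gt0.
    pose N := Num.bound (`|T| / (rho / 2) ^+ s).
    have : T < N%:R * (rho / 2) ^+ s.
      rewrite (le_lt_trans (ler_norm _))// -ltr_pdivrMr// archi_boundP//.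
      by rewrite divr_ge0// ltW.
    apply/negP; rewrite -leNgt; apply: le_trans (sumT N).
    by rewrite mulr_natl -[N in X in X <= _]card_ord -sumr_const ler_sum.
  have kN : (k < N)%N.
    rewrite ltnNge; apply/negP => Nk; move/negP: Nfar; apply.
    by apply/allP => p /(Lsub _ _ Nk); move/allP: bk => /(_ p).
  (* At the stage j where b is first obstructed, the new ball meets b and has more than half its
     radius, so its centre is within p.2 + rho <= 3 p.2 of x. *)
  have [j [jk jfar jNfar]] : exists j, [/\ (k <= j)%N, all (far b) (L j) & ~~ all (far b) (L j.+1)].
    move: kN Nfar; elim: N => // N IH; rewrite ltnS => kN Nfar.
    have [NN|NN] := boolP (all (far b) (L N)); first by exists N.
    apply: IH => //; rewrite ltn_neqAle kN andbT; apply/eqP => kNE.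
    by rewrite -kNE bk in NN.
  have := gP (L j); rewrite -/(o j); move: jNfar; rewrite LS.
  case oj : (o j) => [p|]; last by rewrite jfar.
  rewrite /= jfar andbT /far/= -leNgt => xp [_ _ /(_ b ab jfar)/= rp].
  exists j, p; split => //; rewrite ltnNge jk/=; lra.
Qed.

(** Only the balls from index k on are tripled. The sums of rho^s are bounded, so k can be chosen
    with a tail so small that the factor 3^s costs at most e; the first k balls contribute at most
    T. *)
Lemma hausdorff_measure_le_packing :
  (@hausdorff_measure R s m A <= (unit_ball_volume R s * T)%:E)%E.
Proof.
have w0 := unit_ball_volume_gt0 R s.
apply: ge_ereal_sup => _ [delta delta0 <-].
apply/lee_addgt0Pr => e e0.
(* A tripled ball of radius at most delta / 6 still has diameter at most delta. *)
have d6 : 0 < delta / 6 by rewrite divr_gt0.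
have [ch [oadm]] := vitali_greedy d6.
pose a i := if ch i is Some p then p.2 ^+ s else 0.
rewrite -/a => sumT ocov.
have a0 i : 0 <= a i.
  rewrite /a; case oi : (ch i) => [p|//]; rewrite exprn_ge0// ltW//.
  by have /andP[] := oadm _ _ oi.
have [k ktail] : exists k, forall j, \sum_(k <= i < j) a i <= e / (unit_ball_volume R s * 3 ^+ s).
  set e' := e / _; have e'0 : 0 < e' by rewrite divr_gt0// mulr_gt0// exprn_gt0.
  pose D := range (fun j => \sum_(i < j) a i).
  have Dsup : has_sup D.
    by split; [exists (\sum_(i < 0) a i), 0%N|exists T => _ [j _ <-]; exact: sumT].
  have [_ [k _ <-] kD] := sup_adherent e'0 Dsup.
  exists k => j; have [jk|kj] := leqP j k; first by rewrite big_geq// ltW.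
  have : \sum_(i < j) a i <= sup D by apply: sup_upper_bound => //; exists j.
  have -> : \sum_(i < j) a i = \sum_(i < k) a i + \sum_(k <= i < j) a i.
    by rewrite -!(big_mkord xpredT a) (@big_cat_nat _ _ _ k)// ltnW.
  lra.
pose rad i (p : 'rV[R]_m * R) := if (i < k)%N then p.2 else 3 * p.2.
pose C i : set 'rV[R]_m := if ch i is Some p then [set y | enorm (y - p.1) <= rad i p] else set0.
have rad0 i p : ch i = Some p -> 0 < rad i p <= delta / 2.
  move=> /oadm /andP[p0 pd]; rewrite /rad; case: ifPn => _; apply/andP; split; lra.
pose w i := unit_ball_volume R s * (a i + (if (i < k)%N then 0 else 3 ^+ s * a i)).
have wC i : hausdorff_weight s (C i) <= w i.
  rewrite /w /C /a; case oi : (ch i) => [p|]; last first.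
    by rewrite /hausdorff_weight eqxx mulr0 if_same addr0 mulr0.
  have /andP[r_gt0 _] := rad0 _ _ oi.
  apply: le_trans (hausdorff_weight_ball _ r_gt0) _.
  rewrite ler_pM2l// /rad; case: ifPn => _; first by rewrite addr0.
  rewrite exprMn lerDr; have := a0 i; by rewrite /a oi.
have cov : hausdorff_cover delta A C.
  split=> [x Ax|i y z].
    have [i [p [oi xp]]] := ocov k x Ax; exists i => //.
    by rewrite /C oi /= /rad.
  rewrite /C; case oi : (ch i) => [p|//] /= yp zp.
  have /andP[_ rd] := rad0 _ _ oi.
  apply: le_trans (ler_enormB _ p.1 _) _; rewrite (enormB p.1).
  lra.
apply: (@le_trans _ _ (\sum_(0 <= i <oo) (hausdorff_weight s (C i))%:E)%E).
  by apply: ereal_inf_lbound; exists C.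
apply: lime_le.
  by apply: is_cvg_nneseries => i _ _; rewrite lee_fin hausdorff_weight_ge0.
apply: nearW => j; rewrite sumEFin -EFinD lee_fin.
apply: (@le_trans _ _ (\sum_(0 <= i < j) w i)); first by apply: ler_sum => i _; exact: wC.
rewrite -mulr_sumr big_split/= mulrDr lerD//.
  by rewrite ler_pM2l// big_mkord; exact: sumT.
apply: (@le_trans _ _ (unit_ball_volume R s * (3 ^+ s * \sum_(k <= i < maxn k j) a i))).
  rewrite ler_pM2l// mulr_sumr.
  apply: (@le_trans _ _ (\sum_(0 <= i < maxn k j) if (i < k)%N then 0 else 3 ^+ s * a i)).
    rewrite (@big_cat_nat _ _ _ j 0 (maxn k j))//= ?leq_maxr// lerDl.
    by apply: sumr_ge0 => i _; case: ifPn => // _; rewrite mulr_ge0// exprn_ge0.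
  rewrite (@big_cat_nat _ _ _ k 0 (maxn k j))//= ?leq_maxl//.
  rewrite big_nat big1 => [|i /andP[_ ->]//]; rewrite add0r le_eqVlt.
  by apply/orP; left; apply/eqP/eq_big_nat => i /andP[ki _]; rewrite ltnNge ki.
have w3 : 0 < unit_ball_volume R s * 3 ^+ s by rewrite mulr_gt0// exprn_gt0.
by rewrite mulrA -ler_pdivlMl// mulrC ktail.
Qed.

End hausdorff_packing.

(** * Outer regularity *)

Section regularity.
Context (R : realType) (n : nat).
Variable mu : {measure set (borel_rV R n) -> \bar R}.
Hypothesis mufin : (mu setT < +oo)%E.
Local Notation meas A := (measurable (A : set (borel_rV R n))).

Lemma measure_decr_small (D : (set 'rV[R]_n)^nat) (e : R) : 0 < e ->
  (forall k, meas (D k)) -> nonincreasing_seq D -> \bigcap_k D k = set0 ->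
  exists k, (mu (D k) <= e%:E)%E.
Proof.
move=> e0 mD ndD D0.
have D0oo : (mu (D 0%N) < +oo)%E.
  by apply: le_lt_trans mufin; apply: le_measure; rewrite ?inE.
have mI : meas (\bigcap_k D k) by rewrite D0.
have := @nonincreasing_cvg_mu _ _ _ mu D D0oo mD mI ndD.
rewrite D0 measure0 => /fine_cvgP[[N0 _ N0fin]].
move=> /cvgrPdist_le /(_ _ e0)[N _ NP].
have := NP (maxn N N0) (leq_maxl _ _); rewrite /= sub0r normrN => le_e.
exists (maxn N N0); rewrite -[X in (X <= _)%E]fineK; last first.
  exact: (N0fin (maxn N N0) (leq_maxr _ _)).
by rewrite lee_fin (le_trans (ler_norm _)).
Qed.

(** Approximation from both sides is stable under complements, which approximation from outside
    alone is not; this makes the regular sets a sigma-algebra. *)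
Let regular (A : set 'rV[R]_n) := forall e : R, 0 < e ->
  exists F U : set 'rV[R]_n, [/\ closed F, open U, F `<=` A, A `<=` U &
    (mu (U `\` F) <= e%:E)%E].

Let regular_open A : open A -> regular A.
Proof.
move=> oA e e0.
pose F (k : nat) := \bigcap_(y in ~` A) [set x : 'rV[R]_n | k.+1%:R^-1 <= enorm (x - y)].
have cF k : closed (F k).
  apply: closed_bigI => y _.
  have -> : [set x : 'rV[R]_n | k.+1%:R^-1 <= enorm (x - y)] =
      ~` [set x | enorm (x - y) < k.+1%:R^-1].
    by apply/seteqP; split => x /=; rewrite leNgt => /negP.
  by apply: open_closedC; exact: open_enorm_ball.
have FA k : F k `<=` A.
  move=> x Fx; apply: contrapT => nAx; have := Fx _ nAx.
  by rewrite /= subrr enorm0 leNgt invr_gt0 ltr0n.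
have mA := open_measurable_rV oA; have mF k := closed_measurable_rV (cF k).
have [||||k kP] := @measure_decr_small (fun k => A `\` F k) e.
- by [].
- by move=> k; exact: measurableD.
- move=> j k jk; apply/subsetPset; apply: setDS => x Fx y Ay.
  by apply: le_trans (Fx _ Ay); rewrite lef_pV2 ?posrE// ler_nat ltnS.
- apply/seteqP; split => x // H.
  have [Ax _] := H 0%N I.
  have /nbhs_enormP[d d0 dA] : nbhs x A by apply: open_nbhs_nbhs.
  have [k kd] : exists k : nat, k.+1%:R^-1 < d :> R.
    by have [k _ kP] := near_infty_natSinv_lt (PosNum d0); exists k; exact: (kP k (leqnn k)).
  have [_] := H k I; apply => y nAy /=.
  rewrite leNgt; apply/negP => xy; apply: nAy; apply: dA.
  by rewrite enormB (lt_trans xy).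
- by exists (F k), A; split.
Qed.

Let regular_setC A : regular A -> regular (setT `\` A).
Proof.
move=> rA e e0; have [F [U [cF oU FA AU UF]]] := rA e e0.
exists (~` U), (~` F); split.
- exact: open_closedC.
- exact: closed_openC.
- by rewrite setTD; exact: subsetC.
- by rewrite setTD; exact: subsetC.
- by rewrite setDE setCK setIC -setDE.
Qed.

Let regular_bigcup (A : (set 'rV[R]_n)^nat) :
  (forall k, regular (A k)) -> regular (\bigcup_k A k).
Proof.
move=> rA e e0.
have e20 : 0 < e / 2 by rewrite divr_gt0.
have ek (k : nat) : 0 < (e / 2) / (2 ^ k.+1)%:R by rewrite divr_gt0// ltr0n expn_gt0.
have [F /choice[U FUP]] := choice (fun k => rA k _ (ek k)).
have cF k : closed (F k) by have [] := FUP k.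
have oU k : open (U k) by have [] := FUP k.
have mF k := closed_measurable_rV (cF k); have mU k := open_measurable_rV (oU k).
have mUF : meas (\bigcup_k (U k `\` F k)) by apply: bigcup_measurable => k _; exact: measurableD.
have UFe : (mu (\bigcup_k (U k `\` F k)) <= (e / 2)%:E)%E.
  apply: le_trans (_ : _ <= \sum_(0 <= k <oo) ((e / 2) / (2 ^ k.+1)%:R)%:E)%E _; last first.
    by apply: epsilon_trick0; exact: ltW.
  apply: le_trans (_ : _ <= \sum_(0 <= k <oo) mu (U k `\` F k))%E _.
    by apply: measure_sigma_subadditive => // k; exact: measurableD.
  by apply: lee_nneseries => // k _; have [] := FUP k.
(* Countable unions of closed sets need not be closed, so the union is cut at a finite stage; the
   second half of e pays for the cut. *)
pose G k := \big[setU/set0]_(i < k) F i.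
have cG k : closed (G k) by apply: closed_bigsetU.
have mG k := closed_measurable_rV (cG k).
have mFF : meas (\bigcup_k F k) by exact: bigcup_measurable.
have [||||k kP] := @measure_decr_small (fun k => (\bigcup_k F k) `\` G k) (e / 2).
- by [].
- by move=> k; exact: measurableD.
- by move=> j k jk; apply/subsetPset; apply: setDS; exact: subset_bigsetU.
- apply/seteqP; split => x // H; have [[k _ Fkx] _] := H 0%N I.
  by have [_] := H k.+1 I; apply; rewrite /G big_ord_recr/=; right.
have mUU : meas (\bigcup_k U k) by exact: bigcup_measurable.
exists (G k), (\bigcup_k U k); split => //.
- exact: bigcup_open.
- move=> x; rewrite /G -bigcup_mkord => -[j /= _ Fjx]; exists j => //.
  by have [_ _ FA _ _] := FUP j; exact: FA.
- by apply: subset_bigcup => j _; have [] := FUP j.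
have mD2 : meas ((\bigcup_k F k) `\` G k) by exact: measurableD.
apply: le_trans (_ : _ <= mu (\bigcup_k (U k `\` F k) `|` ((\bigcup_k F k) `\` G k)))%E _.
  apply: le_measure; rewrite ?inE//; [exact: measurableD|exact: measurableU|].
  move=> x [[j _ Ujx] nGx]; have [Fjx|nFjx] := pselect (F j x).
    by right; split => //; exists j.
  by left; exists j.
apply: le_trans (measureU2 _ _ _) _ => //.
by rewrite [e]splitr EFinD leeD.
Qed.

Lemma outer_regular (A : set 'rV[R]_n) (e : R) : meas A -> 0 < e ->
  exists U : set 'rV[R]_n, [/\ open U, A `<=` U & (mu U <= mu A + e%:E)%E].
Proof.
move=> mA e0.
have rA : regular A.
  move: A mA; apply: smallest_sub; last exact: regular_open.
  split; first by apply: regular_open; exact: open0.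
    exact: regular_setC.
  exact: regular_bigcup.
have [F [U [cF oU FA AU UF]]] := rA e e0.
exists U; split => //.
have mU := open_measurable_rV oU; have mF := closed_measurable_rV cF.
apply: le_trans (_ : _ <= mu (A `|` (U `\` F)))%E _.
  apply: le_measure; rewrite ?inE//; [by apply: measurableU => //; exact: measurableD|].
  by move=> x Ux; have [Fx|] := pselect (F x); [left; exact: FA|right].
apply: le_trans (measureU2 _ _ _) _ => //; first exact: measurableD.
exact: leeD.
Qed.

End regularity.

(** * A Remez-type inequality on an interval *)

Section chebyshev.
Context (R : realType).

Fixpoint chebyshev (k : nat) : {poly R} :=
  match k with
  | 0 => 1
  | k'.+1 => match k' with
    | 0 => 'X
    | k''.+1 => 2 *: ('X * chebyshev k') - chebyshev k''
    end
  end.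

Lemma chebyshevS (k : nat) :
  chebyshev k.+2 = 2 *: ('X * chebyshev k.+1) - chebyshev k.
Proof. by []. Qed.

Lemma size_chebyshev (k : nat) : (size (chebyshev k) <= k.+1)%N.
Proof.
suff : (size (chebyshev k) <= k.+1)%N /\ (size (chebyshev k.+1) <= k.+2)%N by case.
elim: k => [|k [IH1 IH2]]; first by rewrite size_poly1 size_polyX.
split=> //; rewrite chebyshevS (leq_trans (size_polyD _ _))// size_polyN.
rewrite geq_max (leq_trans (size_scale_leq _ _)) ?(leq_trans IH1)//.
  by rewrite ltnW// ltnW.
by rewrite (leq_trans (size_polyMleq _ _))// size_polyX.
Qed.

Lemma chebyshev_cos (k : nat) (t : R) : (chebyshev k).[cos t] = cos (k%:R * t).
Proof.
suff : (chebyshev k).[cos t] = cos (k%:R * t) /\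
       (chebyshev k.+1).[cos t] = cos (k.+1%:R * t) by case.
elim: k => [|k [IH1 IH2]]; first by rewrite !hornerE cos0.
split=> //; rewrite chebyshevS hornerD hornerN hornerZ hornerM hornerX IH1 IH2.
have -> : k.+2%:R * t = k.+1%:R * t + t by rewrite -[k.+2]addn1 natrD mulrDl mul1r.
have -> : k%:R * t = k.+1%:R * t - t by rewrite -[k.+1]addn1 natrD mulrDl mul1r addrK.
by rewrite cosB cosD; ring.
Qed.

(** The second difference of the sequence T_k(1+y) is 2 y T_(k+1)(1+y), at most 4 y while the values
    stay below 2, and the first increment is y. Summing twice gives 1 + 2 y k^2 - y k; the
    hypothesis on r keeps the values below 2 up to k = r. *)
Lemma chebyshev_right (r k : nat) (y : R) : 0 <= y -> 2 * y * r%:R ^+ 2 <= 1 ->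
  (k <= r)%N -> (chebyshev k).[1 + y] <= 1 + 2 * y * k%:R ^+ 2.
Proof.
move=> y0 yr.
suff : (k <= r)%N -> (chebyshev k).[1 + y] <= 1 + 2 * y * k%:R ^+ 2 - y * k%:R /\
    (chebyshev k.+1).[1 + y] - (chebyshev k).[1 + y] <= y + 4 * y * k%:R.
  by move=> H /H[h _]; apply: le_trans h _; rewrite gerBl mulr_ge0.
elim: k => [_|k IH kr]; first by rewrite /= -polyC1 hornerC hornerX; split; lra.
have [h1 h2] := IH (ltnW kr).
have -> : k.+1%:R = k%:R + 1 :> R by rewrite -natr1.
have h3 : (chebyshev k.+1).[1 + y] <= 1 + 2 * y * (k%:R + 1) ^+ 2 - y * (k%:R + 1).
  by lra.
split=> //; rewrite chebyshevS hornerD hornerN hornerZ hornerM hornerX.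
have h4 : (chebyshev k.+1).[1 + y] <= 2.
  have : 2 * y * (k%:R + 1) ^+ 2 <= 1.
    apply: le_trans yr; rewrite ler_wpM2l ?mulr_ge0// natr1.
    by rewrite lerXn2r ?nnegrE// ler_nat.
  have : 0 <= y * (k%:R + 1) by rewrite mulr_ge0// addr_ge0.
  lra.
have : y * (chebyshev k.+1).[1 + y] <= y * 2 by rewrite ler_wpM2l.
lra.
Qed.

Lemma lagrange_interpolation (r : nat) (p : {poly R}) (x : 'I_r.+1 -> R) (z : R) :
  (size p <= r.+1)%N -> injective x ->
  p.[z] = \sum_k p.[x k] * \prod_(j | j != k) ((z - x j) / (x k - x j)).
Proof.
move=> sp xinj.
pose l k : {poly R} := \prod_(j | j != k) ((x k - x j)^-1 *: ('X - (x j)%:P)).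
pose q := \sum_k p.[x k] *: l k.
have lE k y : (l k).[y] = \prod_(j | j != k) ((y - x j) / (x k - x j)).
  rewrite /l horner_prod; apply: eq_bigr => j _.
  by rewrite hornerZ hornerXsubC mulrC.
have qE y : q.[y] = \sum_k p.[x k] * \prod_(j | j != k) ((y - x j) / (x k - x j)).
  by rewrite /q horner_sum; apply: eq_bigr => k _; rewrite hornerZ lE.
have qx k : q.[x k] = p.[x k].
  rewrite qE (bigD1 k)//= [X in _ * X]big1 ?mulr1 => [|j jk].
    rewrite big1 ?addr0// => j jk; rewrite (bigD1 k) 1?eq_sym//=.
    by rewrite subrr mul0r mul0r mulr0.
  by rewrite divff// subr_eq0; apply: contra jk => /eqP/xinj ->.
rewrite -qE; suff -> : p = q by [].
apply/eqP; rewrite -subr_eq0; apply/negPn/negP => pq0.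
have sq : (size q <= r.+1)%N.
  apply: (leq_trans (size_sum _ _ _)); apply/bigmax_leqP => k _.
  rewrite (leq_trans (size_scale_leq _ _))//.
  apply: (leq_trans (size_poly_prod_leq _ _)).
  rewrite (@leq_trans ((\sum_(j | j != k) 2).+1 - #|[pred j | j != k]|)%N)//.
    rewrite leq_sub2r// ltnS; apply: leq_sum => j _.
    by rewrite (leq_trans (size_scale_leq _ _))// size_XsubC.
  rewrite sum_nat_const; have -> : #|[pred j | j != k]| = r.
    by have := cardC1 k; rewrite card_ord.
  lia.
have := @max_poly_roots _ (p - q) [seq x k | k <- enum 'I_r.+1] pq0.
rewrite size_map size_enum_ord map_inj_uniq ?enum_uniq//.
have -> : all (root (p - q)) [seq x k | k <- enum 'I_r.+1].
  by apply/allP => _ /mapP[k _ ->]; rewrite rootE !hornerE qx subrr.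
move=> /(_ isT isT); rewrite ltnNge (leq_trans (size_polyD _ _))//.
by rewrite size_polyN geq_max sp sq.
Qed.

(** The extremal points of T_r on [-1, 1], in increasing order; for r = 0 the only node is 1. *)
Definition cheb_node (r : nat) (k : 'I_r.+1) : R := cos ((r - k)%:R * (pi / r%:R)).

Lemma cheb_node_mono (r : nat) (j k : 'I_r.+1) : (j < k)%N -> cheb_node j < cheb_node k.
Proof.
move=> jk; have kr : (k <= r)%N by rewrite -ltnS.
have r0 : 0 < r%:R :> R by rewrite ltr0n; lia.
have itv (i : nat) : (i%:R * (pi / r%:R) : R) \in `[0, pi] <-> (i <= r)%N.
  rewrite in_itv/= mulr_ge0 ?divr_ge0 ?pi_ge0//=.
  by rewrite mulrCA ger_pMr ?pi_gt0// ler_pdivrMr// mul1r ler_nat.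
rewrite /cheb_node ltr_cos; [|apply/itv; lia..].
rewrite ltr_pM2r ?divr_gt0 ?pi_gt0// ltr_nat; lia.
Qed.

Lemma cheb_node_val (r : nat) (k : 'I_r.+1) :
  (chebyshev r).[cheb_node k] = (-1) ^+ (r - k).
Proof.
case: r k => [k|r k]; first by rewrite ord1 hornerE expr0.
rewrite /cheb_node chebyshev_cos (_ : _ * _ = (r.+1 - k)%:R * pi); last first.
  by field; rewrite addrC natr1.
elim: (r.+1 - k)%N => [|i IH]; first by rewrite mul0r cos0.
have -> : i.+1%:R * pi = i%:R * pi + pi :> R by rewrite -natr1 mulrDl mul1r.
by rewrite cosDpi IH exprS mulN1r.
Qed.

Lemma cheb_node_ge (r : nat) (k : 'I_r.+1) : -1 <= cheb_node k.
Proof. exact: cos_geN1. Qed.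

Lemma cheb_node_le (r : nat) (k : 'I_r.+1) : cheb_node k <= 1.
Proof. exact: cos_le1. Qed.

(** To the right of all nodes the Lagrange basis polynomials alternate in sign exactly as the values
    of T_r at the nodes do. Interpolating T_r itself therefore adds up their absolute values. *)
Lemma cheb_lebesgue_sum (r : nat) (z : R) : 1 <= z ->
  \sum_(k < r.+1) \prod_(j | j != k) ((z - cheb_node j) / `|cheb_node k - cheb_node j|) =
  (chebyshev r).[z].
Proof.
move=> z1.
have inj : injective (@cheb_node r).
  move=> j k jk; apply/val_inj/eqP; case: ltngtP => // /cheb_node_mono;
  by rewrite jk ltxx.
rewrite (lagrange_interpolation z (size_chebyshev r) inj).
apply: eq_bigr => k _; rewrite cheb_node_val.
have -> : (-1) ^+ (r - k) = \prod_(j < r.+1 | j != k) (if (k < j)%N then -1 else 1) :> R.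
  rewrite -big_mkcondr/= (eq_bigl (fun j : 'I_r.+1 => (k < j)%N)); last first.
    by move=> j; case: ltngtP => [jk|kj|/val_inj ->]; rewrite ?eqxx ?andbT ?andbF//;
       rewrite -val_eqE /= gt_eqF.
  rewrite -(@big_geq_mkord _ _ _ k.+1 r.+1 xpredT (fun=> -1)).
  by rewrite prodr_const_nat subSS.
rewrite -big_split/=; apply: eq_bigr => j jk.
case: ltngtP => [kj|kj|/val_inj jkE]; last by rewrite jkE eqxx in jk.
  by rewrite ltr0_norm ?subr_lt0 ?cheb_node_mono// invrN mulN1r mulrN.
by rewrite gtr0_norm ?subr_gt0 ?cheb_node_mono// mul1r.
Qed.

End chebyshev.

Section remez.
Context (R : realType).
Local Notation leb := (@lebesgue_measure R).

Lemma lebesgue_setI_itv_lip (A : set R) (a u v : R) :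
  measurable (A : set (measurableTypeR R)) -> u <= v ->
  (leb (A `&` [set` `[a, v]]) <= leb (A `&` [set` `[a, u]]) + (v - u)%:E)%E.
Proof.
move=> mA uv; have mAt t : measurable (A `&` [set` `[a, t]] : set (measurableTypeR R)).
  exact: measurableI.
have -> : (v - u)%:E = leb [set` `[u, v]].
  rewrite lebesgue_measure_itv/= lte_fin; case: ltP => [_|vu]; first by rewrite -EFinD.
  by have -> : u = v; [apply/eqP; rewrite eq_le uv vu|rewrite subrr].
apply: le_trans (measureU2 _ _ _) => //.
apply: le_measure; rewrite ?inE//; first exact: measurableU.
move=> t [At] /=; rewrite !in_itv/= => /andP[at_ tv].
by have [tu|ut] := leP t u; [left|right]; rewrite /= ?in_itv/= ?at_ ?tu ?(ltW ut).
Qed.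

(** The distribution function of A is 1-Lipschitz, so it takes the value c at some z, perhaps
    outside A. It is constant across gaps of A, so z can be moved back to the last earlier point of
    A, or forward to the first point of A if there is none. *)
Lemma quantile (A : set R) (a b c : R) : closed A -> A !=set0 ->
  A `<=` [set` `[a, b]] -> 0 <= c -> (c%:E <= leb A)%E ->
  exists2 x, A x & leb (A `&` [set` `[a, x]]) = c%:E.
Proof.
move=> cA A0 Aab c0 cle.
have mA : measurable (A : set (measurableTypeR R)) by exact: closed_measurable.
have mAt t : measurable (A `&` [set` `[a, t]] : set (measurableTypeR R)).
  exact: measurableI.
have ab : a <= b.
  by have [x /Aab] := A0; rewrite /= in_itv/= => /andP[ax /(le_trans ax)].
have fin t : leb (A `&` [set` `[a, t]]) \is a fin_num.
  rewrite ge0_fin_numE//; apply: le_lt_trans (_ : _ <= leb [set` `[a, t]])%E _.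
    by apply: le_measure; rewrite ?inE//; exact: subIsetr.
  by rewrite lebesgue_measure_itv/=; case: ifPn => //; rewrite -EFinD ltry.
pose f t := fine (leb (A `&` [set` `[a, t]])).
have fE t : leb (A `&` [set` `[a, t]]) = (f t)%:E by rewrite /f fineK.
have fmono u v : u <= v -> f u <= f v.
  move=> uv; rewrite -lee_fin -!fE; apply: le_measure; rewrite ?inE//.
  by apply: setIS => t /=; rewrite !in_itv/= => /andP[-> /le_trans]; exact.
have flip u v : u <= v -> f v <= f u + (v - u).
  by move=> uv; rewrite -lee_fin EFinD -!fE; exact: lebesgue_setI_itv_lip.
have cf : continuous f.
  move=> x B /nbhs_ballP[e /= e0 eB]; apply/nbhs_ballP; exists e => //= y.
  rewrite /ball/= => xy; apply: eB; rewrite /ball/=; apply: le_lt_trans xy.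
  have [xy|/ltW yx] := leP x y.
    move: (fmono _ _ xy) (flip _ _ xy); move: (f x) (f y) => u v.
    by move=> uv vu; rewrite !ler0_norm ?subr_le0//; lra.
  move: (fmono _ _ yx) (flip _ _ yx); move: (f x) (f y) => u v.
  by move=> uv vu; rewrite !ger0_norm ?subr_ge0//; lra.
have fb : leb A = (f b)%:E by rewrite -fE; congr leb; exact/esym/setIidl.
have fa : f a = 0.
  apply/eqP; rewrite eq_le fine_ge0// andbT -lee_fin -fE.
  apply: (@le_trans _ _ (leb [set` `[a, a]])).
    by apply: le_measure; rewrite ?inE//; exact: subIsetr.
  by rewrite lebesgue_measure_itv/= ltxx.
have [z zab fz] : exists2 z, z \in `[a, b] & f z = c.
  apply: IVT => //; first exact: continuous_subspaceT.
  by rewrite fa min_l ?max_r ?c0/= -?lee_fin -?fb// fb lee_fin -fa fmono.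
move: zab; rewrite in_itv/= => /andP[az zb].
have fgap u v : u <= v -> (forall t, A t -> u < t -> v < t) -> f v = f u.
  move=> uv gap; rewrite /f; congr fine; congr leb.
  apply/seteqP; split => t [At]; rewrite /= !in_itv/= => /andP[at_ tv]; split => //=.
    by rewrite at_ leNgt; apply/negP => /(gap _ At); rewrite ltNge tv.
  by rewrite at_ (le_trans tv).
pose B := A `&` [set` `]-oo, z]].
have [[x0 Bx0]|B0] := pselect (B !=set0).
  have Bsup : has_sup B.
    by split; [exists x0|exists z => t [_]/=; rewrite in_itv].
  have cB : closed B by apply: closedI => //; exact: itv_closed.
  have [Asup supz] : B (sup B) by apply: cB; apply: closure_sup; [exists x0|exact: Bsup.2].
  exists (sup B) => //; rewrite fE -fz; congr EFin; apply/esym/fgap.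
    by move: supz; rewrite /= in_itv.
  move=> t At; apply: contraTT; rewrite -!leNgt => tz.
  by apply: sup_upper_bound => //; split => //=; rewrite in_itv.
have gapz t : A t -> z < t.
  by move=> At; rewrite ltNge; apply/negP => tz; apply: B0; exists t; split => //=; rewrite in_itv.
have Ainf : has_inf A.
  by split => //; exists z => t /gapz/ltW.
have Ai : A (inf A).
  apply: cA => N /nbhs_ballP[e /= e0 eN].
  have [y Ay ye] := inf_adherent e0 Ainf.
  exists y; split => //; apply: eN; rewrite /ball/= distrC ger0_norm ?subr_ge0.
    by rewrite ltrBlDl.
  exact: (inf_lbound Ainf.2).
exists (inf A) => //; rewrite fE; congr EFin.
have fz0 : f z = 0.
  rewrite -fa; apply: fgap => // t /gapz//.
rewrite -fz; have zi : z <= inf A by exact/ltW/gapz.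
rewrite fz0 /f (_ : _ `&` _ = [set inf A]).
  by rewrite lebesgue_measure_set1.
apply/seteqP; split => t /=.
  move=> [At]; rewrite in_itv/= => /andP[_ tA]; apply/eqP; rewrite eq_le tA/=.
  exact: (inf_lbound Ainf.2).
move=> ->; split => //; rewrite in_itv/= lexx andbT.
by have := Aab _ Ai; rewrite /= in_itv/= => /andP[].
Qed.

(* Otherwise the sublevel set contains quantiles spread like a Chebyshev grid on
   more than the fraction 1 - 1/(4r^2+2) of [a, b]; Lagrange interpolation there
   bounds |p(b)| by |p(b)|/2 times a value of the Chebyshev polynomial below 2. *)
Lemma remez_superlevel (r : nat) (p : {poly R}) (a b : R) :
  (size p <= r.+1)%N -> a < b ->
  (((b - a) / (4 * r%:R ^+ 2 + 2))%:E <=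
   leb [set t | (a <= t <= b)%R /\ (`|p.[b]| <= 2 * `|p.[t]|)%R])%E.
Proof.
move=> sp ab; set S := [set t | _].
pose s : R := (4 * r%:R ^+ 2 + 2)^-1.
have r20 : 0 <= r%:R ^+ 2 :> R by rewrite exprn_ge0.
have s0 : 0 < s by rewrite invr_gt0; lra.
have s1 : s <= 2^-1 by rewrite lef_pV2 ?posrE//; lra.
have cp : continuous (fun t => `|p.[t]|).
  move=> t; apply: (@continuous_comp _ _ _ (horner p)); first exact: continuous_horner.
  exact: norm_continuous.
have cS : closed S.
  have -> : S = [set` `[a, b]] `&` ((fun t => 2 * `|p.[t]|) @^-1` [set x | `|p.[b]| <= x]).
    by apply/seteqP; split => t; rewrite /S /= in_itv.
  apply: closedI; first exact: itv_closed.
  apply: closed_comp; last exact: closed_ge.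
  by move=> t _; apply: cvgM; [exact: cvg_cst|exact: cp].
have mS : measurable (S : set (measurableTypeR R)) by exact: closed_measurable.
rewrite leNgt -/s; apply/negP => Ss.
have litv : leb [set` `[a, b]] = (b - a)%:E.
  by rewrite lebesgue_measure_itv/= lte_fin ab -EFinD.
have pb0 : p.[b] != 0.
  apply/negP => /eqP pb; move: Ss; rewrite (_ : S = [set` `[a, b]]) ?litv ?lte_fin.
    by rewrite ltNge -[leRHS]mulr1 ler_pM2l ?subr_gt0//; lra.
  apply/seteqP; split => t; rewrite /S /= in_itv/=; first by case.
  by move=> ->; rewrite pb normr0 mulr_ge0.
pose A := [set t | a <= t <= b /\ 2 * `|p.[t]| <= `|p.[b]|].
have cA : closed A.
  have -> : A = [set` `[a, b]] `&` ((fun t => 2 * `|p.[t]|) @^-1` [set x | x <= `|p.[b]|]).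
    by apply/seteqP; split => t; rewrite /A /= in_itv.
  apply: closedI; first exact: itv_closed.
  apply: closed_comp; last exact: closed_le.
  by move=> t _; apply: cvgM; [exact: cvg_cst|exact: cp].
have mA : measurable (A : set (measurableTypeR R)) by exact: closed_measurable.
have Aab : A `<=` [set` `[a, b]] by move=> t [tab _]; rewrite /= in_itv.
have lA : (((1 - s) * (b - a))%:E <= leb A)%E.
  have : ((b - a)%:E <= leb A + leb S)%E.
    rewrite -litv; apply: le_trans (measureU2 _ _ _) => //.
    apply: le_measure; rewrite ?inE//; first exact: measurableU.
    move=> t /=; rewrite in_itv/= => tab.
    by have [H|/ltW H] := leP (2 * `|p.[t]|) `|p.[b]|; [left|right].
  move: Ss; have := measure_ge0 leb S; have := measure_ge0 leb A.
  case: (leb A) => [x| |] //; case: (leb S) => [y| |] //; rewrite ?leey//.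
  by rewrite -EFinD !lee_fin lte_fin => _ _; lra.
have A0 : A !=set0.
  apply/set0P/negP => /eqP A0; move: lA; rewrite A0 measure0 lee_fin leNgt.
  by rewrite mulr_gt0//; lra.
(* The prescribed masses are the Chebyshev nodes carried affinely from [-1, 1] to
   [0, (1 - s) (b - a)]. *)
pose c (k : 'I_r.+1) := (1 - s) * (b - a) * (1 + cheb_node R k) / 2.
have c0 k : 0 <= c k.
  rewrite /c divr_ge0// mulr_ge0//; last by have := cheb_node_ge R k; lra.
  by rewrite mulr_ge0//; lra.
have cle k : ((c k)%:E <= leb A)%E.
  have k1 : (1 + cheb_node R k) / 2 <= 1 by have := cheb_node_le R k; lra.
  have sb : 0 <= (1 - s) * (b - a) by rewrite mulr_ge0//; lra.
  by apply: le_trans lA; rewrite lee_fin /c -mulrA ler_piMr.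
have Q k : exists x, A x /\ leb (A `&` [set` `[a, x]]) = (c k)%:E.
  by have [x Ax xc] := quantile cA A0 Aab (c0 k) (cle k); exists x.
have [x xP] := choice Q.
(* Between two quantiles lies a part of A of measure [c k - c j]. *)
have gap j k : c j < c k -> c k - c j <= x k - x j.
  move=> jk; have [_ xj] := xP j; have [_ xk] := xP k.
  have xjk : x j <= x k.
    rewrite leNgt; apply/negP => /ltW kj; move: jk; rewrite ltNge -lee_fin -xj -xk.
    move/negP; apply; apply: le_measure; rewrite ?inE//; [exact: measurableI..|].
    by apply: setIS => t /=; rewrite !in_itv/= => /andP[-> /le_trans]; exact.
  have := lebesgue_setI_itv_lip a mA xjk; rewrite xj xk -EFinD lee_fin; lra.
have cx k : c k <= x k - a.
  have [/Aab + xk] := xP k; rewrite /= in_itv/= => /andP[ax _].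
  rewrite -lee_fin -xk; apply: (@le_trans _ _ (leb [set` `[a, x k]])).
    by apply: le_measure; rewrite ?inE//; exact: measurableI.
  rewrite lebesgue_measure_itv/=; case: ifPn => _; first by rewrite -EFinD.
  by rewrite lee_fin subr_ge0.
have xb k : x k <= b by have [/Aab + _] := xP k; rewrite /= in_itv/= => /andP[].
pose K := (1 - s) * (b - a) / 2.
have K0 : 0 < K by rewrite divr_gt0// mulr_gt0//; lra.
have cE j k : c k - c j = K * (cheb_node R k - cheb_node R j) by rewrite /c /K; field.
have nodes_neq j k : j != k -> cheb_node R j != cheb_node R k.
  rewrite -val_eqE /=; case: ltngtP => // jk _; first by rewrite lt_eqF// cheb_node_mono.
  by rewrite gt_eqF// cheb_node_mono.
have xdist j k : j != k -> K * `|cheb_node R k - cheb_node R j| <= `|x k - x j|.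
  move=> /nodes_neq; rewrite neq_lt => /orP[jk|jk].
    rewrite gtr0_norm ?subr_gt0// -cE (le_trans (gap _ _ _)) ?ler_norm//.
    by rewrite -subr_gt0 cE mulr_gt0 ?subr_gt0.
  rewrite distrC [leRHS]distrC gtr0_norm ?subr_gt0// -cE (le_trans (gap _ _ _)) ?ler_norm//.
  by rewrite -subr_gt0 cE mulr_gt0 ?subr_gt0.
have xinj : injective x.
  move=> j k xjk; apply/eqP/negPn/negP => jk; have := xdist _ _ jk.
  rewrite xjk subrr normr0 leNgt pmulr_rgt0// normr_gt0 subr_eq0 eq_sym.
  by rewrite nodes_neq.
(* When [0, (1 - s) (b - a)] is rescaled to [-1, 1], the point b - a lands at 2 / (1 - s) - 1 = 1 +
   y. With this s one has 2 y r^2 < 1, which puts T_r(1 + y) strictly below 2. *)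
pose y := 2 / (4 * r%:R ^+ 2 + 1) : R.
have y0 : 0 <= y by rewrite divr_ge0//; lra.
have yr : 2 * y * r%:R ^+ 2 < 1.
  have D0 : 0 < 4 * r%:R ^+ 2 + 1 :> R by lra.
  have -> : 2 * y * r%:R ^+ 2 = 4 * r%:R ^+ 2 / (4 * r%:R ^+ 2 + 1).
    by rewrite /y; field; rewrite gt_eqF.
  by rewrite ltr_pdivrMr// mul1r ltrDl.
have zE : 1 + y = 2 / (1 - s) - 1.
  rewrite /y /s; field; apply/andP; split; apply/lt0r_neq0; nra.
have bx j : b - x j <= K * (1 + y - cheb_node R j).
  apply: (@le_trans _ _ (b - a - c j)); first by have := cx j; lra.
  rewrite zE le_eqVlt; apply/orP; left; apply/eqP; rewrite /K /c; field.
  by apply/lt0r_neq0; lra.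
have : `|p.[b]| <= `|p.[b]| / 2 * (chebyshev R r).[1 + y].
  rewrite -cheb_lebesgue_sum ?lerDl// mulr_sumr.
  rewrite {1}(lagrange_interpolation b sp xinj).
  apply: le_trans (ler_norm_sum _ _ _) _; apply: ler_sum => k _.
  rewrite normrM ler_pM//.
    by rewrite ler_pdivlMr// mulrC; have [[_]] := xP k.
  (* Factor by factor: relative to the rescaled Chebyshev grid the points x are at least as far from
     each other and at most as far from b. *)
  rewrite normr_prod; apply: ler_prod => j jk; rewrite normr_ge0/=.
  have d0 : 0 < `|cheb_node R k - cheb_node R j|.
    by rewrite normr_gt0 subr_eq0 nodes_neq// eq_sym.
  rewrite normrM normfV ger0_norm ?subr_ge0//.
  rewrite ler_pdivlMr// mulrAC ler_pdivrMr; last first.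
    by rewrite normr_gt0 subr_eq0; apply: contra jk => /eqP/xinj ->.
  have b0 : 0 <= b - x j by rewrite subr_ge0.
  have h1 := bx j; have h2 := xdist _ _ jk.
  apply: (@le_trans _ _ (K * (1 + y - cheb_node R j) * `|cheb_node R k - cheb_node R j|)).
    by rewrite ler_wpM2r// ltW.
  rewrite mulrAC mulrC ler_wpM2l//.
  have := cheb_node_le R j; lra.
apply/negP; rewrite -ltNge -[ltRHS]mulr1 -mulrA ltr_pM2l ?normr_gt0//.
have := @chebyshev_right R r r y y0 (ltW yr) (leqnn r); lra.
Qed.

End remez.

(** * Differentiability of Lipschitz functions *)

Section lipschitz_derivable.
Context (R : realType).
Local Notation leb := (@lebesgue_measure R).

Lemma continuous_lipschitzR (f : R -> R) (k : R) :
  (forall x y, `|f x - f y| <= k * `|x - y|) -> continuous f.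
Proof.
move=> fk x A /nbhs_ballP[e /= e0 eA].
have k0 : 0 < `|k| + 1 by rewrite ltr_wpDl.
apply/nbhs_ballP; exists (e / (`|k| + 1)) => /=; first by rewrite divr_gt0.
move=> y; rewrite /ball/= ltr_pdivlMr// => xy; apply: eA; rewrite /ball/=.
apply: le_lt_trans (fk _ _) _; apply: le_lt_trans xy.
by rewrite mulrC ler_wpM2l// (le_trans (ler_norm _))// lerDl.
Qed.

Lemma lebesgue_stieltjes_measure_itv (g : cumulative R R) (a b : R) : a <= b ->
  lebesgue_stieltjes_measure g [set` `]a, b]] = (g b - g a)%:E.
Proof.
move=> ab; rewrite /lebesgue_stieltjes_measure /measure_extension/=.
by rewrite measurable_mu_extE/= ?wlength_itv_bnd//; exact: is_ocitv.
Qed.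

(** The function k x - g(x) is nondecreasing too, and its Stieltjes measure adds up with that of g
    to k times Lebesgue measure. *)
Lemma lebesgue_stieltjes_measure_le (f : R -> R) (g : cumulative R R) (k : R) :
  0 < k -> (forall x y, x <= y -> g y - g x <= k * (y - x)) ->
  forall A, measurable (A : set (measurableTypeR R)) ->
    (lebesgue_stieltjes_measure g A <= k%:E * leb A)%E.
Proof.
move=> k0 gk A mA.
pose h x := k * x - g x.
have ndh : nondecreasing h by move=> x y xy; rewrite /h; have := gk _ _ xy; lra.
have ndg : nondecreasing g := cumulative_is_nondecreasing g.
have ch : right_continuous h.
  apply: right_continuousW; apply: (@continuous_lipschitzR _ k) => x y.
  rewrite /h; have [xy|/ltW yx] := leP x y.
    have := gk _ _ xy; have := ndg _ _ xy => a b.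
    by rewrite !ler0_norm; lra.
  have := gk _ _ yx; have := ndg _ _ yx => a b.
  by rewrite !ger0_norm; lra.
pose hC := isCumulative.Build R _ R h ndh ch.
pose hc : cumulative R R := HB.pack h hC.
have ki0 : 0 <= k^-1 by rewrite invr_ge0 ltW.
pose mg : {measure set (measurableTypeR R) -> \bar R} := lebesgue_stieltjes_measure g.
pose mh : {measure set (measurableTypeR R) -> \bar R} := lebesgue_stieltjes_measure hc.
have mE X : mscale (NngNum ki0) (measure_add mg mh) X = (k^-1%:E * (mg X + mh X))%E.
  by rewrite /mscale; congr (_ * _)%E; exact: measure_addE.
suff -> : leb A = (k^-1%:E * (mg A + mh A))%E.
  by rewrite muleA -EFinM mulfV ?gt_eqF// mul1e leeDl.
rewrite -mE; apply: lebesgue_measure_unique => // _ [[a b] _ <-].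
rewrite [RHS]mE /=.
have [ab|ba] := leP a b; last first.
  by rewrite set_itv_ge ?measure0 ?adde0 ?mule0// bnd_simp -leNgt ltW.
have -> : mg [set` `]a, b]] = (g b - g a)%:E by exact: lebesgue_stieltjes_measure_itv.
have -> : mh [set` `]a, b]] = (h b - h a)%:E by exact: lebesgue_stieltjes_measure_itv.
rewrite -EFinD -EFinM; have := @lebesgue_measure_itv R `]a, b]; rewrite /= => ->.
rewrite lte_fin; case: ltP => [_|ba].
  by rewrite -EFinD; congr EFin; rewrite /h; field; rewrite gt_eqF.
have -> : a = b by apply/eqP; rewrite eq_le ab ba.
by rewrite !subrr addr0 mulr0.
Qed.

(** Adding k x makes f monotone, with a Stieltjes measure dominated by Lebesgue measure. Its
    Radon-Nikodym density recovers the function by integration, and Lebesgue's differentiation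
    theorem applies. Cutting at N makes the measure finite and the density integrable. *)
Lemma lipschitz_derivable_itv (f : R -> R) (k : R) (N : R) :
  0 < k -> 0 < N -> (forall x y, `|f x - f y| <= k * `|x - y|) ->
  {ae leb, forall x, - N < x < N -> derivable f x 1}.
Proof.
move=> k0 N0 fk.
pose g x := f x + k * x.
have gmono x y : x <= y -> 0 <= g y - g x <= (2 * k) * (y - x).
  move=> xy; have := fk y x; rewrite ler_norml (ger0_norm (_ : 0 <= y - x)) ?subr_ge0//.
  by rewrite /g => /andP[h1 h2]; apply/andP; split; lra.
have ndg : nondecreasing g by move=> x y /gmono /andP[]; rewrite subr_ge0.
have cg : right_continuous g.
  apply: right_continuousW; apply: (@continuous_lipschitzR _ (2 * k)) => x y.
  have [xy|/ltW yx] := leP x y.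
    by have /andP[h1 h2] := gmono _ _ xy; rewrite !ler0_norm; lra.
  by have /andP[h1 h2] := gmono _ _ yx; rewrite !ger0_norm; lra.
pose gC := isCumulative.Build R _ R g ndg cg.
pose gc : cumulative R R := HB.pack g gC.
pose mg : {measure set (measurableTypeR R) -> \bar R} := lebesgue_stieltjes_measure gc.
have k20 : 0 < 2 * k by rewrite mulr_gt0.
have mgle A : measurable (A : set (measurableTypeR R)) -> (mg A <= (2 * k)%:E * leb A)%E.
  apply: (@lebesgue_stieltjes_measure_le _ gc) => // x y /gmono /andP[] //.
pose D : set (measurableTypeR R) := [set` `]- N, N]].
have mD : measurable D by exact: measurable_itv.
have NN : - N <= N by lra.
have Doo : (mg D < +oo)%E.
  by rewrite /mg/= (lebesgue_stieltjes_measure_itv gc NN) ltry.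
pose nu : {finite_measure set (measurableTypeR R) -> \bar R} := mfrestr mD Doo.
have numu : nu `<< leb.
  apply/null_content_dominatesP => A mA A0.
  apply/eqP; rewrite eq_le measure_ge0 andbT.
  have mAD : measurable (A `&` D) by exact: measurableI.
  apply: (le_trans (mgle _ mAD)).
  have -> : leb (A `&` D) = 0.
    by apply/eqP; rewrite eq_le measure_ge0 andbT -A0 le_measure ?inE.
  by rewrite mule0.
have [phi [phi0 phifin iphi phiE]] := radon_nikodym_sigma_finite numu.
pose p x := fine (phi x).
have phip : phi = EFin \o p by apply/funext => x /=; rewrite fineK.
have ip : leb.-integrable setT (EFin \o p) by rewrite -phip.
have ipy y : leb.-integrable [set` `]-oo, y]] (EFin \o p).
  exact: integrableS ip.
have lp := open_integrable_locally openT ip.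
have := FTC1Ny ipy lp; apply: filterS; first exact: (ae_filter_ringOfSetsType leb).
move=> x /= [dF _] /andP[Nx xN].
have FE y : - N < y < N -> (\int[leb]_(t in [set` `]-oo, y]]) p t)%R = g y - g (- N).
  move=> /andP[Ny yN]; rewrite /Rintegral -[RHS]/(fine (g y - g (- N))%:E); congr fine.
  rewrite -(lebesgue_stieltjes_measure_itv gc (ltW Ny)).
  rewrite (_ : (fun x => (p x)%:E) = phi) -?phiE//.
  rewrite /nu/= /mfrestr /mrestr; congr (mg _).
  apply/seteqP; split => t /=; rewrite /D/= !in_itv/=.
    by move=> [ty /andP[-> _]]; rewrite ty.
  by move=> /andP[-> ty]; rewrite ty (le_trans ty)// ltW.
have dg : derivable g x 1.
  pose F (y : R) := (\int[leb]_(t in [set` `]-oo, y]]) p t)%R.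
  have : derivable (F + cst (g (- N))) x 1 by exact: derivableD.
  apply: near_eq_derivable => //.
  near=> y.
  have yN : - N < y < N.
    by apply/andP; split; near: y; [exact: lt_nbhsr|exact: lt_nbhsl].
  have : F y + g (- N) = g y by rewrite /F FE// subrK.
  exact.
have -> : f = g - (fun y => k * y) by apply/funext => y; rewrite /g !fctE addrK.
by apply: derivableB => //; exact: derivableM.
Unshelve. all: by end_near. Qed.

Lemma lipschitz_derivable_ae (f : R -> R) (k : R) :
  (forall x y, `|f x - f y| <= k * `|x - y|) ->
  {ae leb, forall x, derivable f x 1}.
Proof.
move=> fk.
have k0 : 0 < `|k| + 1 by rewrite ltr_wpDl.
have fk1 x y : `|f x - f y| <= (`|k| + 1) * `|x - y|.
  apply: le_trans (fk _ _) _; rewrite ler_wpM2r//.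
  by rewrite (le_trans (ler_norm _))// lerDl.
have H : forall N : nat, {ae leb, forall x, - N.+1%:R < x < N.+1%:R -> derivable f x 1}.
  by move=> N; apply: lipschitz_derivable_itv fk1.
have := ae_foralln H; apply: filterS => x /= Hx.
apply: (Hx (Num.bound `|x|)).
rewrite -ltr_norml (lt_trans (archi_boundP _))// ltr_nat//.
Qed.

End lipschitz_derivable.

Section differentiability_rV.
Context (R : realType) (n : nat).

Let dotv_linear (g : 'rV[R]_n) : linear_for *%R (dotv g).
Proof. by move=> a x y; rewrite dotvDr dotvZr. Qed.

HB.instance Definition _ (g : 'rV[R]_n) :=
  GRing.isLinear.Build R 'rV[R]_n R *%R (dotv g) (@dotv_linear g).

Lemma differentiable_dotv (f : 'rV[R]_n -> R) (x g : 'rV[R]_n) :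
  (forall e, 0 < e -> exists2 d, 0 < d & forall v, enorm v < d ->
     `|f (x + v) - f x - dotv g v| <= e * enorm v) ->
  differentiable f x.
Proof.
move=> fg.
(* P is the property by which the differential at x is selected; once [dotv g] satisfies it, the
   selected map does. *)
pose P := (fun (df : {linear 'rV[R]_n -> R}) => continuous df /\ forall y,
      f y = f (lim (nbhs x)) + df (y - lim (nbhs x)) +o_(y \near nbhs x) (y - lim (nbhs x))).
have lx : lim (nbhs x) = x by exact: lim_id.
have k0 : 0 < n%:R + 1 :> R by rewrite ltr_wpDl.
have H : f = (cst (f x) + dotv g \o center x) +o_ x (center x).
  apply/eqaddoP => e e0.
  have e1 : 0 < e / (n%:R + 1) by rewrite divr_gt0.
  have [d d0 dP] := fg _ e1.
  apply/nbhs_enormP; exists d => // y yx.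
  have := dP _ yx; rewrite (addrC x) subrK => h.
  have -> : (f - (cst (f x) + dotv g \o center x)) y = f y - f x - dotv g (y - x).
    by rewrite !fctE opprD addrA.
  apply: le_trans h _; rewrite mulrAC ler_pdivrMr// -mulrA ler_pM2l//.
  apply: le_trans (enorm_le_norm _) _; rewrite mulrC ler_wpM2l//.
  by rewrite lerDl.
have : P (dotv g : {linear 'rV[R]_n -> R}).
  split; first exact: continuous_dotv.
  move: H; rewrite funeqE => H'; apply: eqaddoEx => y; rewrite lx; exact: H'.
move=> Pg; have [dfc dfE] := getPex (ex_intro P (dotv g) Pg).
by constructor; split => //; rewrite funeqE.
Qed.

Lemma differentiable_estimate (f : 'rV[R]_n -> R) (x : 'rV[R]_n) :
  differentiable f x ->
  forall e, 0 < e -> exists2 d, 0 < d & forall v, enorm v < d ->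
     `|f (x + v) - f x - dotv (grad f x) v| <= e * enorm v.
Proof.
move=> df e e0.
have dE v : 'd f x v = dotv (grad f x) v.
  rewrite [in LHS](row_sum_delta v) linear_sum /dotv; apply: eq_bigr => j _.
  by rewrite linearZ /= -deriveE// mxE mulrC.
have /diff_locally := df => /eqaddoP.
have k0 : 0 < n%:R + 1 :> R by rewrite ltr_wpDl.
move=> /(_ e e0) /nbhs_enormP[d d0 dP]; exists d => // v vd.
have := dP v; rewrite subr0 => /(_ vd) /= h.
rewrite -dE [x + v]addrC; apply: le_trans (_ : _ <= e * `|v|) _.
  by apply: le_trans h; rewrite !fctE/= opprD addrA.
by rewrite ler_pM2l// norm_le_enorm.
Qed.

End differentiability_rV.

(** * Null sets by slicing, porosity and Rademacher's theorem *)

Section slices.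
Context (R : realType).
Local Notation leb := (@lebesgue_measure R).

Lemma lebesgue_rV_slice0 (n : nat) (S : set (borel_rV R n.+1)) : measurable S ->
  (forall b, leb [set a | S (cons_rV (a, b))] = 0) ->
  lebesgue_rV R n.+1 S = 0.
Proof.
move=> mS S0.
have mS' : measurable (@cons_rV R n @^-1` S).
  by rewrite -[X in measurable X]setTI; exact: measurable_cons_rV.
have := indic_fubini_tonelli leb (lebesgue_rV R n) mS'.
rewrite indic_fubini_tonelli_FE// indic_fubini_tonelli_GE// => H.
rewrite -[LHS]/(\int[leb]_a (lebesgue_rV R n \o xsection (@cons_rV R n @^-1` S)) a)%E H.
apply: integral0_eq => y _ /=; rewrite -[RHS](S0 y); congr (leb _).
by apply/seteqP; split => a; rewrite /ysection/= inE.
Qed.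

(** Exchanging coordinates 0 and l is an orthogonal map, which reduces the claim to slices in the
    first coordinate. *)
Lemma lebesgue_rV_slice (n : nat) (l : 'I_n.+1) (S : set 'rV[R]_n.+1) :
  measurable (S : set (borel_rV R n.+1)) ->
  (forall w, leb [set h | S (w + h *: delta_mx 0 l)] = 0) ->
  lebesgue_rV R n.+1 S = 0.
Proof.
move=> mS S0; pose Q : 'M[R]_n.+1 := perm_mx (tperm 0 l).
have QQ : Q *m Q^T = 1%:M by rewrite tr_perm_mx tpermV -perm_mxM tperm2 perm_mx1.
have mQ : measurable_fun setT (fun x : borel_rV R n.+1 => (x : 'rV[R]_n.+1) *m Q : borel_rV R n.+1).
  by apply: (@continuous_measurable_rV _ _ _ (mulmx^~ Q)); exact: continuous_orth.
have mS' : measurable ([set x : 'rV[R]_n.+1 | S (x *m Q)] : set (borel_rV R n.+1)).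
  by rewrite -[X in measurable X]setTI; exact: mQ.
rewrite -(lebesgue_rV_orth QQ mS); apply: lebesgue_rV_slice0 => // b.
rewrite -[RHS](S0 ((cons_rV (0, b) : 'rV[R]_n.+1) *m Q)); congr (leb _).
have E (a : R) : (cons_rV (a, b) : 'rV[R]_n.+1) *m Q =
    (cons_rV (0, b) : 'rV[R]_n.+1) *m Q + a *: delta_mx 0 l.
  have -> : (delta_mx 0 l : 'rV[R]_n.+1) = delta_mx 0 0 *m Q.
    by apply/rowP => j; rewrite -rowE !mxE tpermL eq_sym eqxx.
  rewrite scalemxAl -mulmxDl; congr (_ *m _); apply/rowP => j.
  have [k|] := unliftP 0 j.
    by move=> ->; rewrite [RHS]mxE !cons_rV_lift !mxE /= mulr0 addr0.
  by move=> ->; rewrite [RHS]mxE !cons_rV0 !mxE eqxx mulr1 add0r.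
by apply/funext => a; exact: (congr1 S (E a)).
Qed.

End slices.

Section porous.
Context (R : realType).
Local Notation leb := (@lebesgue_measure R).

(* A point of B is not a Lebesgue density point of S. *)
Lemma porous_null (S B : set R) (eta : R) :
  measurable (S : set (measurableTypeR R)) ->
  measurable (B : set (measurableTypeR R)) -> 0 < eta <= 1 -> B `<=` S ->
  (forall t, B t -> forall k : nat, exists h, [/\ h != 0, `|h| < k.+1%:R^-1 &
     forall s, `|s - (t + h)| < eta * `|h| -> ~ S s]) ->
  leb B = 0.
Proof.
move=> mS mB /andP[eta0 eta1] BS por.
have [N [mN N0 NP]] := lebesgue_density mS.
suff BN : forall t : R, B t -> N t by exact: (subset_measure0 mB mN BN N0).
move=> t Bt; apply: NP => /= cvgt.
move: cvgt; rewrite indicE mem_set; last exact: BS.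
(* The ball of radius 2 |h| around t has length 4 |h| and contains a hole of length 2 eta |h|, so at
   arbitrarily small scales the density is at most 1 - eta / 2. *)
have lt1 : nbhs 1%:E [set y : \bar R | ((1 - eta / 2)%:E < y)%E].
  apply: open_nbhs_nbhs; split; first exact: open_ereal_gt_ereal.
  by rewrite /= lte_fin ltrBlDr ltrDl divr_gt0.
move=> /(_ _ lt1) [d /= d0 dP].
have [k kd] : exists k : nat, k.+1%:R^-1 < d / 2 :> R.
  by have [k _ kP] := near_infty_natSinv_lt (PosNum (divr_gt0 d0 (ltr0n _ 2)));
    exists k; exact: (kP k (leqnn k)).
have [h [h0 hk gap]] := por _ Bt k.
have h_gt0 : 0 < `|h| by rewrite normr_gt0.
have r0 : 0 < 2 * `|h| by rewrite mulr_gt0.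
have := dP (2 * `|h|); rewrite /ball/= sub0r normrN gtr0_norm// => /(_ _ r0).
have -> : 2 * `|h| < d by rewrite mulrC -ltr_pdivlMr// (lt_trans hk kd).
move=> /(_ isT).
rewrite lebesgue_measure_ball ?ltW//.
apply/negP; rewrite -leNgt.
have -> : ((2 * `|h| *+ 2)%:E^-1 = ((2 * `|h| *+ 2)^-1)%:E)%E.
  by rewrite inver mulrn_eq0/= gt_eqF.
rewrite lee_pdivrMr ?lte_fin ?pmulrn_lgt0//.
have sub : S `&` ball t (2 * `|h|) `<=` ball t (2 * `|h|) `\` ball (t + h) (eta * `|h|).
  move=> s [Ss ts]; split => //; rewrite /ball/= distrC => sth.
  exact: gap sth Ss.
have m1 : measurable (ball t (2 * `|h|) : set (measurableTypeR R)) by exact: measurable_ball.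
have m2 : measurable (ball (t + h) (eta * `|h|) : set (measurableTypeR R)) by exact: measurable_ball.
have v1 : leb (ball t (2 * `|h|)) = (2 * `|h| *+ 2)%:E.
  exact: lebesgue_measure_ball (ltW r0).
have v2 : leb (ball (t + h) (eta * `|h|)) = (eta * `|h| *+ 2)%:E.
  by apply: lebesgue_measure_ball; rewrite mulr_ge0 ?ltW.
have b2 : ball (t + h) (eta * `|h|) `<=` ball t (2 * `|h|).
  move=> s; rewrite /ball/= => sth.
  rewrite (_ : t - s = (t + h - s) - h); last by ring.
  apply: le_lt_trans (ler_normB _ _) _.
  have : eta * `|h| <= 1 * `|h| by rewrite ler_wpM2r.
  lra.
have m3 : measurable (S `&` ball t (2 * `|h|) : set (measurableTypeR R)) by exact: measurableI.
have : (leb (S `&` ball t (2 * `|h|)%R) + leb (ball (t + h)%R (eta * `|h|)%R) <=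
        leb (ball t (2 * `|h|)%R))%E.
  rewrite -measureU//.
    apply: le_measure; rewrite ?inE//; first exact: measurableU.
    by move=> s [[_ //]|/b2].
  by apply/seteqP; split => s // [/sub[_]].
rewrite v1 v2; case: (leb _) => [x| |]//; last by move=> _; exact: leNye.
rewrite -EFinD -EFinM !lee_fin; move: `|h| => H xle.
rewrite (_ : (1 - eta / 2) * (2 * H *+ 2) = 2 * H *+ 2 - eta * H *+ 2) ?lerBrDr//.
by rewrite [2 * H *+ 2]mulr2n [eta * H *+ 2]mulr2n; field.
Qed.

End porous.

Section rademacher.
Context (R : realType) (n : nat) (phi : 'rV[R]_n -> R) (K : R).
Hypothesis phiK : forall x y, `|phi x - phi y| <= K * enorm (x - y).
Local Notation leb := (@lebesgue_measure R).
Local Notation e l := (delta_mx 0 l : 'rV[R]_n).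

Lemma enorm_delta (l : 'I_n) (h : R) : enorm (h *: e l) = `|h|.
Proof.
rewrite enormZ (_ : enorm (e l) = 1) ?mulr1// /enorm /dotv (bigD1 l)//=.
rewrite big1 ?addr0 => [|j jl]; first by rewrite mxE !eqxx mulr1 sqrtr1.
by rewrite mxE (negbTE jl) andbF mul0r.
Qed.

(* The closed sets from which differentiability is built by countable operations:
   p is the slope up to 1/(m+1) at all scales below 1/(j+1). *)
Definition quotient_near (l : 'I_n) (p : R) (m j : nat) : set 'rV[R]_n :=
  [set w | forall h, `|h| <= j.+1%:R^-1 ->
     `|phi (w + h *: e l) - phi w - p * h| <= `|h| / m.+1%:R].

Lemma closed_quotient_near l p m j : closed (quotient_near l p m j).
Proof.
have -> : quotient_near l p m j =
    \bigcap_(h in [set h | `|h| <= j.+1%:R^-1])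
      ((fun w => `|phi (w + h *: e l) - phi w - p * h|) @^-1` [set x | x <= `|h| / m.+1%:R]).
  by apply/seteqP; split => w H h; exact: H.
apply: closed_bigI => h _; apply: closed_comp; last exact: closed_le.
move=> w _; apply: (@enorm_lipschitz_continuous _ _ _ (2 * K)) => x y.
apply: le_trans (ler_dist_dist _ _) _.
rewrite (_ : _ - _ = (phi (x + h *: e l) - phi (y + h *: e l)) - (phi x - phi y)); last by ring.
apply: le_trans (ler_normB _ _) _.
have := phiK (x + h *: e l) (y + h *: e l); have := phiK x y.
by rewrite opprD addrACA subrr addr0; lra.
Qed.

(** Rational slopes replace the unknown derivative, which keeps the set Borel. *)
Definition has_partial (l : 'I_n) : set 'rV[R]_n :=
  \bigcap_m \bigcup_(q : rat) \bigcup_j quotient_near l (ratr q) m j.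

Lemma measurable_has_partial l : measurable (has_partial l : set (borel_rV R n)).
Proof.
apply: bigcapT_measurable => m; apply: countable_bigcupT_measurable => // q.
apply: bigcup_measurable => j _; apply: closed_measurable_rV.
exact: closed_quotient_near.
Qed.

Lemma derivable_has_partial (l : 'I_n) (w : 'rV[R]_n) (t : R) :
  derivable (fun s : R => phi (w + s *: e l)) t 1 -> has_partial l (w + t *: e l).
Proof.
set g := fun s => _ => /cvg_ex[/= D /(@cvgrPdist_lt _ R^o) gD] m _.
have m0 : 0 < m.+1%:R^-1 / 2 :> R by rewrite divr_gt0.
have [d /= d0 dP] := gD _ m0.
have [q qD] : exists q : rat, `|ratr q - D| < m.+1%:R^-1 / 2.
  have /rat_in_itvoo[q /itvP qx] : D - m.+1%:R^-1 / 2 < D + m.+1%:R^-1 / 2.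
    by rewrite ltrD2l gtrN.
  by exists q; rewrite ltr_distl !qx.
have [j jd] : exists j : nat, j.+1%:R^-1 < d :> R.
  by have [j _ jP] := near_infty_natSinv_lt (PosNum d0); exists j; exact: (jP j (leqnn j)).
exists q => //; exists j => // h hj.
have [->|h0] := eqVneq h 0; first by rewrite scale0r addr0 subrr mulr0 subr0 normr0 mul0r.
have h_gt0 : 0 < `|h| by rewrite normr_gt0.
have := dP h; rewrite /ball/= sub0r normrN (le_lt_trans hj jd) => /(_ isT h0).
rewrite /g /=.
have -> : w + (h *: 1 + t) *: e l = w + t *: e l + h *: e l.
  by rewrite [h *: 1]mulr1 scalerDl [h *: e l + _]addrC addrA.
move=> Dh.
set a := phi _ - phi _ in Dh *.
have -> : a - ratr q * h = h * ((h^-1 * a - D) + (D - ratr q)) by field.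
rewrite normrM ler_wpM2l//; apply: le_trans (ler_normD _ _) _.
have := ltW Dh; have := ltW qD; rewrite distrC => h1.
rewrite distrC => h2; have := lerD h2 h1; rewrite -splitr; exact.
Qed.

(** The intervals of radius 1/(m+1) around the approximate slopes meet pairwise, as a common small h
    shows. The supremum of their left ends lies in all of them and is the derivative. *)
Lemma has_partialP (l : 'I_n) (w : 'rV[R]_n) : has_partial l w ->
  exists p : R, forall eps : R, 0 < eps -> exists2 d : R, 0 < d & forall h : R, `|h| < d ->
    `|phi (w + h *: e l) - phi w - p * h| <= eps * `|h|.
Proof.
move=> Dw.
have /choice[pj pjP] : forall m, exists pj : R * nat, quotient_near l pj.1 m pj.2 w.
  by move=> m; have [q _ [j _ qj]] := Dw m I; exists (ratr q, j).
have dist m m' : (pj m).1 - m.+1%:R^-1 <= (pj m').1 + m'.+1%:R^-1.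
  pose h : R := Num.min (pj m).2.+1%:R^-1 (pj m').2.+1%:R^-1.
  have h0 : 0 < h by rewrite lt_min !invr_gt0 !ltr0n.
  have h1 : `|h| <= (pj m).2.+1%:R^-1 by rewrite gtr0_norm// /h ge_min lexx.
  have h2 : `|h| <= (pj m').2.+1%:R^-1 by rewrite gtr0_norm// /h ge_min lexx orbT.
  have := pjP m h h1; have := pjP m' h h2.
  set a := phi _ - phi _; rewrite !ler_norml (gtr0_norm h0).
  move=> /andP[a1 a2] /andP[a3 a4].
  rewrite -(ler_pM2r h0) mulrBl mulrDl ![_^-1 * h]mulrC.
  move: a1 a2 a3 a4; set u := h / _; set v := h / _.
  set b := _ * h; set c := _ * h; lra.
pose P := range (fun m => (pj m).1 - m.+1%:R^-1).
have Pub m : ubound P ((pj m).1 + m.+1%:R^-1) by move=> _ [m' _ <-]; exact: dist.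
have Psup : has_sup P by split; [exists ((pj 0%N).1 - 1%:R^-1), 0%N|exists ((pj 0%N).1 + 1%:R^-1); exact: Pub].
exists (sup P) => eps eps0.
have [m mP] : exists m : nat, m.+1%:R^-1 < eps / 2 :> R.
  by have [m _ mP] := near_infty_natSinv_lt (PosNum (divr_gt0 eps0 (ltr0n _ 2)));
    exists m; exact: (mP m (leqnn m)).
exists ((pj m).2.+1%:R^-1); first by rewrite invr_gt0.
move=> h hm; have := pjP m h (ltW hm); set a := phi _ - phi _ => ah.
have p1 : sup P <= (pj m).1 + m.+1%:R^-1 by apply: sup_le_ub; [exact: Psup.1|exact: Pub].
have p2 : (pj m).1 - m.+1%:R^-1 <= sup P by apply: sup_upper_bound => //; exists m.
rewrite (_ : a - sup P * h = (a - (pj m).1 * h) + ((pj m).1 - sup P) * h); last by ring.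
apply: le_trans (ler_normD _ _) _; rewrite normrM.
have : `|(pj m).1 - sup P| * `|h| <= eps / 2 * `|h|.
  rewrite ler_wpM2r// ler_norml; move: mP p1 p2; set u := _^-1 => mP p1 p2.
  by apply/andP; split; lra.
have : `|h| / m.+1%:R <= eps / 2 * `|h| by rewrite mulrC ler_wpM2r// ltW.
by move: ah; set u := `|h| / _; set b := `|a - _|; set c := _ * `|h|; lra.
Qed.

(** The holes are balls of the whole space centred on the line. On the line they leave interval
    holes, so one-dimensional density applies; their absence yields a point of A close to the line,
    though not on it. Rational steps q keep the set Borel. *)
Definition porous_part (l : 'I_n) (A : set 'rV[R]_n) (eta : R) : set 'rV[R]_n :=
  A `&` \bigcap_(k : nat) \bigcup_(q in [set q : rat | q != 0 /\ `|ratr q : R| < k.+1%:R^-1])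
    \bigcap_(a in A) [set w | eta * `|ratr q : R| <= enorm (a - (w + ratr q *: e l))].

Lemma measurable_porous_part l A eta : closed A ->
  measurable (porous_part l A eta : set (borel_rV R n)).
Proof.
move=> cA; apply: measurableI; first exact: closed_measurable_rV.
apply: bigcapT_measurable => k; rewrite bigcup_mkcond.
apply: countable_bigcupT_measurable => // q; case: ifPn => // _.
apply: closed_measurable_rV; apply: closed_bigI => a _.
apply: (@closed_comp _ _ (fun w : 'rV[R]_n => enorm (a - (w + ratr q *: e l)))
  [set x : R | eta * `|ratr q : R| <= x]).
  move=> w _; apply: (@enorm_lipschitz_continuous _ _ _ 1) => x y.
  apply: le_trans (ler_dist_enorm _ _) _; rewrite mul1r enormB.
  by rewrite (_ : _ - _ = x - y)//; apply/rowP => j; rewrite !mxE; ring.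
exact: closed_ge.
Qed.

(** A real step h is replaced by a rational q within eta |h|, for which |q| < 2 |h|; hence 2 eta |h|
    + eta |h|. *)
Lemma not_porousP l A eta w : A w -> ~ porous_part l A eta w -> 0 < eta < 1 ->
  exists2 d : R, 0 < d & forall h : R, `|h| < d ->
    exists2 a, A a & enorm (a - (w + h *: e l)) <= 3 * eta * `|h|.
Proof.
move=> Aw nP /andP[eta0 eta1].
have [k kP] : exists k : nat, forall q : rat, q != 0 -> `|ratr q : R| < k.+1%:R^-1 ->
    exists2 a, A a & enorm (a - (w + ratr q *: e l)) < eta * `|ratr q|.
  apply: contrapT => /forallNP H; apply: nP; split => // k _.
  apply: contrapT => nq; apply: (H k) => q q0 qk.
  apply: contrapT => na; apply: nq; exists q => //= a Aa /=.
  by rewrite leNgt; apply/negP => ae; apply: na; exists a.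
exists (k.+1%:R^-1 / 2); first by rewrite divr_gt0.
move=> h hk; have [->|h0] := eqVneq h 0.
  by exists w => //; rewrite scale0r addr0 subrr enorm0 normr0 mulr0.
have h_gt0 : 0 < `|h| by rewrite normr_gt0.
have eh : 0 < eta * `|h| by rewrite mulr_gt0.
have [q qh] : exists q : rat, `|ratr q - h| < eta * `|h|.
  have /rat_in_itvoo[q /itvP qx] : h - eta * `|h| < h + eta * `|h|.
    by rewrite ltrD2l gtrN.
  by exists q; rewrite ltr_distl !qx.
have ehh : eta * `|h| < `|h| by rewrite gtr_pMl.
have q0 : q != 0.
  by apply/negP => /eqP q0; move: qh; rewrite q0 rmorph0 sub0r normrN; lra.
have q2 : `|ratr q : R| < 2 * `|h|.
  rewrite -[ratr q](subrK h); apply: le_lt_trans (ler_normD _ _) _; lra.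
have qk : `|ratr q : R| < k.+1%:R^-1 by rewrite (lt_trans q2)// mulrC -ltr_pdivlMr.
have [a Aa ae] := kP q q0 qk.
exists a => //; apply: le_trans (ler_enormB _ (w + ratr q *: e l) _) _.
have -> : w + ratr q *: e l - (w + h *: e l) = (ratr q - h) *: e l.
  by rewrite opprD addrACA subrr add0r scalerBl.
rewrite enorm_delta.
have : eta * `|ratr q : R| <= eta * (2 * `|h|) by rewrite ler_wpM2l ?ltW.
lra.
Qed.

End rademacher.

Section rademacher_null.
Context (R : realType) (n : nat).
Local Notation leb := (@lebesgue_measure R).
Local Notation e l := (delta_mx 0 l : 'rV[R]_n.+1).

Lemma measurable_line (l : 'I_n.+1) (w : 'rV[R]_n.+1) (S : set 'rV[R]_n.+1) :
  measurable (S : set (borel_rV R n.+1)) ->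
  measurable ([set h | S (w + h *: e l)] : set (measurableTypeR R)).
Proof.
move=> mS; rewrite -[X in measurable X]setTI.
have : measurable_fun setT (fun h : measurableTypeR R => w + h *: e l : borel_rV R n.+1).
  apply: measurable_funP_rV => j.
  under eq_fun do rewrite !mxE.
  by apply: measurable_funD => //; exact: measurable_funM.
exact.
Qed.

Lemma has_partial_null (phi : 'rV[R]_n.+1 -> R) (K : R) (l : 'I_n.+1) :
  (forall x y, `|phi x - phi y| <= K * enorm (x - y)) ->
  lebesgue_rV R n.+1 (~` has_partial phi l) = 0.
Proof.
move=> phiK; have mD := measurable_has_partial phiK l.
have mC : measurable (~` has_partial phi l : set (borel_rV R n.+1)) by exact: measurableC.
apply: (lebesgue_rV_slice mC) => w.
have gK (x y : R) : `|phi (w + x *: e l) - phi (w + y *: e l)| <= K * `|x - y|.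
  apply: le_trans (phiK _ _) _.
  have -> : w + x *: e l - (w + y *: e l) = (x - y) *: e l.
    by rewrite opprD addrACA subrr add0r scalerBl.
  by rewrite enorm_delta.
have [N [mN N0 NP]] := lipschitz_derivable_ae gK.
apply: (subset_measure0 (measurable_line l w mC) mN _ N0) => h /= hD.
by apply: NP => dh; apply: hD; exact: derivable_has_partial dh.
Qed.

Lemma porous_part_null (l : 'I_n.+1) (A : set 'rV[R]_n.+1) (eta : R) :
  closed A -> 0 < eta <= 1 -> lebesgue_rV R n.+1 (porous_part l A eta) = 0.
Proof.
move=> cA eta01; have mB := measurable_porous_part l eta cA.
apply: (lebesgue_rV_slice mB) => w.
have mS := measurable_line l w (closed_measurable_rV cA).
apply: (porous_null mS (measurable_line l w mB) eta01) => [t [//]|t [At por] k].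
have [q [q0 qk] qP] := por k I.
have rq0 : (ratr q : R) != 0 by rewrite fmorph_eq0.
exists (ratr q); split => // s sq As.
have := qP _ As; rewrite /= leNgt => /negP; apply.
have -> : w + s *: e l - (w + t *: e l + ratr q *: e l) = (s - (t + ratr q)) *: e l.
  by apply/rowP => j; rewrite !mxE; ring.
by rewrite enorm_delta.
Qed.

End rademacher_null.

Lemma rademacher1 (R : realType) (phi : 'rV[R]_1 -> R) (K : R) : 0 < K ->
  (forall x y, `|phi x - phi y| <= K * enorm (x - y)) ->
  exists N : set (borel_rV R 1), [/\ measurable N, lebesgue_rV R 1 N = 0 &
    forall w, ~ N w -> differentiable phi w].
Proof.
move=> K0 phiK; exists (~` has_partial phi 0); split.
- by apply: measurableC; exact: measurable_has_partial phiK _.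
- exact: has_partial_null phiK.
move=> w /contrapT /has_partialP[p pP].
apply: (@differentiable_dotv _ _ _ _ (p *: delta_mx 0 0)) => eps eps0.
have [d d0 dP] := pP _ eps0; exists d => // v vd.
have vE : v = v 0 0 *: delta_mx 0 0.
  by apply/rowP => j; rewrite ord1 !mxE eqxx mulr1.
have vn : enorm v = `|v 0 0| by rewrite {1}vE enorm_delta.
rewrite {2}vE dotvZl dotvZr (_ : dotv _ _ = 1); last first.
  by rewrite /dotv big_ord1 !mxE eqxx mulr1.
rewrite mulr1 vn {1}vE; apply: dP; by rewrite -vn.
Qed.

(* Outside a null set both partial derivatives exist, and on e1 lines through
   nearby points of the set A where the e1 quotient is already uniformly close to
   its limit; points of A that are not porous along e0 see such a line at every
   abscissa. *)
Lemma rademacher2 (R : realType) (phi : 'rV[R]_2 -> R) (K : R) : 0 < K ->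
  (forall x y, `|phi x - phi y| <= K * enorm (x - y)) ->
  exists N : set (borel_rV R 2), [/\ measurable N, lebesgue_rV R 2 N = 0 &
    forall w, ~ N w -> differentiable phi w].
Proof.
move=> K0 phiK; pose i0 : 'I_2 := 0; pose i1 : 'I_2 := lift 0 0.
pose e0 : 'rV[R]_2 := delta_mx 0 i0; pose e1 : 'rV[R]_2 := delta_mx 0 i1.
(* The index lists slope, tolerance, scale and porosity; the porosity 1/(i+2) stays below 1, as
   [not_porousP] demands. *)
pose B (c : rat * nat * nat * nat) := porous_part i0
  (quotient_near phi i1 (ratr c.1.1.1 : R) c.1.1.2 c.1.2) c.2.+2%:R^-1.
have cA (c : rat * nat * nat * nat) := @closed_quotient_near R 2 phi K phiK i1 (ratr c.1.1.1) c.1.1.2 c.1.2.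
have mB c : measurable (B c : set (borel_rV R 2)).
  by apply: measurable_porous_part; exact: (cA c).
have B0 c : lebesgue_rV R 2 (B c) = 0.
  apply: porous_part_null; first exact: (cA c).
  by rewrite invr_gt0 ltr0n/= invf_le1// ler1n.
pose N := ~` has_partial phi i0 `|` ~` has_partial phi i1 `|` \bigcup_c B c.
have mD i : measurable (~` has_partial phi i : set (borel_rV R 2)).
  by apply: measurableC; exact: measurable_has_partial phiK _.
have D0 i : lebesgue_rV R 2 (~` has_partial phi i) = 0 by exact: has_partial_null phiK.
have mBB : measurable (\bigcup_c B c : set (borel_rV R 2)).
  exact: countable_bigcupT_measurable.
have BB0 : lebesgue_rV R 2 (\bigcup_c B c) = 0.
  apply/(negligibleP _ mBB).
  have -> : \bigcup_c B c = \bigcup_k (if unpickle k is Some c then B c else set0).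
    apply/seteqP; split => x [c _ Bc].
      by exists (pickle c); [exact: I|rewrite pickleK; exact: Bc].
    by move: Bc; case: (unpickle c) => // c' Bc'; exists c'.
  apply: negligible_bigcup => k; case: (unpickle k) => [c|].
    by exists (B c); split; [exact: mB|exact: B0|].
  exact: negligible_set0.
exists N; split.
- by apply: measurableU => //; exact: measurableU.
- have mDD : measurable (~` has_partial phi i0 `|` ~` has_partial phi i1 : set (borel_rV R 2)).
    exact: measurableU.
  apply/eqP; rewrite -measure_le0; apply: le_trans (measureU2 _ _ _) _ => //.
  rewrite [X in (_ + X)%E]BB0 adde0; apply: le_trans (measureU2 _ _ _) _ => //.
  by rewrite [X in (X + _)%E]D0 [X in (_ + X)%E]D0 adde0.
move=> w Nw.
have D_0 : has_partial phi i0 w by apply: contrapT => h; apply: Nw; left; left.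
have D_1 : has_partial phi i1 w by apply: contrapT => h; apply: Nw; left; right.
have nB c : ~ B c w by move=> h; apply: Nw; right; exists c.
have [p0 p0P] := has_partialP D_0; have [p1 p1P] := has_partialP D_1.
apply: (@differentiable_dotv _ _ _ _ (p0 *: e0 + p1 *: e1)) => eps eps0.
have [m mP] : exists m : nat, m.+1%:R^-1 < eps / 12 :> R.
  by have [m _ mP] := near_infty_natSinv_lt (PosNum (divr_gt0 eps0 (ltr0n _ 12)));
    exists m; exact: (mP m (leqnn m)).
have [q _ [j _ Aw]] := D_1 m I.
have K6 : 0 < eps / (24 * K) by rewrite divr_gt0 ?mulr_gt0.
have [i iP] : exists i : nat, i.+1%:R^-1 < eps / (24 * K) :> R.
  by have [i _ iP] := near_infty_natSinv_lt (PosNum K6); exists i; exact: (iP i (leqnn i)).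
pose eta : R := i.+2%:R^-1.
have eta0 : 0 < eta by rewrite invr_gt0.
have etaK : 6 * K * eta <= eps / 4.
  have : eta < eps / (24 * K).
    by apply: le_lt_trans iP; rewrite lef_pV2 ?posrE// ler_nat.
  rewrite ltr_pdivlMr ?mulr_gt0// => h.
  have -> : 6 * K * eta = eta * (24 * K) / 4 by field.
  by rewrite ler_pM2r// ltW.
have eta1 : 0 < eta < 1 by rewrite eta0 invf_lt1// ltr1n.
have [d1 d10 d1P] := not_porousP Aw (nB (q, m, j, i)) eta1.
have eps4 : 0 < eps / 4 by rewrite divr_gt0.
have [d2 d20 d2P] := p0P _ eps4.
have eps12 : 0 < eps / 12 by rewrite divr_gt0.
have [d3 d30 d3P] := p1P _ eps12.
have j0 : 0 < j.+1%:R^-1 :> R by rewrite invr_gt0.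
(* At one small step h both slopes describe the same difference quotient up to eps / 12. *)
have qp1 : `|ratr q - p1| <= eps / 6.
  pose h : R := Num.min (d3 / 2) j.+1%:R^-1.
  have h0 : 0 < h by rewrite lt_min divr_gt0.
  have hd : `|h| < d3.
    by rewrite gtr0_norm// (@le_lt_trans _ _ (d3 / 2)) ?ge_min ?lexx//; lra.
  have hj : `|h| <= j.+1%:R^-1 by rewrite gtr0_norm// ge_min lexx orbT.
  have := Aw h hj; have := d3P h hd; set a := phi _ - phi _.
  rewrite (gtr0_norm h0) => a1 a2.
  have a3 : h / m.+1%:R <= eps / 12 * h by rewrite mulrC ler_pM2r// ltW.
  have := le_trans a2 a3 => {}a2.
  rewrite -(ler_pM2r h0) -{1}(gtr0_norm h0) -normrM.
  rewrite (_ : (ratr q - p1) * h = (a - p1 * h) - (a - ratr q * h)); last by ring.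
  apply: le_trans (ler_normB _ _) _; lra.
exists (Num.min (Num.min d1 d2) j.+1%:R^-1); first by rewrite !lt_min d10 d20 j0.
move=> v; rewrite !lt_min => /andP[/andP[vd1 vd2] vj].
have v0 := coord_le_enorm v i0; have v1 := coord_le_enorm v i1.
have vE : v = v 0 i0 *: e0 + v 0 i1 *: e1.
  apply/rowP => k; rewrite !mxE /=; case: (unliftP i0 k) => [k'|] ->.
    by rewrite ord1 /= mulr0 mulr1 add0r.
  by rewrite /= mulr1 mulr0 addr0.
have dv : dotv (p0 *: e0 + p1 *: e1) v = p0 * v 0 i0 + p1 * v 0 i1.
  by rewrite /dotv big_ord_recl big_ord1 !mxE /= !mulr0 !mulr1 add0r addr0.
have [a Aa ae] := d1P (v 0 i0) (le_lt_trans v0 vd1).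
have f1 := d2P (v 0 i0) (le_lt_trans v0 vd2).
have f2 := Aa (v 0 i1) (le_trans v1 (ltW vj)).
have f3 := phiK (w + v 0 i0 *: e0 + v 0 i1 *: e1) (a + v 0 i1 *: e1).
have f4 := phiK a (w + v 0 i0 *: e0).
rewrite opprD addrACA subrr addr0 enormB in f3.
rewrite {1}vE addrA dv.
set P := phi (w + v 0 i0 *: e0 + v 0 i1 *: e1) in f3 *.
set Q := phi (w + v 0 i0 *: e0) in f1 f4.
set S := phi (a + v 0 i1 *: e1) in f2 f3.
(* The path from w + v to w passes through a + v1 e1, a and w + v0 e0. The Lipschitz jumps cost
   eps/8 each, the e1 move on the good line eps/12, the change of slope eps/6 and the e0 move eps/4:
   in all 3/4 of eps. *)
rewrite (_ : P - phi w - (p0 * v 0 i0 + p1 * v 0 i1) =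
  (P - S) + (S - phi a - ratr q * v 0 i1) + (ratr q - p1) * v 0 i1 +
  (phi a - Q) + (Q - phi w - p0 * v 0 i0)); last by ring.
have g1 : K * enorm (a - (w + v 0 i0 *: e0)) <= eps / 8 * enorm v.
  apply: (@le_trans _ _ (K * (3 * eta * enorm v))).
    rewrite ler_pM2l// (le_trans ae)// ler_wpM2l// mulr_ge0// ltW//.
  have -> : K * (3 * eta * enorm v) = (6 * K * eta) / 2 * enorm v by field.
  rewrite ler_wpM2r ?enorm_ge0//; lra.
have g2 : `|v 0 i1| / m.+1%:R <= eps / 12 * enorm v.
  by rewrite mulrC ler_pM// ?invr_ge0// ltW.
have g3 : `|(ratr q - p1) * v 0 i1| <= eps / 6 * enorm v.
  by rewrite normrM ler_pM.
have g4 : eps / 4 * `|v 0 i0| <= eps / 4 * enorm v by rewrite ler_pM2l.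
have g5 := le_trans f2 g2; have g6 := le_trans f1 g4.
have g7 := le_trans f3 g1; have g8 := le_trans f4 g1.
move: (enorm_ge0 v) g3 g5 g6 g7 g8; move: (enorm v) => V.
move: (P - S) (S - phi a - _) ((ratr q - p1) * _) (phi a - Q) (Q - phi w - _).
move=> a1 a2 a3 a4 a5 V0 h3 h2 h5 h1 h4.
have := ler_normD (a1 + a2 + a3 + a4) a5; have := ler_normD (a1 + a2 + a3) a4.
have := ler_normD (a1 + a2) a3; have := ler_normD a1 a2.
have : 0 <= eps * V by rewrite mulr_ge0// ltW.
lra.
Qed.

Lemma rademacher_le2 (R : realType) (n : nat) (phi : 'rV[R]_n -> R) (K : R) :
  (n < 3)%N -> 0 < K -> (forall x y, `|phi x - phi y| <= K * enorm (x - y)) ->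
  exists N : set (borel_rV R n), [/\ measurable N, lebesgue_rV R n N = 0 &
    forall w, ~ N w -> differentiable phi w].
Proof.
case: n phi => [|[|[|//]]] phi _ K0 phiK; last 2 first.
- exact: rademacher1 K0 phiK.
- exact: rademacher2 K0 phiK.
exists set0; split; [exact: measurable0|exact: measure0|].
move=> w _; apply: (@differentiable_dotv _ _ _ _ 0) => e e0; exists 1 => // v _.
have -> : w + v = w by apply/rowP => -[].
have -> : v = 0 by apply/rowP => -[].
by rewrite dot0v !subrr normr0 enorm0 mulr0.
Qed.

(** * Star-shaped sets *)

Section segments.
Context (R : realType) (n : nat).
Implicit Types (A : set 'rV[R]_n) (a b x y : 'rV[R]_n).

Lemma continuous_line a b : continuous (fun t : R => a + t *: b).
Proof.
move=> t; apply: (@continuousD _ _ _ (cst a) (fun t : R => t *: b)).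
  exact: cst_continuous.
exact: scalel_continuous.
Qed.

Lemma segment_avoiding_boundary A a b : open A -> A a ->
  (forall t : R, 0 <= t <= 1 -> ~ boundary A (a + t *: (b - a))) -> A b.
Proof.
move=> oA Aa nb.
pose g (t : R) := a + t *: (b - a).
have cg : continuous g by exact: continuous_line.
pose B := [set` `[0 : R, 1]] `&` g @^-1` A.
suff BE : B = [set` `[0 : R, 1]].
  have : B 1 by rewrite BE /= in_itv/= ler01 lexx.
  by move=> [_]; rewrite /g /= scale1r addrC subrK.
have conn : connected [set` `[0 : R, 1]] by exact: segment_connected.
apply: conn.
- by exists 0; split; rewrite /= ?in_itv/= ?lexx ?ler01// /g scale0r addr0.
- by exists (g @^-1` A) => //; apply: open_comp => // t _; exact: cg.
exists (g @^-1` closure A).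
  by apply: closed_comp; [move=> t _; exact: cg|exact: closed_closure].
apply/seteqP; split => t [t01 At]; split => //; first exact: subset_closure.
apply: contrapT => nAt; move: t01; rewrite /= in_itv/= => /nb; apply; split => //.
by move=> /interior_subset.
Qed.

End segments.

(** * The gauge of a star-shaped set and its exit points *)

Section gauge.
Context (R : realType) (n : nat) (A : set 'rV[R]_n) (x0 : 'rV[R]_n).
Hypotheses (oA : open A) (sA : star_shaped A x0).

(** The Minkowski functional of A about x0, capped at 1 so that the infimum is over a nonempty set
    and equals 1 off A. *)
Definition gauge (z : 'rV[R]_n) : R :=
  inf ([set c | 0 < c < 1 /\ A (x0 + c^-1 *: (z - x0))] `|` [set 1]).

(* Where the gauge vanishes this is x0, since 0^-1 = 0. *)
Definition exit_point (z : 'rV[R]_n) : 'rV[R]_n :=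
  x0 + (gauge z)^-1 *: (z - x0).

Let D z := [set c | 0 < c < 1 /\ A (x0 + c^-1 *: (z - x0))] `|` [set 1].

Let Dinf z : has_inf (D z).
Proof.
split; first by exists 1; right.
by exists 0 => c [[/andP[/ltW]]|->].
Qed.

Lemma gauge_ge0 z : 0 <= gauge z.
Proof.
apply: lb_le_inf; first by exists 1; right.
by move=> c [[/andP[/ltW]]|->].
Qed.

Lemma gauge_le1 z : gauge z <= 1.
Proof. by apply: (inf_lbound (Dinf z).2); right. Qed.

(** From left to right, star-shapedness pulls a point of A back towards x0; from right to left,
    openness lets the point move slightly outwards, which makes the inequality strict. *)
Lemma gauge_lt z c : 0 < c <= 1 -> gauge z < c <-> A (x0 + c^-1 *: (z - x0)).
Proof.
move=> /andP[c0 c1]; split => [zc|Az].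
  have [c' + c'c] := inf_lt (Dinf z).1 zc.
  move=> [[/andP[c'0 c'1] Ac']|c'1]; last by move: c'c; rewrite c'1 ltNge c1.
  have := sA (t := c' / c) Ac'; rewrite divr_gt0//= ler_pdivrMr// mul1r (ltW c'c).
  move=> /(_ isT); rewrite [x0 + _ - x0]addrC addKr scalerA.
  by rewrite mulrAC mulfV ?mul1r// gt_eqF.
have : nbhs c^-1 [set t : R | A (x0 + t *: (z - x0))].
  have := @continuous_line R n x0 (z - x0) c^-1; apply.
  exact: open_nbhs_nbhs.
move=> /nbhs_ballP[e /= e0 eA].
have ci : c^-1 < c^-1 + e / 2 by rewrite ltrDl divr_gt0.
have ci0 : 0 < c^-1 by rewrite invr_gt0.
pose c' := (c^-1 + e / 2)^-1.
have c'0 : 0 < c' by rewrite invr_gt0 (lt_trans ci0).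
have c'c : c' < c by rewrite -[ltRHS]invrK ltf_pV2// posrE (lt_trans ci0).
apply: le_lt_trans c'c; apply: (inf_lbound (Dinf z).2); left; split.
  by rewrite c'0 (lt_le_trans _ c1)// -[ltRHS]invrK ltf_pV2// posrE (lt_trans ci0).
apply: eA; rewrite /ball/= invrK opprD addrA subrr add0r normrN gtr0_norm ?divr_gt0//.
by rewrite ltr_pdivrMr// ltr_pMr// ltr1n.
Qed.

Lemma gauge_lt1 z : gauge z < 1 <-> A z.
Proof.
have := @gauge_lt z 1; rewrite ltr01 lexx => /(_ isT).
by rewrite invr1 scale1r addrC subrK.
Qed.

Lemma gauge_dilate z c : 0 < c <= 1 -> gauge z < c ->
  gauge z = c * gauge (x0 + c^-1 *: (z - x0)).
Proof.
move=> /andP[c0 c1] zc; set w := x0 + _.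
have wE d : d != 0 -> x0 + d^-1 *: (w - x0) = x0 + (c * d)^-1 *: (z - x0).
  by move=> d0; rewrite /w [x0 + _ - x0]addrC addKr scalerA invfM mulrC.
have w1 : gauge w < 1.
  by apply/gauge_lt1; apply/gauge_lt => //; rewrite c0.
apply/eqP; rewrite eq_le; apply/andP; split.
  rewrite leNgt; apply/negP => H.
  pose d := Num.min 1 (gauge z / c).
  have d0 : 0 < d.
    by rewrite lt_min ltr01 divr_gt0// (le_lt_trans _ H)// mulr_ge0 ?gauge_ge0// ltW.
  have d1 : d <= 1 by rewrite ge_min lexx.
  have wd : gauge w < d by rewrite lt_min w1 ltr_pdivlMr// mulrC.
  have : A (x0 + d^-1 *: (w - x0)) by apply/gauge_lt => //; rewrite d0.
  have cd : 0 < c * d <= 1.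
    by rewrite mulr_gt0//= mulr_ile1 ?c1 ?d1 ?(ltW c0) ?(ltW d0).
  rewrite wE ?gt_eqF// => /(gauge_lt z cd); rewrite ltNge => /negP; apply.
  by rewrite -ler_pdivlMl// mulrC ge_min lexx orbT.
rewrite leNgt; apply/negP => H.
pose d := gauge w.
have d0 : 0 < d by rewrite -(pmulr_rgt0 _ c0); exact: le_lt_trans (gauge_ge0 _) H.
have d1 : d <= 1 by exact: gauge_le1.
have cd : 0 < c * d <= 1.
  by rewrite mulr_gt0//= mulr_ile1 ?c1 ?d1 ?(ltW c0) ?(ltW d0).
have d01 : 0 < d <= 1 by rewrite d0.
have : gauge z < c * d by [].
move=> /(gauge_lt z cd); rewrite -wE ?gt_eqF// => /(gauge_lt w d01).
by rewrite ltxx.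
Qed.

Lemma exit_point_dilate z c : 0 < c <= 1 -> gauge z < c ->
  exit_point z = exit_point (x0 + c^-1 *: (z - x0)).
Proof.
move=> c01 zc; rewrite /exit_point (gauge_dilate c01 zc).
by rewrite [x0 + c^-1 *: _ - x0]addrC addKr scalerA invfM mulrC.
Qed.

Lemma measurable_gauge :
  measurable_fun setT (gauge : borel_rV R n -> measurableTypeR R).
Proof.
apply: (measurability _ (RGenInftyO.measurableE R)).
move=> _ [_ [c ->] <-]; rewrite setTI.
have [c0|c0] := leP c 0.
  rewrite (_ : _ @^-1` _ = set0); first exact: measurable0.
  apply/seteqP; split => z //=; rewrite in_itv/= ltNge => /negP; apply.
  exact: le_trans c0 (gauge_ge0 z).
have [c1|c1] := leP c 1; last first.
  rewrite (_ : _ @^-1` _ = setT); first exact: measurableT.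
  apply/seteqP; split => z //= _; rewrite in_itv/=.
  exact: le_lt_trans (gauge_le1 z) c1.
have c01 : 0 < c <= 1 by rewrite c0.
rewrite (_ : _ @^-1` _ = (fun z => x0 + c^-1 *: (z - x0)) @^-1` A).
  apply: open_measurable_rV; apply: open_comp => // z _.
  apply: (@enorm_lipschitz_continuous_rV _ _ _ _ c^-1) => x y.
  have -> : x0 + c^-1 *: (x - x0) - (x0 + c^-1 *: (y - x0)) = c^-1 *: (x - y).
    by apply/rowP => j; rewrite !mxE; ring.
  by rewrite enormZ normfV gtr0_norm.
by apply/seteqP; split => z /=; rewrite in_itv/= => /(gauge_lt z c01).
Qed.

Lemma measurable_exit_point :
  measurable_fun setT (exit_point : borel_rV R n -> borel_rV R n).
Proof.
apply: measurable_funP_rV => j; under eq_fun do rewrite !mxE.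
apply: measurable_funD => //; apply: measurable_funM.
  (* The identity holds also at 0, where both sides are 0 by convention. *)
  have -> : (fun z => (gauge z)^-1) = @powR R ^~ (-1) \o gauge.
    by apply/funext => z /=; rewrite powR_inv1// gauge_ge0.
  exact: (measurableT_comp (measurable_powR (-1)) measurable_gauge).
apply: measurable_funD => //; exact: measurable_rV_coord.
Qed.

End gauge.

(** * Normals to Lipschitz domains *)

Section charts.
Context (R : realType) (n : nat).
Implicit Types (K : set 'rV[R]_n.+1) (x y c nu : 'rV[R]_n.+1) (Q : 'M[R]_n.+1).

Lemma lipschitz_enorm (phi : 'rV[R]_n -> R) : lipschitz phi ->
  exists2 L : R, 0 < L & forall u v, `|phi u - phi v| <= L * enorm (u - v).
Proof.
move=> /pinfty_ex_gt0[L L0 phiL]; exists L => // u v.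
have := phiL (u, v) (conj I I) => /= h; apply: le_trans h _.
by rewrite ler_pM2l// norm_le_enorm.
Qed.

Lemma rV_subE (m : nat) (u v : 'rV[R]_m) j : (u - v) 0 j = u 0 j - v 0 j.
Proof. by rewrite !mxE. Qed.

Lemma dotv_split (u v : 'rV[R]_n.+1) :
  dotv u v = u 0 0 * v 0 0 + dotv (col' 0 u) (col' 0 v).
Proof.
by rewrite /dotv big_ord_recl; congr (_ + _); apply: eq_bigr => j _; rewrite !mxE.
Qed.

Lemma enorm_col' (u : 'rV[R]_n.+1) : enorm (col' 0 u) <= enorm u.
Proof.
rewrite -ler_sqr ?nnegrE ?enorm_ge0// !enorm_sqr [leRHS]dotv_split lerDr.
by rewrite -expr2 sqr_ge0.
Qed.

Lemma boundary_not K x : open K -> boundary K x -> ~ K x.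
Proof. by move=> oK [_ nKx] Kx; apply: nKx; move: oK; rewrite openE; exact. Qed.

(** Below the graph x would belong to the open set K. Above it, no point of K is near: the height
    over the graph changes by at most (L + 1) |y - x|. *)
Lemma chart_graph K c Q rho phi x : open K -> lipschitz_chart K c Q rho phi ->
  boundary K x -> enorm (x - c) < rho ->
  (x *m Q) 0 0 = phi (col' 0 (x *m Q)).
Proof.
move=> oK [QQ rho0 /lipschitz_enorm[L L0 phiL] KP] bx xc.
apply/eqP; rewrite eq_le; apply/andP; split; rewrite leNgt; apply/negP => H.
  pose e := (x *m Q) 0 0 - phi (col' 0 (x *m Q)).
  have e0 : 0 < e by rewrite subr_gt0.
  have [y [Ky yx]] : exists y, K y /\ enorm (y - x) < Num.min (rho - enorm (x - c)) (e / (L + 1)).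
    have [bcl _] := bx; apply: bcl; apply/nbhs_enormP.
    eexists; last by move=> y; exact: id.
    by rewrite lt_min subr_gt0 xc divr_gt0// addr_gt0.
  move: yx; rewrite lt_min => /andP[yx1 yx2].
  have /KP : enorm (y - c) < rho.
    by apply: le_lt_trans (ler_enormB _ x _) _; rewrite -ltrBrDr.
  move=> [/(_ Ky) + _]; apply/negP; rewrite -leNgt.
  have h1 : `|(y *m Q) 0 0 - (x *m Q) 0 0| <= enorm (y - x).
    rewrite (_ : _ - _ = ((y - x) *m Q) 0 0); last by rewrite mulmxBl !mxE.
    by rewrite -(enorm_orth QQ) coord_le_enorm.
  have h2 := phiL (col' 0 (y *m Q)) (col' 0 (x *m Q)).
  have h3 : enorm (col' 0 (y *m Q) - col' 0 (x *m Q)) <= enorm (y - x).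
    rewrite -(enorm_orth QQ) mulmxBl; apply: le_trans (enorm_col' _).
    by rewrite le_eqVlt; apply/orP; left; apply/eqP; congr enorm; apply/rowP => j; rewrite !mxE.
  have h4 : L * enorm (col' 0 (y *m Q) - col' 0 (x *m Q)) <= L * enorm (y - x).
    by rewrite ler_pM2l.
  have h5 : (L + 1) * enorm (y - x) < e by rewrite mulrC -ltr_pdivlMr// addr_gt0.
  move: h1 h2; rewrite !ler_norml => /andP[h1 _] /andP[_ h2].
  by move: h5; rewrite /e; lra.
by apply: (boundary_not oK bx); apply/KP.
Qed.

Lemma normal_sandwich K x nu : open K -> outward_unit_normal K x nu ->
  enorm nu = 1 /\ forall eps : R, 0 < eps -> exists2 r : R, 0 < r &
    forall y, enorm (y - x) < r ->
      (dotv (y - x) nu < - (eps * enorm (y - x)) -> K y) /\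
      (eps * enorm (y - x) < dotv (y - x) nu -> ~ K y).
Proof.
move=> oK [bx [Q [rho [phi [chart [dphi nuE]]]]]].
have [QQ rho0 phil KP] := chart.
pose z := col' 0 (x *m Q).
pose w : 'rV[R]_n.+1 := row_mx (1%:M : 'rV[R]_1) (- grad phi z).
rewrite -/z -/w in dphi nuE.
have w0 : w 0 0 = 1.
  by rewrite /w mxE; case: splitP => // j _; rewrite ord1 mxE.
have w' : col' 0 w = - grad phi z.
  apply/rowP => j; rewrite mxE -(rshift1 j).
  by rewrite (row_mxEr (1%:M : 'rV[R]_1)).
have ew : 0 < enorm w.
  apply: (@lt_le_trans _ _ `|w 0 0|); first by rewrite w0 normr1.
  exact: coord_le_enorm.
have QT : Q^T *m Q^T^T = 1%:M by rewrite trmxK orth_trK.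
split.
  by rewrite nuE enormZ (enorm_orth QT) normfV gtr0_norm// mulVf// gt_eqF.
move=> eps eps0.
(* The tolerance carries the factor |w| because normalising w divides heights by |w|. *)
have [d d0 dP] := differentiable_estimate dphi (mulr_gt0 eps0 ew).
exists (Num.min d rho); first by rewrite lt_min d0.
move=> y; rewrite lt_min => /andP[yd yrho].
pose v := (y - x) *m Q.
have ev : enorm v = enorm (y - x) by exact: enorm_orth.
have dv : dotv (y - x) nu = (enorm w)^-1 * (v 0 0 - dotv (grad phi z) (col' 0 v)).
  rewrite nuE dotvZr; congr (_ * _).
  rewrite -(dotv_orth QQ) -mulmxA orth_trK// mulmx1 dotv_split w0 mulr1 w' dotvNr.
  by rewrite dotvC.
have cv : enorm (col' 0 v) < d by rewrite (le_lt_trans (enorm_col' _))// ev.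
have := dP _ cv.
have -> : z + col' 0 v = col' 0 (y *m Q).
  apply/rowP => j; rewrite mxE [z 0 j]mxE [col' 0 v 0 j]mxE [RHS]mxE /v mulmxBl.
  by rewrite rV_subE addrC subrK.
have yE : (y *m Q) 0 0 = phi z + v 0 0.
  have <- := chart_graph oK chart bx _; last by rewrite subrr enorm0.
  by rewrite /v mulmxBl rV_subE addrC subrK.
have evw : eps * enorm w * enorm (col' 0 v) <= eps * enorm w * enorm (y - x).
  by rewrite -ev ler_pM2l ?mulr_gt0// enorm_col'.
rewrite ler_norml => /andP[h1 h2].
split => [lt|gt].
  apply/KP => //; rewrite yE; move: lt.
  rewrite dv ltr_pdivrMl//; lra.
move=> /KP; move=> /(_ yrho); rewrite yE; apply/negP; rewrite -leNgt.
move: gt; rewrite dv ltr_pdivlMl//; lra.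
Qed.

End charts.

Section exit_density.
Context (R : realType) (n : nat).
Variables (K A : set 'rV[R]_n.+1) (x0 x nu : 'rV[R]_n.+1).
Hypotheses (oK : open K) (oA : open A) (AK : A `<=` K) (sA : star_shaped A x0).
Hypotheses (bA : boundary A x) (nux : outward_unit_normal K x nu).
Hypothesis bAK : exists2 r : R, 0 < r &
  forall y, enorm (y - x) < r -> boundary A y -> boundary K y.
Let h := dotv (x - x0) nu.
Hypothesis h0 : 0 < h.

(* The domain K contains one half-space cone at x; a point of A near x is pulled
   into it by star-shapedness, and segments inside it cannot leave A. *)
Lemma half_space_sandwich (eps : R) : 0 < eps -> eps * enorm (x - x0) < h ->
  exists2 r : R, 0 < r & forall p, enorm (p - x) < r ->
    (dotv (p - x) nu < - (eps * enorm (p - x)) -> A p) /\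
    (eps * enorm (p - x) < dotv (p - x) nu -> ~ A p).
Proof.
move=> eps0 epsh; have [nu1 /(_ _ eps0)[rs rs0 rsP]] := normal_sandwich oK nux.
have [r0 r00 r0P] := bAK.
pose r := Num.min rs r0.
have r_gt0 : 0 < r by rewrite lt_min rs0.
have rrs y : enorm (y - x) < r -> enorm (y - x) < rs by rewrite lt_min => /andP[].
have rr0 y : enorm (y - x) < r -> enorm (y - x) < r0 by rewrite lt_min => /andP[].
exists r => // p pr; split; last first.
  by move=> pnu Ap; have [_ /(_ pnu)] := rsP p (rrs _ pr); apply; exact: AK.
move=> pnu; set M := enorm (x - x0) in epsh.
have M0 : 0 <= M by exact: enorm_ge0.
(* A point y of A near x is pulled towards x0 by the fraction sg, which gains normal depth sg h
   against a threshold of about eps sg M; this is a gain because eps M < h. The second bound in sg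
   keeps the pulled point within r, and d below absorbs the error (1 + eps) |y - x|. *)
pose sg := Num.min 2^-1 (r / (2 * (M + 1))).
have sg0 : 0 < sg by rewrite lt_min invr_gt0 ltr0n/= divr_gt0 ?mulr_gt0//; lra.
have sg2 : sg <= 2^-1 by rewrite ge_min lexx.
have sgM : sg * M < r / 2.
  have : sg <= r / (2 * (M + 1)) by rewrite ge_min lexx orbT.
  rewrite ler_pdivlMr ?mulr_gt0//; [|lra].
  have -> : sg * (2 * (M + 1)) = 2 * (sg * M) + 2 * sg by ring.
  by move=> sgr; lra.
pose d := Num.min (r / 2) (sg * (h - eps * M) / (2 * (1 + eps))).
have e1 : 0 < 1 + eps by lra.
have he : 0 < sg * (h - eps * M) by rewrite mulr_gt0// subr_gt0.
have d0 : 0 < d by rewrite lt_min !divr_gt0// mulr_gt0.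
have dr : d <= r / 2 by rewrite ge_min lexx.
have de : d * (1 + eps) < sg * (h - eps * M).
  have : d <= sg * (h - eps * M) / (2 * (1 + eps)) by rewrite ge_min lexx orbT.
  rewrite ler_pdivlMr ?mulr_gt0// => dd.
  have : d * (2 * (1 + eps)) = 2 * (d * (1 + eps)) by ring.
  lra.
have [y [Ay yx]] : exists y, A y /\ enorm (y - x) < d.
  have [bcl _] := bA; apply: bcl; apply/nbhs_enormP.
  by exists d.
pose y1 := x0 + (1 - sg) *: (y - x0).
have Ay1 : A y1 by apply: sA => //; apply/andP; split; lra.
have y1x : y1 - x = (1 - sg) *: (y - x) - sg *: (x - x0).
  by apply/rowP => j; rewrite /y1 !mxE; ring.
have y1n : enorm (y1 - x) <= d + sg * M.
  rewrite y1x; apply: le_trans (ler_enormD _ _) _.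
  rewrite enormN !enormZ (gtr0_norm sg0) gtr0_norm; last by lra.
  apply: lerD => //; apply: (@le_trans _ _ (enorm (y - x))); last exact: ltW.
  by rewrite ler_piMl ?enorm_ge0//; lra.
have y1r : enorm (y1 - x) < r by lra.
have y1nu : dotv (y1 - x) nu < - (eps * enorm (y1 - x)).
  rewrite y1x dotvBl !dotvZl -/h -y1x.
  have u1 : dotv (y - x) nu <= d.
    apply: le_trans (ler_norm _) _; apply: le_trans (cauchy_schwarz_dotv _ _) _.
    by rewrite nu1 mulr1 ltW.
  have u2 : (1 - sg) * dotv (y - x) nu <= d.
    have [u3|u3] := leP 0 (dotv (y - x) nu).
      apply: le_trans u1; rewrite -[leRHS]mul1r ler_wpM2r//; lra.
    apply: (@le_trans _ _ 0); last exact: ltW.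
    by apply: mulr_ge0_le0; lra.
  have u4 : eps * enorm (y1 - x) <= eps * (d + sg * M) by rewrite ler_pM2l.
  have : eps * (d + sg * M) = d * (1 + eps) - d + sg * (eps * M) by ring.
  have : sg * (h - eps * M) = sg * h - sg * (eps * M) by ring.
  lra.
(* The cone below the tangent plane, intersected with the ball of radius r, is convex and contained
   in K. The segment from y1 to p stays there, hence off the boundary of K and so off that of A. *)
apply: (segment_avoiding_boundary oA Ay1) => t /andP[t0 t1] bt.
set q := y1 + _ in bt.
have qE : q - x = (1 - t) *: (y1 - x) + t *: (p - x).
  by apply/rowP => j; rewrite /q !mxE; ring.
have t10 : 0 <= 1 - t by lra.
have qn : enorm (q - x) <= (1 - t) * enorm (y1 - x) + t * enorm (p - x).
  rewrite qE; apply: le_trans (ler_enormD _ _) _.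
  by rewrite !enormZ !ger0_norm.
have conv (a b a' b' : R) : a < a' -> b < b' -> (1 - t) * a + t * b < (1 - t) * a' + t * b'.
  move=> aa bb; have [->|tn0] := eqVneq t 0; first by rewrite subr0 !mul1r !mul0r !addr0.
  by rewrite ler_ltD// ?ler_wpM2l// ?ltr_pM2l ?ltW// lt_neqAle eq_sym tn0.
have qr : enorm (q - x) < r.
  apply: le_lt_trans qn _; apply: lt_le_trans (conv _ _ _ _ y1r pr) _.
  by rewrite -mulrDl subrK mul1r.
have qnu : dotv (q - x) nu < - (eps * enorm (q - x)).
  rewrite {1}qE dotvDl !dotvZl; apply: lt_le_trans (conv _ _ _ _ y1nu pnu) _.
  have : eps * enorm (q - x) <= eps * ((1 - t) * enorm (y1 - x) + t * enorm (p - x)).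
    by rewrite ler_pM2l.
  lra.
have [/(_ qnu) Kq _] := rsP q (rrs _ qr).
by apply: (boundary_not oK _ Kq); apply: r0P => //; exact: rr0.
Qed.

Lemma bernoulli_ineq (a : R) (k : nat) : 0 <= a <= 1 -> 1 - k%:R * a <= (1 - a) ^+ k.
Proof.
move=> /andP[a0 a1]; elim: k => [|k IH]; first by rewrite mul0r subr0 expr0.
rewrite exprS; have a10 : 0 <= 1 - a by lra.
apply: le_trans (ler_wpM2l a10 IH).
have k0 : 0 <= k%:R * a ^+ 2 by rewrite mulr_ge0// sqr_ge0.
by rewrite -natr1; lra.
Qed.

(** The set contains a slightly narrowed and shortened cone over the tangent disc: a ray through a
    point y of the smaller disc is inside A at parameter 1 - eta and outside at 1 + eta, so it exits
    within eta M of y. The losses in radius and height tend to nothing with t. *)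
Lemma exit_point_density (th : R) : 0 < th < 1 ->
  exists2 r : R, 0 < r & forall rho, 0 < rho < r ->
    ((th * h / n.+1%:R * unit_ball_volume R n * rho ^+ n)%:E <=
     lebesgue_rV R n.+1 [set z | A z /\ (enorm (exit_point A x0 z - x) <= rho)%R])%E.
Proof.
move=> /andP[th0 th1].
have [nu1 _] := normal_sandwich oK nux.
pose M := enorm (x - x0) + 2.
have M2 : 2 <= M by rewrite lerDr enorm_ge0.
have M0 : 0 < M by lra.
have N0 : 0 < (2 * n + 1)%:R :> R by rewrite ltr0n addn1.
(* The volume loses at most the factor (1 - t M)^(2n+1), since 2 t <= t M; Bernoulli's inequality
   keeps this above th. *)
pose t := (1 - th) / ((2 * n + 1)%:R * M) / 2.
have t0 : 0 < t by rewrite !divr_gt0 ?mulr_gt0 ?subr_gt0.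
have tM : (2 * n + 1)%:R * (t * M) <= 1 - th.
  rewrite /t; set N := _%:R in N0 *.
  have -> : N * ((1 - th) / (N * M) / 2 * M) = (1 - th) / 2.
    by field; rewrite !gt_eqF.
  lra.
have tM1 : t * M <= 1 - th.
  apply: le_trans tM; rewrite ler_peMl// ?ler1n ?addn1//.
  by rewrite mulr_ge0// ltW.
have t2 : t <= t * M / 2 by rewrite -mulrA ler_peMr ?(ltW t0)// ler_pdivlMr// mul1r.
(* The test points at parameters 1 - eta and 1 + eta lie within rho (1 + t M) of x, at heights - eta
   h and eta h over the tangent plane; with this eps the cone condition needs only half that
   height. *)
pose eps := t * h / (2 * (1 + t * M)).
have tM0 : 0 < t * M by rewrite mulr_gt0.
have D0 : 0 < 2 * (1 + t * M) by lra.
have eps0 : 0 < eps by rewrite divr_gt0// mulr_gt0.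
have eD : eps * (2 * (1 + t * M)) = t * h by rewrite /eps mulfVK// gt_eqF.
have epsh : eps * enorm (x - x0) < h.
  apply: (@le_lt_trans _ _ (eps * M)); first by rewrite ler_pM2l// lerDl.
  have : eps * (2 * (1 + t * M)) = 2 * eps + 2 * t * (eps * M) by ring.
  rewrite eD => E; have : t * (eps * M) * 2 < t * h by lra.
  rewrite -mulrA ltr_pM2l// => E2.
  have : 0 < eps * M by rewrite mulr_gt0.
  lra.
have [rs rs0 rsP] := half_space_sandwich eps0 epsh.
exists (Num.min 1 (rs / (2 * (1 + t * M)))); first by rewrite lt_min ltr01 divr_gt0.
move=> rho /andP[rho0]; rewrite lt_min => /andP[rho1 rhors].
have rhoD : rho * (2 * (1 + t * M)) < rs by rewrite -ltr_pdivlMr.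
pose eta := t * rho.
have eta0 : 0 < eta by rewrite mulr_gt0.
have etat : eta < t by rewrite gtr_pMr.
have t12 : t < 2^-1 by lra.
pose r1 := (1 - t * M) * rho.
have tM1' : t * M < 1 by lra.
have r10 : 0 < r1 by rewrite mulr_gt0// subr_gt0.
have r1rho : r1 <= rho by rewrite ger_pMl//; lra.
pose T := 1 - 2 * t.
have T0 : 0 < T by rewrite /T; lra.
have mS : measurable ([set z | A z /\ (enorm (exit_point A x0 z - x) <= rho)%R] : set (borel_rV R n.+1)).
  apply: measurableI; first exact: open_measurable_rV.
  rewrite -[X in measurable X]setTI.
  have := measurable_exit_point oA sA measurableT (measurable_enorm_ball x rho).
  exact.
apply: (@le_trans _ _ (lebesgue_rV R n.+1 (cone x0 x nu r1 T))); last first.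
  apply: le_measure; rewrite ?inE//; first exact: measurable_cone.
  move=> z; rewrite /cone /= -/h; set s := _ / h => -[/andP[s0 sT] zs].
  pose y := x0 + s^-1 *: (z - x0).
  have zE : z = x0 + s *: (y - x0).
    by rewrite /y [x0 + _ - x0]addrC addKr scalerA mulfV ?gt_eqF// scale1r addrC subrK.
  have yx : enorm (y - x) <= r1.
    have -> : y - x = s^-1 *: (z - x0 - s *: (x - x0)).
      by apply/rowP => j; rewrite /y !mxE; field; rewrite gt_eqF.
    by rewrite enormZ normfV gtr0_norm// ler_pdivrMl.
  have ynu : dotv (y - x0) nu = h.
    rewrite /y [x0 + _ - x0]addrC addKr dotvZl /s; field.
    by rewrite !gt_eqF//= -(pmulr_lgt0 _ (_ : 0 < h^-1)) ?invr_gt0.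
  have yxnu : dotv (y - x) nu = 0.
    have -> : y - x = (y - x0) - (x - x0) by apply/rowP => j; rewrite !mxE; ring.
    by rewrite dotvBl ynu subrr.
  have yM : enorm (y - x0) <= M.
    apply: le_trans (ler_enormB _ x _) _; rewrite /M; lra.
  have near (k : R) : `|k| = eta ->
      enorm (x0 + (1 + k) *: (y - x0) - x) < rs /\
      eps * enorm (x0 + (1 + k) *: (y - x0) - x) < eta * h.
    move=> ke; have -> : x0 + (1 + k) *: (y - x0) - x = (y - x) + k *: (y - x0).
      by apply/rowP => j; rewrite !mxE; ring.
    have b1 : enorm ((y - x) + k *: (y - x0)) <= rho * (1 + t * M).
      apply: le_trans (ler_enormD _ _) _; rewrite enormZ ke.
      have : eta * enorm (y - x0) <= eta * M by rewrite ler_pM2l.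
      rewrite /eta; lra.
    have b2 : 0 < rho * (1 + t * M) by rewrite mulr_gt0//; lra.
    split; first by lra.
    apply: (@le_lt_trans _ _ (eps * (rho * (1 + t * M)))); first by rewrite ler_pM2l.
    have -> : eta * h = eps * (rho * (1 + t * M)) * 2.
      by rewrite /eta mulrAC -eD; ring.
    by rewrite ltr_pMr ?ltr1n// mulr_gt0.
  have dotk (k : R) : dotv (x0 + (1 + k) *: (y - x0) - x) nu = k * h.
    have -> : x0 + (1 + k) *: (y - x0) - x = (y - x) + k *: (y - x0).
      by apply/rowP => j; rewrite !mxE; ring.
    by rewrite dotvDl dotvZl yxnu ynu add0r.
  have Alow : A (x0 + (1 - eta) *: (y - x0)).
    have [n1 n2] := near (- eta) ltac:(by rewrite normrN gtr0_norm).
    have [H _] := rsP _ n1; apply: H.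
    by rewrite dotk mulNr ltrN2.
  have Ahigh : ~ A (x0 + (1 + eta) *: (y - x0)).
    have [n1 n2] := near eta (gtr0_norm eta0).
    have [_] := rsP _ n1; apply.
    by rewrite dotk.
  have e10 : 0 < 1 - eta by lra.
  have c1 : 0 < s / (1 - eta) <= 1.
    by rewrite divr_gt0//= ler_pdivrMr// mul1r; move: sT; rewrite /T; lra.
  have zc (c : R) : c != 0 -> x0 + c^-1 *: (z - x0) = x0 + (s / c) *: (y - x0).
    by move=> c0; rewrite zE [x0 + _ - x0]addrC addKr scalerA mulrC.
  have c2 : s / (1 - eta) != 0 by rewrite gt_eqF// divr_gt0.
  have gz : gauge A x0 z < s / (1 - eta).
    apply/gauge_lt => //; rewrite zc//.
    by rewrite (_ : s / _ = 1 - eta)//; field; rewrite !gt_eqF.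
  have gz1 : gauge A x0 z < 1 by apply: (lt_le_trans gz); case/andP: c1.
  have gzl : s / (1 + eta) <= gauge A x0 z.
    rewrite leNgt; apply/negP => lt; apply: Ahigh.
    have c3 : 0 < s / (1 + eta) <= 1.
      rewrite divr_gt0 ?addr_gt0//= ler_pdivrMr ?addr_gt0// mul1r.
      by move: sT; rewrite /T; lra.
    have c4 : s / (1 + eta) != 0 by rewrite gt_eqF//; case/andP: c3.
    move/(gauge_lt oA sA z c3) : lt; rewrite zc//.
    by rewrite (_ : s / _ = 1 + eta)//; field; rewrite !gt_eqF ?addr_gt0.
  have g0 : 0 < gauge A x0 z by apply: lt_le_trans gzl; rewrite divr_gt0// addr_gt0.
  split; first by apply/(gauge_lt1 oA sA).
  rewrite /exit_point zc ?gt_eqF//; set u := s / _.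
  have u1 : 1 - eta <= u.
    by rewrite /u ler_pdivlMr// -ler_pdivlMl// mulrC ltW.
  have u2 : u <= 1 + eta.
    by rewrite /u ler_pdivrMr// mulrC -ler_pdivrMr// addr_gt0.
  have -> : x0 + u *: (y - x0) - x = (y - x) + (u - 1) *: (y - x0).
    by apply/rowP => j; rewrite !mxE; ring.
  apply: le_trans (ler_enormD _ _) _; rewrite enormZ.
  have : `|u - 1| * enorm (y - x0) <= eta * M.
    by rewrite ler_pM ?enorm_ge0// ler_norml; apply/andP; split; lra.
  move: yx; rewrite /r1 /eta; lra.
rewrite (lebesgue_rV_cone nu1 h0 r10 T0) lee_fin -/h.
have w0 := unit_ball_volume_gt0 R n.
have hn0 : 0 < h / n.+1%:R by rewrite divr_gt0.
have -> : h * T ^+ n.+1 / n.+1%:R * r1 ^+ n * unit_ball_volume R n =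
  (T ^+ n.+1 * (1 - t * M) ^+ n) * (h / n.+1%:R * unit_ball_volume R n * rho ^+ n).
  by rewrite /r1 exprMn; ring.
have -> : th * h / n.+1%:R * unit_ball_volume R n * rho ^+ n =
  th * (h / n.+1%:R * unit_ball_volume R n * rho ^+ n) by ring.
rewrite ler_pM2r ?mulr_gt0 ?exprn_gt0//.
apply: (@le_trans _ _ ((1 - t * M) ^+ n.+1 * (1 - t * M) ^+ n)).
  rewrite -exprD; have tM01 : 0 <= t * M <= 1 by apply/andP; split; lra.
  apply: le_trans (bernoulli_ineq (n.+1 + n) tM01).
  have nn : (n.+1 + n)%N = (2 * n + 1)%N by rewrite addSn addnn -mul2n -addn1.
  by rewrite nn lerBrDr -lerBrDl.
rewrite ler_wpM2r ?exprn_ge0//; first by lra.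
rewrite lerXn2r ?nnegrE; [|lra|lra|]; first by [].
by rewrite /T; lra.
Qed.

End exit_density.

(** * Null sets in charts *)

Lemma measure_pairwise_le d (T : measurableType d) (R : realType)
    (mu : {measure set T -> \bar R}) (I : eqType) (g : I -> set T) (l : seq I)
    (U : set T) :
  measurable U -> (forall i, i \in l -> measurable (g i) /\ g i `<=` U) ->
  pairwise (fun i j => `[< g i `&` g j = set0 >]) l ->
  (\sum_(i <- l) mu (g i) <= mu U)%E.
Proof.
elim: l U => [|i l IH] U mU gU; first by rewrite big_nil.
rewrite big_cons pairwise_cons => /andP[/allP il pl].
have [mi iU] := gU i (mem_head _ _).
have mD : measurable (U `\` g i) by exact: measurableD.
have -> : mu U = (mu (g i) + mu (U `\` g i))%E.
  by rewrite -measureU ?setDIK// setDUK.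
apply: leeD2l; apply: IH => // j jl.
have [mj jU] := gU j (mem_behead (s := i :: l) jl); split => // z gz; split; first exact: jU.
move=> gi; have /asboolP ij := il j jl.
by have : (g i `&` g j) z by []; rewrite ij.
Qed.

(** * Packing bounds and null projections *)

Section packing_bound.
Context (R : realType) (m s : nat).
Implicit Types (A B : set 'rV[R]_m) (T : R).

(** Meaningful for every set, monotone and finitely subadditive, so regular and irregular points of
    F can be bounded separately before passing to Hausdorff measure. *)
Definition packing_bound A T := exists r0 : 'rV[R]_m -> R,
  (forall x, A x -> 0 < r0 x) /\
  forall l : seq ('rV[R]_m * R),
    (forall p, p \in l -> A p.1 /\ 0 < p.2 <= r0 p.1) ->
    pairwise (@far R m) l -> \sum_(p <- l) p.2 ^+ s <= T.

Lemma sub_packing_bound A B T : A `<=` B -> packing_bound B T -> packing_bound A T.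
Proof.
move=> AB [r0 [r00 H]]; exists r0; split=> [x /AB /r00//|l lA].
by apply: H => p /lA[/AB].
Qed.

Lemma packing_boundU A B S T : packing_bound A S -> packing_bound B T ->
  packing_bound (A `|` B) (S + T).
Proof.
move=> [ra [ra0 Ha]] [rb [rb0 Hb]].
exists (fun x => if `[< A x >] then ra x else rb x); split.
  by move=> x ABx; case: asboolP => [|nA]; [exact: ra0|case: ABx => // /rb0].
move=> l lAB lfar.
rewrite (bigID (fun p => `[< A p.1 >]))/= -big_filter -[X in _ + X]big_filter.
apply: lerD.
  apply: Ha; last exact: subseq_pairwise (filter_subseq _ _) lfar.
  move=> p; rewrite mem_filter => /andP[Ap /lAB[_]]; rewrite Ap => ->.
  by split => //; apply/asboolP.
apply: Hb; last exact: subseq_pairwise (filter_subseq _ _) lfar.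
move=> p; rewrite mem_filter => /andP[nAp /lAB[Ap]]; rewrite (negbTE nAp) => ->.
by split => //; case: Ap => // /asboolP; rewrite (negbTE nAp).
Qed.

Lemma packing_bound_bigcup (I : eqType) (r : seq I) (A : I -> set 'rV[R]_m) :
  (forall i e, 0 < e -> i \in r -> packing_bound (A i) e) ->
  forall e, 0 < e -> packing_bound (\bigcup_(i in [set` r]) A i) e.
Proof.
elim: r => [|i r IH] H e e0.
  exists (fun=> 1); split=> [x [j /=]//|[_ _|p l lH]].
    by rewrite big_nil ltW.
  by have [[j]] := lH p (mem_head _ _).
have e2 : 0 < e / 2 by rewrite divr_gt0.
have := packing_boundU (H i _ e2 (mem_head _ _))
  (IH (fun j e e0 jr => H j e e0 (mem_behead (s := i :: r) jr)) _ e2).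
rewrite -splitr; apply: sub_packing_bound => x [j /=]; rewrite inE => /orP[/eqP->|jr] xj.
  by left.
by right; exists j.
Qed.

End packing_bound.

Section null_sets_in_charts.
Context (R : realType).
Local Notation leb := (@lebesgue_measure R).

(** The floor of a / d is injective on A: equal floors force a distance of at most d. *)
Lemma countable_separated (A : set R) (d : R) : 0 < d ->
  (forall a b, A a -> A b -> `|a - b| <= d -> a = b) -> countable A.
Proof.
move=> d0 sep.
suff [f finj] : exists f : R -> nat, {in A &, injective f} by apply/countable_injP; exists f.
exists (fun a => pickle (Num.floor (a / d))) => a b; rewrite !inE => Aa Ab /(pcan_inj pickleK) ab.
apply: sep => //; have /andP[a1 a2] := floor_itv (a / d).
have /andP[b1 b2] := floor_itv (b / d).
rewrite ab in a1 a2.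
have : `|a / d - b / d| <= 1.
  rewrite ler_norml; move: a2 b2; rewrite !intrD => a2 b2.
  by apply/andP; split; lra.
by rewrite -mulrBl normrM normfV (gtr0_norm d0) ler_pdivrMr// mul1r.
Qed.

(* Along direction l the points of this set are d-separated. *)
Definition steep_zero (n : nat) (psi : 'rV[R]_n -> R) (l : 'I_n) (d : R) :
    set (borel_rV R n) :=
  [set w : 'rV[R]_n | psi w = 0 /\
    forall h : R, `|h| <= d -> `|h| * d <= `|psi (w + h *: delta_mx 0 l)|].

Lemma measurable_steep_zero n (psi : 'rV[R]_n -> R) l d : continuous psi ->
  measurable (steep_zero psi l d).
Proof.
move=> cpsi; apply: closed_measurable_rV.
have -> : steep_zero psi l d = [set w | psi w = 0] `&`
    \bigcap_(h in [set h | `|h| <= d])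
      [set w | `|h| * d <= `|psi (w + h *: delta_mx 0 l)|].
  by apply/seteqP; split => w [].
apply: closedI.
  by apply: (@closed_comp _ _ psi [set 0]) => [x _|]; [exact: cpsi|exact: closed_eq].
apply: closed_bigI => h _.
apply: (@closed_comp _ _ (fun w : 'rV[R]_n => `|psi (w + h *: delta_mx 0 l)|) [set y | `|h| * d <= y]).
  move=> x _; apply: (@continuous_comp _ _ _ (fun w : 'rV[R]_n => psi (w + h *: delta_mx 0 l)) Num.norm).
    apply: (@continuous_comp _ _ _ (fun w : 'rV[R]_n => w + h *: delta_mx 0 l) psi); last exact: cpsi.
    apply: (@enorm_lipschitz_continuous_rV _ _ _ _ 1) => a b.
    by rewrite mul1r opprD addrACA subrr addr0.
  exact: norm_continuous.
exact: closed_ge.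
Qed.

Lemma steep_zero_null n (psi : 'rV[R]_n -> R) l d : continuous psi -> 0 < d ->
  lebesgue_rV R n (steep_zero psi l d) = 0%E.
Proof.
case: n psi l => [|n] psi l cpsi d0; first by case: l.
apply: (@lebesgue_rV_slice _ _ l); first exact: measurable_steep_zero.
move=> w; apply: countable_lebesgue_measure0; apply: (countable_separated d0).
move=> a b [_ Ha] [pb _] ab.
have := Ha (b - a); rewrite distrC => /(_ ab).
rewrite -addrA -scalerDl subrKC pb normr0.
rewrite pmulr_lle0// normr_le0 subr_eq0 => /eqP->//.
Qed.

End null_sets_in_charts.

Section bad_points.
Context (R : realType) (n : nat) (K : set 'rV[R]_n.+1) (c : 'rV[R]_n.+1).
Context (Q : 'M[R]_n.+1) (rho : R) (phi : 'rV[R]_n -> R).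
Hypotheses (oK : open K) (chart : lipschitz_chart K c Q rho phi).

Let proj (x : 'rV[R]_n.+1) : 'rV[R]_n := col' 0 (x *m Q).

(* Projecting through the chart turns far balls into disjoint balls of
   comparable radius contained in a thin neighbourhood of Z. *)
Lemma chart_packing_bound (Z : set (borel_rV R n)) (e : R) :
  measurable Z -> lebesgue_rV R n Z = 0%E -> 0 < e ->
  packing_bound n [set x | [/\ boundary K x, enorm (x - c) < rho & Z (proj x)]] e.
Proof.
move=> mZ Z0 e0; have [QQ rho0 /lipschitz_enorm[L L0 phiL] _] := chart.
(* The projections lie in a ball of radius M; restricting Lebesgue measure to it gives the finite
   measure that outer regularity asks for. *)
pose M := enorm (c *m Q) + rho.
pose D : set (borel_rV R n) := [set w | enorm (w - 0) < M].
have mD : measurable D by apply: open_measurable_rV; exact: open_enorm_ball.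
pose mu := mrestr (lebesgue_rV R n) mD.
have muoo : (mu setT < +oo)%E.
  rewrite /mu /mrestr setTI; apply: (@lebesgue_rV_enorm_bounded _ _ _ M) => // w.
  by rewrite /D /= subr0 => /ltW.
have w0 := unit_ball_volume_gt0 R n.
have L1 : 0 < 1 + L by rewrite addr_gt0.
pose e' := e * (unit_ball_volume R n / (1 + L) ^+ n).
have e'0 : 0 < e' by rewrite mulr_gt0// divr_gt0// exprn_gt0.
have [V [oV ZV muV]] := outer_regular muoo mZ e'0.
have oVD : open (V `&` D) by apply: openI => //; exact: open_enorm_ball.
have muVD : (lebesgue_rV R n (V `&` D) <= e'%:E)%E.
  apply: le_trans muV _.
  rewrite [X in (X + _)%E](_ : _ = 0%E) ?add0e//.
  apply: (subset_measure0 _ mZ (@subIsetl _ Z D) Z0); exact: measurableI.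
pose A := [set x | [/\ boundary K x, enorm (x - c) < rho & Z (proj x)]].
have ball_in x : exists r : R, A x -> 0 < r /\
    forall w, enorm (w - proj x) < r -> (V `&` D) w.
  have [Ax|nA] := pselect (A x); last by exists 0.
  have [bx xc Zx] := Ax.
  have VDx : (V `&` D) (proj x).
    split; first exact: ZV.
    rewrite /D /= subr0; apply: le_lt_trans (enorm_col' _) _.
    rewrite -[x](subrK c) mulmxDl; apply: le_lt_trans (ler_enormD _ _) _.
    by rewrite (enorm_orth QQ) addrC ltrD2l.
  have /nbhs_enormP[r r0 rP] : nbhs (proj x) (V `&` D) by exact: open_nbhs_nbhs.
  by exists r.
have [r rP] := choice ball_in.
exists (fun x => r x / 2); split => [x /rP[rx _]|l lA lfar]; first by rewrite divr_gt0.
pose g (p : 'rV[R]_n.+1 * R) : set (borel_rV R n) :=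
  [set w | enorm (w - proj p.1) <= p.2 / (1 + L)].
have gvol p : p \in l -> lebesgue_rV R n (g p) =
    (p.2 ^+ n * (unit_ball_volume R n / (1 + L) ^+ n))%:E.
  move=> /lA[_ /andP[p0 _]]; rewrite /g lebesgue_rV_ball ?divr_gt0//.
  by rewrite exprMn exprVn mulrAC mulrA.
(* On a graph of Lipschitz constant L, distances are at most 1 + L times those of the projections;
   hence the radius [p.2 / (1 + L)] in g. *)
have disj p q : p \in l -> q \in l -> far p q -> g p `&` g q = set0.
  move=> /lA[[bp pc _] _] /lA[[bq qc _] _] pq; apply/seteqP; split => // w [gp gq].
  have wpq : enorm (proj p.1 - proj q.1) <= (p.2 + q.2) / (1 + L).
    apply: le_trans (ler_enormB _ w _) _; rewrite mulrDl enormB.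
    exact: lerD.
  move: pq; rewrite /far ltNge => /negP; apply.
  move: wpq; rewrite ler_pdivlMr//; apply: le_trans.
  rewrite -(enorm_orth QQ) mulmxBl; set u := _ - _.
  have u0 : `|u 0 0| <= L * enorm (proj p.1 - proj q.1).
    by rewrite /u rV_subE (chart_graph oK chart bp pc) (chart_graph oK chart bq qc).
  have u' : col' 0 u = proj p.1 - proj q.1.
    by apply/rowP => j; rewrite rV_subE [LHS]mxE rV_subE [proj p.1 0 j]mxE [proj q.1 0 j]mxE.
  rewrite -ler_sqr ?nnegrE ?enorm_ge0 ?mulr_ge0 ?enorm_ge0 ?(ltW L1)//.
  rewrite enorm_sqr dotv_split u' -enorm_sqr.
  set E := enorm _ in u0 *.
  have E0 : 0 <= E by exact: enorm_ge0.
  have : `|u 0 0| ^+ 2 <= (L * E) ^+ 2 by rewrite lerXn2r// nnegrE// mulr_ge0// ltW.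
  rewrite real_normK ?num_real// expr2 => uu.
  have : 0 <= L * (E ^+ 2) by rewrite mulr_ge0 ?sqr_ge0// ltW.
  have -> : (E * (1 + L)) ^+ 2 = E ^+ 2 + 2 * (L * E ^+ 2) + (L * E) ^+ 2 by ring.
  lra.
have := @measure_pairwise_le _ _ _ (lebesgue_rV R n) _ g l (V `&` D).
move=> /(_ (open_measurable_rV oVD)).
have lg p : p \in l -> measurable (g p) /\ g p `<=` V `&` D.
  move=> pl; split; first exact: measurable_enorm_ball.
  have [/rP[rp rV] /andP[p0 pr]] := lA p pl.
  move=> w; rewrite /g /= => wp; apply: rV; apply: le_lt_trans wp _.
  rewrite ltr_pdivrMr//.
  apply: (@le_lt_trans _ _ (r p.1 / 2)) => //.
  have : 0 < r p.1 * L by rewrite mulr_gt0.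
  lra.
move=> /(_ lg).
have ldisj : pairwise (fun p q => `[< g p `&` g q = set0 >]) l.
  apply: (sub_in_pairwise (P := mem l)) lfar; last by apply/allP.
  by move=> p q pl ql /= pq; apply/asboolP; exact: disj.
move=> /(_ ldisj) /le_trans/(_ muVD).
rewrite big_seq (eq_bigr _ gvol) -big_seq sumEFin lee_fin -mulr_suml.
by rewrite ler_pM2r// divr_gt0// exprn_gt0.
Qed.

Lemma chart_outward_normal x : boundary K x -> enorm (x - c) < rho ->
  differentiable phi (proj x) ->
  let w : 'rV[R]_n.+1 := row_mx (1%:M : 'rV[R]_1) (- grad phi (proj x)) in
  outward_unit_normal K x ((enorm w)^-1 *: (w *m Q^T)).
Proof.
move=> bx xc dphi; split => //; have [QQ rho0 phil KP] := chart.
exists Q, (rho - enorm (x - c)), phi; split => //; split => //; first by rewrite subr_gt0.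
move=> y yx; apply: KP; apply: le_lt_trans (ler_enormB _ x _) _.
by rewrite -ltrBrDr.
Qed.

(* If the tangent plane at x contained the hyperplane through x and x0, then x - x0
   would be tangent. So the equation of the hyperplane, pulled back to the chart,
   has a nonzero partial derivative there. *)
Lemma hyperplane_null_part (a x0 : 'rV[R]_n.+1) : (n < 3)%N -> a != 0 ->
  exists Z : set (borel_rV R n), [/\ measurable Z, lebesgue_rV R n Z = 0%E &
    forall x, boundary K x -> enorm (x - c) < rho -> ~ Z (proj x) ->
      exists nu, outward_unit_normal K x nu /\
        (dotv a x = dotv a x0 -> ~ 0 < dotv (x - x0) nu)].
Proof.
move=> n3 a0; have [QQ rho0 /lipschitz_enorm[L L0 phiL] _] := chart.
have [N [mN N0 Nd]] := rademacher_le2 n3 L0 phiL.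
pose b := a *m Q.
have dotb y : dotv a y = dotv b (y *m Q) by rewrite dotv_orth.
pose psi (w : 'rV[R]_n) := b 0 0 * phi w + dotv (col' 0 b) w - dotv a x0.
have cphi : continuous phi by exact: enorm_lipschitz_continuous phiL.
have cpsi : continuous psi.
  move=> w; apply: (@continuousB _ _ _ (fun w => b 0 0 * phi w + dotv (col' 0 b) w)
    (fun=> dotv a x0)); last exact: cst_continuous.
  apply: (@continuousD _ _ _ (fun w => b 0 0 * phi w) (dotv (col' 0 b))).
    by apply: continuousM; [exact: cst_continuous|exact: cphi].
  exact: continuous_dotv.
(* Countably many directions and scales catch every zero of psi where phi is differentiable and some
   partial derivative of psi does not vanish. *)
pose S : set (borel_rV R n) := \bigcup_k
  if unpickle k is Some p then steep_zero psi (p : 'I_n * nat).1 p.2.+1%:R^-1 else set0.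
have mS : measurable S.
  apply: bigcupT_measurable => k; case: (unpickle k) => [p|]; last exact: measurable0.
  exact: measurable_steep_zero.
have S0 : lebesgue_rV R n S = 0%E.
  apply/(negligibleP _ mS); apply: negligible_bigcup => k.
  case: (unpickle k) => [p|]; last exact: negligible_set0.
  apply/negligibleP; first exact: measurable_steep_zero.
  by apply: steep_zero_null => //; rewrite invr_gt0.
exists (N `|` S); split; first exact: measurableU.
  by apply: null_set_setU.
move=> x bx xc /not_orP[nN nS].
have dphi := Nd _ nN.
have nux := chart_outward_normal bx xc dphi.
cbv zeta in nux; set w := row_mx _ _ in nux; set nu := _ *: _ in nux.
exists nu; split => // ax; rewrite lt_def => /andP[/eqP nu0 _]; apply: nu0.
pose g := grad phi (proj x).
pose u := (x - x0) *m Q.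
have psi0 : psi (proj x) = 0.
  by rewrite /psi -(chart_graph oK chart bx xc) -dotv_split -dotb ax subrr.
have slope l : b 0 0 * g 0 l + (col' 0 b) 0 l = 0.
  apply/eqP/negPn/negP => D0; apply: nS.
  set D := _ + _ in D0; have D1 : 0 < `|D| by rewrite normr_gt0.
  have b1 : 0 < 2 * (`|b 0 0| + 1) by rewrite mulr_gt0// ltr_wpDl.
  have [d d0 dP] := differentiable_estimate dphi (divr_gt0 D1 b1).
  have m0 : 0 < Num.min d (`|D| / 2) by rewrite lt_min d0 divr_gt0.
  have [k _ /(_ k (leqnn k)) /=] := near_infty_natSinv_lt (PosNum m0).
  rewrite lt_min => /andP[kd kD].
  exists (pickle (l, k)); first exact: I.
  rewrite pickleK /=; split; first exact: psi0.
  move=> h hk; have ed : enorm (h *: (delta_mx 0 l : 'rV[R]_n)) = `|h|.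
    by rewrite enorm_delta.
  have := dP (h *: delta_mx 0 l); rewrite ed => /(_ (le_lt_trans hk kd)).
  rewrite dotvZr -/g; have dl (v : 'rV[R]_n) : dotv v (delta_mx 0 l) = v 0 l.
    rewrite /dotv (bigD1 l)//= big1 ?addr0 ?mxE ?eqxx ?mulr1// => j /negbTE jl.
    by rewrite !mxE jl mulr0.
  rewrite dl; set dphi' := phi _ - _ - _ => est.
  have psiE : psi (proj x + h *: delta_mx 0 l) = b 0 0 * dphi' + h * D.
    rewrite -[LHS]subr0 -psi0 /psi dotvDr dotvZr dl /dphi' /D; ring.
  rewrite psiE.
  have e1 : `|b 0 0 * dphi'| <= `|h| * (`|D| / 2).
    rewrite normrM; apply: (@le_trans _ _ ((`|b 0 0| + 1) * (`|D| / (2 * (`|b 0 0| + 1)) * `|h|))).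
      by rewrite ler_pM// lerDl.
    rewrite le_eqVlt; apply/orP; left; apply/eqP.
    by field; rewrite gt_eqF// ltr_wpDl.
  have e2 : `|h * D| = `|h| * `|D| by rewrite normrM.
  have e3 := lerB_dist (h * D) (- (b 0 0 * dphi')).
  rewrite normrN opprK e2 [h * D + _]addrC in e3.
  apply: le_trans e3; have : `|h| * k.+1%:R^-1 <= `|h| * (`|D| / 2).
    by rewrite ler_wpM2l// ltW.
  have -> : `|h| * `|D| = `|h| * (`|D| / 2) + `|h| * (`|D| / 2) by rewrite -mulrDr -splitr.
  by move: (`|h| / _) (`|h| * _) (`|b 0 0 * _|) e1 => s1 s2 s3 *; lra.
have b'E : col' 0 b = - (b 0 0 *: g).
  apply/rowP => l; rewrite [RHS]mxE [(b 0 0 *: g) 0 l]mxE.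
  by move/eqP: (slope l); rewrite addrC addr_eq0 => /eqP.
(* Now b is b 0 0 times (1, - g), so a is parallel to the normal as soon as b 0 0 is nonzero;
   otherwise b, hence a, would vanish. *)
have b00 : b 0 0 != 0.
  apply/negP => /eqP b00; move/eqP: a0; apply.
  have b0 : b = 0.
    apply/rowP => j; case: (unliftP 0 j) => [l ->|->]; last by rewrite b00 mxE.
    have := congr1 (fun v : 'rV[R]_n => v 0 l) b'E.
    by rewrite /= b00 scale0r oppr0 !mxE.
  by rewrite -[a]mulmx1 -QQ mulmxA -/b b0 mul0mx.
have : dotv b u = 0 by rewrite /u -dotb dotvBr ax subrr.
rewrite dotv_split b'E dotvNl dotvZl -mulrBr => /eqP; rewrite mulf_eq0 (negbTE b00)/= => /eqP ug.
have w00 : w 0 0 = 1.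
  by rewrite /w mxE; case: splitP => // j _; rewrite ord1 mxE.
have w' : col' 0 w = - g.
  apply/rowP => j; rewrite mxE -(rshift1 j).
  by rewrite (row_mxEr (1%:M : 'rV[R]_1)).
rewrite /nu dotvZr -(dotv_orth QQ) -mulmxA orth_trK// mulmx1 -/u dotv_split w00 mulr1 w' dotvNr.
by rewrite dotvC ug mulr0.
Qed.

End bad_points.

(** * Surface measure against volumes of sectors *)

Lemma countable_bigcup_null d (T : measurableType d) (R : realType)
    (mu : {measure set T -> \bar R}) (J : countType) (A : J -> set T) :
  (forall i, measurable (A i)) -> (forall i, mu (A i) = 0%E) ->
  mu (\bigcup_i A i) = 0%E.
Proof.
move=> mA A0.
have mU : measurable (\bigcup_i A i) by exact: countable_bigcupT_measurable.
apply/(negligibleP _ mU).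
have -> : \bigcup_i A i = \bigcup_k (if unpickle k is Some i then A i else set0).
  apply/seteqP; split => x [i _ Ai].
    by exists (pickle i); [exact: I|rewrite pickleK; exact: Ai].
  by move: Ai; case: (unpickle i) => // j Aj; exists j.
apply: negligible_bigcup => k; case: (unpickle k) => [i|]; last exact: negligible_set0.
by apply/negligibleP; [exact: mA|exact: A0].
Qed.

Lemma bounded_set_enorm (R : realType) (m : nat) (A : set 'rV[R]_m) :
  bounded_set A -> exists M : R, forall x, A x -> enorm x <= M.
Proof.
move=> [M [Mreal AM]]; exists (m%:R * (M + 1)) => x Ax.
apply: le_trans (enorm_le_norm x) _; rewrite ler_wpM2l//.
by apply: AM => //; rewrite ltrDl.
Qed.

Section surface_bound.
Context (R : realType) (n : nat) (K F KF : set 'rV[R]_n.+1) (x0 : 'rV[R]_n.+1).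
Hypotheses (n3 : (n < 3)%N) (hK : lipschitz_domain K) (FK : F `<=` boundary K).
Hypotheses (hKF : sub_element K F KF x0).
Hypotheses (mn0 : forall s, m_dot_n K F x0 s -> 0 < s) (mu0 : 0 < min_m_dot_n K F x0).
Local Notation mu := (min_m_dot_n K F x0).

Let oK : open K. Proof. by have [] := hK. Qed.
Let oKF : open KF. Proof. by have [] := hKF. Qed.
Let KFK : KF `<=` K. Proof. by have [] := hKF. Qed.
Let sKF : star_shaped KF x0. Proof. by have [] := hKF. Qed.

Let face_planes : exists (P : 'I_n.+1 -> set 'rV[R]_n.+1) (a : 'I_n.+1 -> 'rV[R]_n.+1),
  [/\ forall j, closed (P j), forall j, a j != 0,
      forall j x, P j x -> dotv (a j) x = dotv (a j) x0 &
      boundary KF `<=` F `|` \bigcup_j P j].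
Proof.
have [_ _ _ [_ [P [_ Pp Px0 bKF]]]] := hKF.
have [a aP] := choice Pp; exists P, a; split => [j|j|j x Px|]; last by rewrite bKF.
- by have [c [_ _ ->]] := aP j; exact: closed_closure.
- by have [c []] := aP j.
- by have [c [_ PH _]] := aP j; rewrite (PH _ Px) (PH _ (Px0 j)).
Qed.

Lemma compact_boundary : compact (boundary K).
Proof.
have [_ _ /bounded_set_enorm[M KM] _ _] := hK.
apply: bounded_closed_compact; last first.
  by apply: closedI; [exact: closed_closure|apply: open_closedC; exact: open_interior].
exists M; split => [|b Mb x [clx _]]; first exact: num_real.
apply: le_trans (norm_le_enorm x) _; apply: le_trans (ltW Mb).
rewrite -[x]subr0; have := @closed_enorm_ball R n.+1 0 M; apply.
by apply: closureS clx => y Ky; rewrite /= subr0; exact: KM.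
Qed.

(** The points where the density estimate cannot be applied: near a planar face the boundary of KF
    may leave that of K, and without a normal there is no tangent plane. *)
Let irregular (P : 'I_n.+1 -> set 'rV[R]_n.+1) : set 'rV[R]_n.+1 :=
  [set x | F x /\ ((\bigcup_j P j) x \/ forall nu, ~ outward_unit_normal K x nu)].

(** Finitely many charts cover the compact boundary. Off a null set in each chart a normal exists,
    and at a point of a face, thus of a hyperplane through x0, it would violate the positivity of
    m.n on F. *)
Let irregular_packing P a (e : R) : 0 < e -> (forall j, a j != 0) ->
  (forall j x, P j x -> dotv (a j) x = dotv (a j) x0) ->
  packing_bound n (irregular P) e.
Proof.
move=> e0 a0 Pa.
have chartE c : exists p : 'M[R]_n.+1 * R * ('rV[R]_n -> R),
    boundary K c -> lipschitz_chart K c p.1.1 p.1.2 p.2.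
  have [/[dup] bc|nbc] := pselect (boundary K c); last by exists (0, 0, fun=> 0).
  have [_ _ _ _ /[apply]] := hK => -[Q [rho [phi h]]].
  by exists (Q, rho, phi).
have [p pP] := choice chartE.
have := compact_boundary; rewrite compact_cover.
move=> /(_ _ (boundary K) (fun c => [set y | enorm (y - c) < (p c).1.2])).
case=> [c _|x bx|D Db cov].
- exact: open_enorm_ball.
- by exists x => //=; rewrite subrr enorm0; have [] := pP x bx.
have := @packing_bound_bigcup R n.+1 n _ (finmap.enum_fset D)
  (fun c => irregular P `&` [set y | enorm (y - c) < (p c).1.2]).
have Dpack c d : 0 < d -> c \in (finmap.enum_fset D) ->
    packing_bound n (irregular P `&` [set y | enorm (y - c) < (p c).1.2]) d.
  move=> d0 cD; have bc : boundary K c by apply: set_mem; exact: Db.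
  have ch := pP c bc.
  have [Z ZP] := choice (fun j => hyperplane_null_part oK ch x0 n3 (a0 j)).
  apply: sub_packing_bound (chart_packing_bound oK ch (Z := \bigcup_j Z j) _ _ d0).
  - move=> x [[Fx bad] xc]; have bx := FK Fx.
    split => //; apply: contrapT => nZ; case: bad => [[j _ Pjx]|nonu].
      have [_ _ /(_ x bx xc)] := ZP j; case=> [Zj|nu [nux]]; first by apply: nZ; exists j.
      by apply; [exact: Pa|apply: mn0; exists x, nu].
    have [_ _ /(_ x bx xc)] := ZP ord0; case=> [Zj|nu [nux _]]; first by apply: nZ; exists ord0.
    exact: nonu nux.
  - by apply: countable_bigcupT_measurable => // j; have [] := ZP j.
  - by apply: countable_bigcup_null => j; have [] := ZP j.
move=> /(_ Dpack e e0); apply: sub_packing_bound => x irx.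
have [c cD xc] := cov x (FK irx.1).
by exists c.
Qed.

Lemma ex_exit_measure : exists2 nu : {measure set (borel_rV R n.+1) -> \bar R},
  (nu setT < +oo)%E &
  forall A, nu A = lebesgue_rV R n.+1 [set z | KF z /\ A (exit_point KF x0 z)].
Proof.
have mKF : measurable (KF : set (borel_rV R n.+1)) by exact: open_measurable_rV.
have [nu nuE] := ex_pushforward_measure (mrestr (lebesgue_rV R n.+1) mKF)
  (measurable_exit_point oKF sKF).
exists nu => [|A]; last by rewrite nuE /= /mrestr setIC.
have [_ _ /bounded_set_enorm[M KM] _ _] := hK.
rewrite nuE preimage_setT /= /mrestr setTI.
by apply: (lebesgue_rV_enorm_bounded mKF (M := M)) => z /KFK/KM.
Qed.

(** At regular points every small ball has nu-mass at least th mu / (n+1) times omega_n rho^n.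
    Disjoint such balls inside an open U around B have total mass at most nu B + e, which bounds
    their packing sum; irregular points add e. *)
Lemma surface_measure_le (B : set (borel_rV R n.+1)) : measurable B -> B `<=` F ->
  (surface_measure B <= (n.+1%:R / mu)%:E *
     lebesgue_rV R n.+1 [set z | KF z /\ B (exit_point KF x0 z)])%E.
Proof.
move=> mB BF; have [nu nuoo nuE] := ex_exit_measure; rewrite -nuE.
have [P [a [cP a0 Pa bKF]]] := face_planes.
have nuB : nu B \is a fin_num.
  rewrite ge0_fin_numE// (le_lt_trans _ nuoo)//.
  by apply: le_measure; rewrite ?inE//; exact: measurableT.
have nB0 : 0 <= fine (nu B) by exact: fine_ge0.
rewrite -(fineK nuB) -EFinM; set nB := fine _ in nB0 *; set C := _ / _.
have C0 : 0 < C by rewrite divr_gt0.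
have w0 := unit_ball_volume_gt0 R n; set om := unit_ball_volume R n in w0.
have regular_packing (e th : R) : 0 < e -> 0 < th < 1 ->
    packing_bound n (B `\` irregular P) ((nB + e) * C / (th * om)).
  move=> e0 th01; have [th0 _] := andP th01.
  have [U [oU BU nuU]] := outer_regular nuoo mB e0.
  have rad x : exists r : R, (B `\` irregular P) x ->
      [/\ 0 < r, forall y, enorm (y - x) < r -> U y & forall rho, 0 < rho < r ->
        ((th / C * om * rho ^+ n)%:E <= nu [set y | (enorm (y - x) <= rho)%R])%E].
    have [[Bx reg]|] := pselect ((B `\` irregular P) x); last by exists 0.
    have Fx := BF x Bx.
    have nPx : ~ (\bigcup_j P j) x by move=> Px; apply: reg; split => //; left.
    have [nu' nux] : exists nu', outward_unit_normal K x nu'.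
      apply: contrapT => nonu; apply: reg; split => //; right => nu' nux.
      by apply: nonu; exists nu'.
    (* The faces are closed and miss x, so near x only F is left of the boundary of KF. *)
    have bAK : exists2 r : R, 0 < r &
        forall y, enorm (y - x) < r -> boundary KF y -> boundary K y.
      have : closed (\bigcup_j P j) by apply: closed_bigcup; first exact: finite_finset.
      rewrite -openC => oCP.
      have /nbhs_enormP[r r0 rP] : nbhs x (~` \bigcup_j P j) by exact: open_nbhs_nbhs.
      exists r => // y yx /bKF[/FK//|Py].
      by case: (rP y yx).
    have hmu : mu <= dotv (x - x0) nu'.
      apply: ge_inf; last by exists x, nu'.
      by exists 0 => s /mn0/ltW.
    have h0 : 0 < dotv (x - x0) nu' by exact: lt_le_trans hmu.
    have bAx : boundary KF x by have [_ _ _ [+ _]] := hKF; apply.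
    have [r r0 rP] := exit_point_density oK oKF KFK sKF bAx nux bAK h0 th01.
    have /nbhs_enormP[r' r'0 r'P] : nbhs x U by apply: open_nbhs_nbhs; split => //; exact: BU.
    exists (Num.min r r') => _; split; first by rewrite lt_min r0.
      by move=> y; rewrite lt_min => /andP[_]; exact: r'P.
    move=> rho /andP[rho0]; rewrite lt_min => /andP[rhor _].
    rewrite nuE; apply: le_trans (rP rho _); last by rewrite rho0.
    rewrite lee_fin; apply: ler_wpM2r; first by rewrite exprn_ge0// ltW.
    apply: ler_wpM2r; first exact: ltW.
    rewrite /C invf_div mulrA ler_wpM2r// ler_wpM2l//.
    exact: ltW.
  have [r rP] := choice rad.
  exists (fun x => r x / 2); split => [x /rP[rx _ _]|l lB lfar]; first by rewrite divr_gt0.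
  pose g (p : 'rV[R]_n.+1 * R) : set (borel_rV R n.+1) := [set y | enorm (y - p.1) <= p.2].
  have rl p : p \in l -> 0 < p.2 < r p.1.
    move=> /lB[/rP[rx _ _] /andP[p0 pr]]; rewrite p0 (le_lt_trans pr)//.
    by rewrite ltr_pdivrMr// ltr_pMr// ltr1n.
  have := @measure_pairwise_le _ _ _ nu _ g l U (open_measurable_rV oU).
  have lg p : p \in l -> measurable (g p) /\ g p `<=` U.
    move=> pl; split; first exact: measurable_enorm_ball.
    have [/rP[rx rU _] _] := lB p pl; move=> y yp; apply: rU.
    by apply: le_lt_trans yp _; case/andP: (rl p pl).
  move=> /(_ lg).
  have ldisj : pairwise (fun p q => `[< g p `&` g q = set0 >]) l.
    apply: sub_pairwise lfar => p q pq; apply/asboolP/seteqP; split => // y [gp gq].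
    move: pq; rewrite /far ltNge => /negP; apply.
    apply: le_trans (ler_enormB _ y _) _; rewrite enormB.
    exact: lerD.
  move=> /(_ ldisj) /le_trans/(_ nuU) H.
  have {H} : ((\sum_(p <- l) th / C * om * p.2 ^+ n)%:E <= (nB + e)%:E)%E.
    rewrite EFinD fineK//; apply: le_trans H.
    rewrite -sumEFin big_seq [leRHS]big_seq; apply: lee_sum => p pl.
    by have [/rP[_ _ pP] _] := lB p pl; apply: pP; exact: rl.
  rewrite lee_fin -mulr_sumr => H.
  rewrite ler_pdivlMr ?mulr_gt0// -[leRHS]mulrC -ler_pdivrMl//.
  apply: le_trans H; rewrite le_eqVlt; apply/orP; left; apply/eqP.
  by field; rewrite gt_eqF.
have total (e : R) : 0 < e ->
    (surface_measure B <= ((nB + e) * C * (1 + e) + om * e)%:E)%E.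
  move=> e0; have e1 : 0 < 1 + e by rewrite addr_gt0.
  have th01 : 0 < (1 + e)^-1 < 1 by rewrite invr_gt0 e1/= invf_lt1// ltrDl.
  have := packing_boundU (regular_packing e _ e0 th01) (irregular_packing e0 a0 Pa).
  move=> /(@sub_packing_bound _ _ _ B) => -[x Bx|r [r0 rP]].
    by have [irx|nirx] := pselect (irregular P x); [right|left].
  apply: le_trans (hausdorff_measure_le_packing r0 rP) _.
  rewrite lee_fin -/om le_eqVlt; apply/orP; left; apply/eqP.
  by field; rewrite !gt_eqF.
apply/lee_addgt0Pr => d d0.
(* The excess of the bound over C nB is e (C nB + C + om) + C e^2, at most e D because e <= 1. *)
pose D := C * nB + 2 * C + om.
have CnB : 0 <= C * nB by rewrite mulr_ge0// ltW.
have D0 : 0 < D by rewrite /D; lra.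
pose e := Num.min 1 (d / D).
have e0 : 0 < e by rewrite lt_min ltr01 divr_gt0.
have e1 : e <= 1 by rewrite ge_min lexx.
have eD : e * D <= d by rewrite -ler_pdivlMr// ge_min lexx orbT.
apply: le_trans (total e e0) _; rewrite -EFinD lee_fin.
have : C * e * e <= C * e by rewrite ler_piMr// mulr_ge0 ?ltW.
move: eD; rewrite /D.
have -> : (nB + e) * C * (1 + e) + om * e =
  C * nB + e * (C * nB + C + om) + C * e * e by ring.
have -> : e * (C * nB + 2 * C + om) = e * (C * nB + C + om) + C * e by ring.
move: (e * _) (C * e * e) (C * e) => s1 s2 s3; lra.
Qed.

End surface_bound.

(** * Integration against a set function *)

Import HBNNSimple.

(** The integral is a supremum over simple functions, which evaluate mu only on level sets. For a
    simple function below f restricted to D, the level sets of nonzero values lie in D, where the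
    comparison holds. *)
Lemma integral_le_of_le_measure d (T : measurableType d) (R : realType)
    (mu : set T -> \bar R) (nu : {measure set T -> \bar R}) (D : set T) (f : T -> \bar R) :
  mu set0 = 0%E ->
  (forall B, measurable B -> B `<=` D -> (mu B <= nu B)%E) ->
  (forall x, 0 <= f x)%E ->
  (\int[mu]_(x in D) f x <= \int[nu]_(x in D) f x)%E.
Proof.
move=> mu0 munu f0; rewrite /integral.
have sintE (m : set T -> \bar R) (h : {nnsfun T >-> R}) : m set0 = 0%E ->
    sintegral m h = (\sum_(x \in range h) x%:E * m (h @^-1` [set x]))%E.
  move=> m0; rewrite /sintegral (fsbig_widen (range h) setT)//= => x [_ Nfx] /=.
  by rewrite preimage10// m0 mule0.
have fD0 x : (0 <= (f \_ D) x)%E by rewrite patchE; case: ifP.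
apply: leeB.
  apply: ge_ereal_sup => _ [h hf <-].
  apply: le_trans (_ : sintegral nu h <= _)%E; last first.
    by apply: ereal_sup_ubound; exists h.
  rewrite !sintE ?measure0//; apply: lee_fsum; first exact: fimfunP.
  move=> _ [z _ <-].
  have [->|hz] := eqVneq (h z) 0%R; first by rewrite !mul0e.
  apply: lee_wpmul2l; first by rewrite lee_fin.
  apply: munu => // x /= hx; apply: contrapT => nDx.
  have := hf x; rewrite hx funeposE patchE memNset// /maxe ltxx lee_fin => hz0.
  by move/eqP: hz; apply; apply/eqP; rewrite eq_le hz0/=.
(* The negative part is zero, so the only simple function below it is 0. *)
apply: (@le_trans _ _ 0%E).
  apply: ge_ereal_sup => _ [h hf <-].
  have h0 x : h x = 0%R.
    apply/eqP; rewrite eq_le; apply/andP; split => //.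
    have := hf x; rewrite funenegE /maxe; case: ifPn; rewrite ?lee_fin// => _.
    by move=> hfx; rewrite -lee_fin (le_trans hfx)// oppe_le0.
  rewrite sintE// fsbig1// => x [z _ <-]; by rewrite h0 mul0e.
apply: ereal_sup_ubound; exists nnsfun0 => [x|].
  by apply: (@le_trans _ _ 0%E) => //; rewrite funenegE le_max lexx orbT.
rewrite sintE// fsbig1// => x [z _ <-]; by rewrite mul0e.
Qed.

Section hausdorff_set0.
Context (R : realType) (s m : nat).

Lemma hausdorff_measure_ge0 (A : set (borel_rV R m)) :
  (0 <= @hausdorff_measure R s m A)%E.
Proof.
apply: le_trans (_ : _ <= ereal_inf _)%E _; last first.
  by apply: ereal_sup_ubound; exists 1 => //=.
apply: le_ereal_inf_tmp => _ [C _ <-]; apply: nneseries_ge0 => k _ _.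
by rewrite lee_fin hausdorff_weight_ge0.
Qed.

Lemma hausdorff_measure0 : @hausdorff_measure R s m set0 = 0%E.
Proof.
apply/eqP; rewrite eq_le hausdorff_measure_ge0 andbT.
apply: ge_ereal_sup => _ [delta _ <-]; apply: ereal_inf_lbound.
exists (fun=> set0); first by split.
by rewrite eseries0// => k _ _; rewrite /hausdorff_weight eqxx.
Qed.

End hausdorff_set0.

(** * Polar coordinates *)

Lemma finite_sigma_finite_measure d (T : measurableType d) (R : realType)
    (mu : {measure set T -> \bar R}) : (mu setT < +oo)%E ->
  exists nu : {sigma_finite_measure set T -> \bar R}, forall A, nu A = mu A.
Proof.
move=> mufin.
have [||||nu nuE] := @sigma_finite_measure_of _ T R mu.
- exact: measure0.
- by move=> A; exact: measure_ge0.
- exact: measure_semi_sigma_additive.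
- by exists (fun=> setT); [rewrite bigcup_const//; exists 0%N|move=> _; split].
- by exists nu => A; rewrite nuE.
Qed.

Lemma ex_density_measure d (T : measurableType d) (R : realType)
    (mu : {measure set T -> \bar R}) (f : T -> \bar R) :
  measurable_fun setT f -> (forall x, 0 <= f x)%E -> (\int[mu]_x f x < +oo)%E ->
  exists nu : {sigma_finite_measure set T -> \bar R},
    forall A, nu A = (\int[mu]_(x in A) f x)%E.
Proof.
move=> mf f0 foo.
have [||||nu nuE] := @sigma_finite_measure_of _ T R (fun A => (\int[mu]_(x in A) f x)%E).
- by rewrite integral_set0.
- by move=> A; exact: integral_ge0.
- move=> F mF tF mUF; rewrite ge0_integral_bigcup//.
    by apply: is_cvg_ereal_nneg_natsum => k _; exact: integral_ge0.
  exact: measurable_funTS.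
- by exists (fun=> setT); [rewrite bigcup_const//; exists 0%N|move=> _; split].
- by exists nu => A; rewrite nuE.
Qed.

Section polar.
Context (R : realType) (n : nat) (A : set 'rV[R]_n.+1) (x0 : 'rV[R]_n.+1).
Hypotheses (oA : open A) (sA : star_shaped A x0).
Hypothesis Afin : (lebesgue_rV R n.+1 A < +oo)%E.
Local Notation leb := (@lebesgue_measure R).
Local Notation L := (lebesgue_rV R n.+1).
Local Notation gauge := (gauge A x0).
Local Notation exit := (exit_point A x0).

Let mA : measurable (A : set (borel_rV R n.+1)). Proof. exact: open_measurable_rV. Qed.

Let sector (B : set (borel_rV R n.+1)) : set (borel_rV R n.+1) :=
  [set z | A z /\ B (exit z)].

Let mexit (B : set (borel_rV R n.+1)) : measurable B ->
  measurable (exit @^-1` B : set (borel_rV R n.+1)).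
Proof.
by move=> mB; rewrite -[X in measurable X]setTI; exact: measurable_exit_point.
Qed.

Let msector B : measurable B -> measurable (sector B).
Proof. by move=> mB; apply: measurableI => //; exact: mexit. Qed.

Lemma lebesgue_rV_gauge_lt (c : R) (B : set (borel_rV R n.+1)) :
  0 < c <= 1 -> measurable B ->
  L [set z | (gauge z < c)%R /\ B (exit z)] = ((c ^+ n.+1)%:E * L (sector B))%E.
Proof.
move=> c01 mB; have [c0 c1] := andP c01.
have ci : c^-1 != 0 by rewrite invr_eq0 gt_eqF.
have -> : [set z | (gauge z < c)%R /\ B (exit z)] =
    (fun z : 'rV[R]_n.+1 => c^-1 *: z + (x0 - c^-1 *: x0)) @^-1` sector B.
  apply/seteqP; split => z.
    move=> [zc Bz]; rewrite /= addrCA -scalerBr; split; first exact/gauge_lt.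
    by rewrite -(exit_point_dilate oA sA c01 zc).
  rewrite /= addrCA -scalerBr => -[Az Bz].
  have zc : gauge z < c by apply/gauge_lt.
  by split => //; rewrite (exit_point_dilate oA sA c01 zc).
rewrite lebesgue_rV_affine//; last exact: msector.
by rewrite gtr0_norm ?invr_gt0// exprVn invrK.
Qed.

(** Dilation about x0 preserves exit points, so the points of gauge below c that exit in B fill the
    fraction c^(n+1) of the sector over B. This determines the joint law of gauge and exit point on
    rectangles; uniqueness of product measures and Tonelli do the rest. *)
Lemma polar_coordinates :
  exists (rho : {sigma_finite_measure set (measurableTypeR R) -> \bar R})
    (nu : {sigma_finite_measure set (borel_rV R n.+1) -> \bar R}),
  [/\ forall X, measurable X ->
        rho X = (\int[leb]_(s in (X `&` `]0%R, 1%R])%classic) (n.+1%:R * s ^+ n)%:E)%E,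
      forall B, nu B = L [set z | A z /\ B (exit z)] &
      forall g : measurableTypeR R * borel_rV R n.+1 -> \bar R,
        measurable_fun setT g -> (forall p, 0 <= g p)%E ->
        (\int[L]_(z in A) g (gauge z, exit z) = \int[nu]_y \int[rho]_t g (t, y))%E].
Proof.
have [nu0 nu0E] := ex_pushforward_measure (mrestr L mA) (measurable_exit_point oA sA).
have nu0E' B : nu0 B = L (sector B) by rewrite nu0E /= /mrestr setIC.
have [|nu nuE] := finite_sigma_finite_measure (mu := nu0).
  by rewrite nu0E' (_ : sector setT = A)//; apply/seteqP; split => z // [].
pose f (s : R) : \bar R := (((fun s => (n.+1%:R * s ^+ n)%:E) \_ `]0%R, 1%R]) s)%E.
have mpow : measurable_fun setT (fun s : R => n.+1%:R * s ^+ n).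
  by apply: measurable_funM => //; exact: exprn_measurable.
have f0 s : (0 <= f s)%E.
  rewrite /f patchE; case: ifPn => //; rewrite inE/= in_itv/= => /andP[/ltW s0 _].
  by rewrite lee_fin mulr_ge0// exprn_ge0.
have mf : measurable_fun setT f.
  apply/(measurable_restrictT _ _).1 => //.
  by apply/measurable_EFinP; exact: measurable_funTS.
have [|rho rhoE] := @ex_density_measure _ _ _ leb f mf f0.
  by rewrite -integral_mkcond integral_exprn// ltry.
exists rho, nu.
have rhoX X : measurable X ->
    rho X = (\int[leb]_(s in (X `&` `]0%R, 1%R])%classic) (n.+1%:R * s ^+ n)%:E)%E.
  by move=> mX; rewrite rhoE integral_mkcondr.
have nuB B : nu B = L (sector B) by rewrite nuE nu0E'.
split => // g mg g0.
pose pol (z : borel_rV R n.+1) : measurableTypeR R * borel_rV R n.+1 := (gauge z, exit z).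
have mpol : measurable_fun setT pol.
  by apply/measurable_fun_pair; [exact: measurable_gauge|exact: measurable_exit_point].
pose lam := mrestr L mA.
pose m' := pushforward lam pol.
have law X B : measurable X -> measurable B -> lam (pol @^-1` (X `*` B)) = (rho X * nu B)%E.
  move=> mX mB.
  have [m1 m1E] := ex_pushforward_measure (mrestr L (msector mB)) (measurable_gauge oA sA).
  have nuBfin : nu B \is a fin_num.
    rewrite ge0_fin_numE// nuB; apply: le_lt_trans Afin.
    by apply: le_measure; rewrite ?inE//; [exact: msector|move=> z []].
  have nuB0 : 0 <= fine (nu B) by exact: fine_ge0.
  have m1X Y : m1 Y = L [set z | [/\ A z, Y (gauge z) & B (exit z)]].
    rewrite m1E /= /mrestr; congr L; apply/seteqP.
    by split => [z [Yz [Az Bz]]|z [Az Yz Bz]].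
  transitivity (m1 X).
    rewrite m1X /lam /mrestr; congr L; apply/seteqP.
    by split => [z [[Xz Bz] Az]|z [Az Xz Bz]].
  transitivity (mscale (NngNum nuB0) rho X); last by rewrite /mscale /= fineK// muleC.
  (* Half-lines ]-oo, c[ are stable under intersection; on them both measures give 0 for c <= 0 and
     min(c, 1)^(n+1) nu(B) for c > 0. *)
  apply: (@measure_unique _ R (measurableTypeR R) (@RGenInftyO.G R)
    (fun k => `]-oo, k%:R[%classic) _ _ _ _ m1 (mscale (NngNum nuB0) rho)) => //.
  - exact: RGenInftyO.measurableE.
  - move=> _ _ [u ->] [v ->]; exists (Num.min u v); apply/seteqP.
    by split => t /=; rewrite !in_itv/= lt_min => /andP.
  - by move=> k; exists k%:R.
  - apply/seteqP; split => // t _; exists (Num.bound `|t|) => //=.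
    by rewrite in_itv/= (le_lt_trans (ler_norm _))// archi_boundP.
  - move=> _ [c ->]; transitivity ((fine (nu B))%:E * rho `]-oo, c[%classic)%E; last by [].
    rewrite fineK// m1X rhoX//.
    have [c0|c0] := leP c 0.
      rewrite (_ : `]-oo, c[%classic `&` _ = set0); last first.
        apply/seteqP; split => // s /= [].
        rewrite !in_itv/= => sc /andP[s0 _]; move: (lt_trans s0 sc); lra.
      rewrite integral_set0 mule0 (_ : [set z | _] = set0) ?measure0//.
      apply/seteqP; split => // z [_ + _]; rewrite /= in_itv/= => zc.
      by have := gauge_ge0 A x0 z; rewrite leNgt (lt_le_trans zc c0).
    have [c1|c1] := leP c 1.
      rewrite (_ : `]-oo, c[%classic `&` _ = [set` `]0%R, c[]); last first.
        apply/seteqP; split => s /=; rewrite !in_itv/=.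
          by move=> [-> /andP[->]].
        by move=> /andP[-> sc]; split => //; rewrite ltW// (lt_le_trans sc).
      rewrite integral_itv_bndo_bndc; last first.
        by apply/measurable_EFinP; exact: measurable_funTS.
      rewrite integral_exprn// nuB muleC -lebesgue_rV_gauge_lt ?c0//; congr L.
      apply/seteqP; split => z; first by move=> [_ + Bz]; rewrite /= in_itv.
      move=> [zc Bz]; split; rewrite /= ?in_itv//.
      by apply/(gauge_lt1 oA sA); exact: lt_le_trans c1.
    rewrite (_ : `]-oo, c[%classic `&` _ = [set` `]0%R, 1%R]]); last first.
      apply/seteqP; split => s /=; rewrite !in_itv/=; first by case.
      by move=> /andP[-> s1]; split => //; exact: le_lt_trans c1.
    rewrite integral_exprn// expr1n mule1 nuB; congr L.
    apply/seteqP; split => z; first by case.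
    move=> [Az Bz]; split => //; rewrite /= in_itv/=.
    by apply: lt_trans c1; apply/(gauge_lt1 oA sA).
  - move=> k; apply: (@le_lt_trans _ _ (m1 setT)).
      by apply: le_measure; rewrite ?inE//; exact: measurableT.
    rewrite m1X (_ : [set z | _] = sector B).
      by rewrite -nuB ltey_eq nuBfin.
    by apply/seteqP; split => z /= [].
have mmg : measurable_fun setT (g \o pol) by exact: measurableT_comp.
have lamE : (\int[lam]_z (g \o pol) z = \int[L]_(z in A) g (gauge z, exit z))%E.
  have lamX X : X `<=` A -> lam X = L X by move=> XA; rewrite /lam /mrestr setIidl.
  have lamN : lam (~` A) = 0%E by rewrite /lam /mrestr setICl measure0.
  rewrite (ge0_negligible_integral (measurableC mA) measurableT mmg (fun z _ => g0 _) lamN).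
  rewrite setDE setCK setTI; apply: eq_measure_integral => X mX XA.
  exact: lamX.
rewrite -lamE.
have [m'' m''E] := ex_pushforward_measure lam mpol.
rewrite -[LHS](ge0_integral_pushforward mpol lam measurableT mg (fun p _ => g0 p)).
have <- := @fubini_tonelli2 _ _ _ _ _ rho nu g mg g0.
apply: eq_measure_integral => X mX _.
transitivity (m'' X); first by rewrite m''E.
symmetry; apply: product_measure_unique mX => Y Z mY mZ.
by rewrite m''E; exact: law.
Qed.

End polar.

(** * Polynomials along rays and the radial inequality *)

Section polynomial_rays.
Context (R : realType) (n : nat).
Implicit Types (v : mpoly.mpoly n R) (x w : 'rV[R]_n).

Lemma poly_eval_line v x w : exists p : {poly R},
  (size p <= mpoly.msize v)%N /\ forall t, p.[t] = poly_eval v (x + t *: w).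
Proof.
pose h (j : 'I_n) : {poly R} := (x 0 j)%:P + w 0 j *: 'X.
have sh j : (size (h j) <= 2)%N.
  rewrite (leq_trans (size_polyD _ _))// geq_max (leq_trans (size_polyC_leq1 _))//=.
  by rewrite (leq_trans (size_scale_leq _ _))// size_polyX.
have sM (p q : {poly R}) i j : (size p <= i.+1)%N -> (size q <= j.+1)%N ->
    (size (p * q)%R <= (i + j).+1)%N.
  move=> pi qj; rewrite (leq_trans (size_polyMleq _ _))//.
  by move: (size p) (size q) pi qj => k l; lia.
have sX (p : {poly R}) k : (size p <= 2)%N -> (size (p ^+ k)%R <= k.+1)%N.
  move=> p2; elim: k => [|k IH]; first by rewrite expr0 size_poly1.
  by rewrite exprS; exact: (sM _ _ 1%N k).
exists (\sum_(m <- mpoly.msupp v)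
  mpoly.mcoeff m v *: \prod_(j < n) h j ^+ (m : mpoly.multinom n) j); split => [|t].
  rewrite big_seq; apply: (big_ind (fun p : {poly R} => size p <= mpoly.msize v)%N).
  - by rewrite size_poly0.
  - by move=> p q pv qv; rewrite (leq_trans (size_polyD _ _))// geq_max pv.
  move=> m /mpoly.msize_mdeg_lt mv; rewrite (leq_trans (size_scale_leq _ _))//.
  apply: leq_trans mv; rewrite mpoly.mdegE.
  apply: (big_ind2 (fun (p : {poly R}) (k : nat) => size p <= k.+1)%N).
  - by rewrite size_poly1.
  - by move=> p i q j; exact: sM.
  - by move=> j _; exact: sX.
rewrite horner_sum /poly_eval mpoly.mevalE; apply: eq_bigr => m _.
rewrite hornerZ horner_prod; congr (_ * _); apply: eq_bigr => j _.
by rewrite horner_exp /h hornerD hornerC hornerZ hornerX !mxE mulrC.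
Qed.

Lemma measurable_poly_eval v :
  measurable_fun setT (poly_eval v : borel_rV R n -> measurableTypeR R).
Proof.
rewrite (_ : poly_eval v = fun y : 'rV[R]_n => \sum_(m <- mpoly.msupp v)
  mpoly.mcoeff m v * \prod_(j < n) y 0 j ^+ (m : mpoly.multinom n) j); last first.
  by apply/funext => y; rewrite /poly_eval mpoly.mevalE.
apply: measurable_sum => m; apply: measurable_funM => //.
apply: measurable_prod => j _; apply: measurable_funX.
exact: measurable_rV_coord.
Qed.

End polynomial_rays.

Section radial_inequality.
Context (R : realType) (n r : nat) (q a : R) (v : mpoly.mpoly n.+1 R).
Variables (A : set 'rV[R]_n.+1) (x0 : 'rV[R]_n.+1).
Hypotheses (q0 : 0 < q) (a0 : 0 <= a) (a1 : a < 1) (vr : total_degree_le r v).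
Hypotheses (oA : open A) (sA : star_shaped A x0).
Hypothesis Afin : (lebesgue_rV R n.+1 A < +oo)%E.
Local Notation leb := (@lebesgue_measure R).
Local Notation L := (lebesgue_rV R n.+1).

Let f (y : borel_rV R n.+1) : R := `|poly_eval v y| `^ q.

Lemma measurable_powR_poly_eval : measurable_fun setT (f : borel_rV R n.+1 -> measurableTypeR R).
Proof.
apply: (measurableT_comp (measurable_powR q)).
by apply: measurableT_comp => //; exact: measurable_poly_eval.
Qed.

Let line (p : measurableTypeR R * borel_rV R n.+1) : borel_rV R n.+1 :=
  x0 + p.1 *: ((p.2 : 'rV[R]_n.+1) - x0).

Let measurable_line : measurable_fun setT line.
Proof.
apply: measurable_funP_rV => j.
have -> : (fun p => (line p : 'rV[R]_n.+1) 0 j) =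
    fun p => x0 0 j + p.1 * ((p.2 : 'rV[R]_n.+1) 0 j - x0 0 j).
  by apply/funext => p; rewrite /line !mxE.
apply: measurable_funD => //; apply: measurable_funM; first exact: measurable_fst.
apply: measurable_funB => //.
exact: (measurableT_comp (measurable_rV_coord j) measurable_snd).
Qed.

(** The parameter is required to be positive because only then is a point recovered from its gauge
    and its exit point. *)
Let G : set (measurableTypeR R * borel_rV R n.+1) :=
  [set p | [/\ 0 < p.1, a <= p.1 <= 1 &
    `|poly_eval v p.2| <= 2 * `|poly_eval v (line p)|]].

Let measurable_G : measurable G.
Proof.
have -> : G = (fst @^-1` (`]0, +oo[ `&` `[a, 1])) `&`
    [set p | `|poly_eval v p.2| <= 2 * `|poly_eval v (line p)|].
  apply/seteqP; split => p; rewrite /G /= !in_itv/= andbT.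
    by move=> [].
  by move=> [[]].
apply: measurableI.
  by rewrite -[X in measurable X]setTI; apply: measurable_fst => //; exact: measurableI.
rewrite -[X in measurable X]setTI; apply: measurable_fun_le => //.
  apply: measurableT_comp => //.
  exact: (measurableT_comp (@measurable_poly_eval R n.+1 v) measurable_snd).
apply: measurable_funM => //; apply: measurableT_comp => //.
exact: (measurableT_comp (@measurable_poly_eval R n.+1 v) measurable_line).
Qed.

Let section_bound (y : 'rV[R]_n.+1) :
  (((1 - a) / (4 * r%:R ^+ 2 + 2))%:E <= leb (ysection G y))%E.
Proof.
have [p [sp pE]] := poly_eval_line v x0 (y - x0).
have mGy : measurable (ysection G y) by exact: measurable_ysection.
apply: le_trans (remez_superlevel (leq_trans sp vr) a1) _.
(* When a = 0 the Remez set may contain t = 0, which G leaves out; one point has measure zero. *)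
have -> : leb (ysection G y) = (leb (ysection G y `|` [set 0%R]))%E.
  by rewrite measureU0//; exact: lebesgue_measure_set1.
apply: le_measure; rewrite ?inE.
- have -> : [set t | a <= t <= 1 /\ `|p.[1]| <= 2 * `|p.[t]|] =
      [set` `[a, 1]] `&` [set t | `|p.[1]| <= 2 * `|p.[t]|].
    by apply/seteqP; split => t; rewrite /= in_itv.
  apply: measurableI => //; rewrite -[X in measurable X]setTI.
  apply: measurable_fun_le => //; apply: measurable_funM => //.
  apply: measurableT_comp => //; apply: continuous_measurable_fun.
  exact: continuous_horner.
- exact: measurableU.
move=> t [/andP[at1 t1]]; rewrite !pE scale1r subrKC => vt.
have [->|tn0] := eqVneq t 0; first by right.
left; rewrite ysectionE/= /G /=; split => //; last by rewrite at1.
by rewrite lt_def tn0 (le_trans a0).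
Qed.

Let k : R := 2^-1 `^ q.
Let kap : R := n.+1%:R * a ^+ n * ((1 - a) / (4 * r%:R ^+ 2 + 2)).

(** Apart from the indicator of G, the minorant g depends on a point only through its exit point;
    integrating along the rays first leaves the rho-measure of a section of G. *)
Lemma exit_integral_le :
  exists nu : {sigma_finite_measure set (borel_rV R n.+1) -> \bar R},
    (forall B, nu B = L [set z | A z /\ B (exit_point A x0 z)]) /\
    ((k * kap)%:E * \int[nu]_y (f y)%:E <= \int[L]_(z in A) (f z)%:E)%E.
Proof.
have [rho [nu [rhoE nuE polar]]] := polar_coordinates oA sA Afin.
exists nu; split => //.
have f0 y : 0 <= f y by exact: powR_ge0.
have k0 : 0 <= k by exact: powR_ge0.
have mA : measurable (A : set (borel_rV R n.+1)) by exact: open_measurable_rV.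
have D0 : 0 < 4 * r%:R ^+ 2 + 2 :> R.
  by have : 0 <= r%:R ^+ 2 :> R by [exact: sqr_ge0|lra].
have kap0 : 0 <= kap.
  by rewrite mulr_ge0 ?divr_ge0 ?mulr_ge0 ?exprn_ge0 ?subr_ge0 ?(ltW a1) ?(ltW D0).
pose g (p : measurableTypeR R * borel_rV R n.+1) : \bar R := (k * f p.2 * \1_G p)%:E.
have g0 p : (0 <= g p)%E by rewrite lee_fin mulr_ge0// mulr_ge0.
have mg : measurable_fun setT g.
  apply/measurable_EFinP; apply: measurable_funM; last exact: measurable_indic.
  apply: measurable_funM => //.
  exact: (measurableT_comp measurable_powR_poly_eval measurable_snd).
have <- : (\int[nu]_y ((k * kap)%:E * (f y)%:E) = (k * kap)%:E * \int[nu]_y (f y)%:E)%E.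
  apply: ge0_integralZl_EFin => //; last exact: mulr_ge0.
    by move=> y _; rewrite lee_fin.
  by apply/measurable_EFinP; exact: measurable_powR_poly_eval.
apply: (@le_trans _ _ (\int[nu]_y \int[rho]_t g (t, y))%E).
  apply: ge0_le_integral => //.
  - by move=> y _; rewrite lee_fin mulr_ge0// mulr_ge0.
  - apply/measurable_EFinP; apply: measurable_funM => //.
    exact: measurable_powR_poly_eval.
  - exact: measurable_fun_fubini_tonelli_G.
  move=> y _; have mGy : measurable (ysection G y) by exact: measurable_ysection.
  have -> : (\int[rho]_t g (t, y) = (k * f y)%:E * rho (ysection G y))%E.
    rewrite -[X in rho X]setIT -integral_indic//.
    rewrite -ge0_integralZl_EFin//; last exact: mulr_ge0.
      apply: eq_integral => t _; rewrite /g /= !indicE.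
      by rewrite -EFinM mem_ysection.
    by apply/measurable_EFinP; exact: measurable_indic.
  rewrite -EFinM mulrAC EFinM; apply: lee_wpmul2l; first by rewrite lee_fin mulr_ge0.
  have Gy1 : ysection G y `&` `]0%R, 1%R] = ysection G y.
    rewrite setIidl// => t; rewrite ysectionE /= in_itv/=.
    by move=> [-> /andP[_ ->] _].
  rewrite rhoE// Gy1.
  (* On the section t >= a, so the radial density is at least its value at a. *)
  apply: (@le_trans _ _ (\int[leb]_(s in ysection G y) (n.+1%:R * a ^+ n)%:E)%E).
    rewrite integral_cst// /kap EFinM; apply: lee_wpmul2l; last exact: section_bound.
    by rewrite lee_fin mulr_ge0// exprn_ge0.
  apply: ge0_le_integral => //.
  - by move=> t _; rewrite lee_fin mulr_ge0// exprn_ge0.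
  - by apply/measurable_EFinP; apply: measurable_funM => //; exact: measurable_funX.
  move=> t; rewrite ysectionE /G /= => -[t0 /andP[at1 _] _].
  by rewrite lee_fin ler_wpM2l// lerXn2r// nnegrE// ltW.
rewrite -polar//; apply: ge0_le_integral => //.
- apply: measurable_funTS; apply: (measurableT_comp mg).
  by apply/measurable_fun_pair; [exact: measurable_gauge|exact: measurable_exit_point].
- apply/measurable_EFinP; apply: measurable_funTS; exact: measurable_powR_poly_eval.
move=> z Az; rewrite /g lee_fin indicE; case: (boolP (_ \in G)); last by rewrite mulr0.
rewrite inE /G /= mulr1 => -[gz _ vz].
have lineE : line (gauge A x0 z, exit_point A x0 z) = z.
  rewrite /line /= /exit_point [x0 + _ - x0]addrC addKr scalerA mulfV ?gt_eqF//.
  by rewrite scale1r subrKC.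
rewrite lineE in vz.
rewrite /k /f -powRM ?invr_ge0//; apply: ge0_ler_powR; rewrite ?nnegrE ?mulr_ge0 ?invr_ge0//.
- exact: ltW.
- by rewrite ler_pdivrMl.
Qed.

End radial_inequality.

(* The best cut of the rays at a fraction a would maximise a^n (1 - a); the value
   a = 1/2 is the one that produces the constants 4 and 8. *)
Lemma C_inv_cut (R : realType) (n : nat) : (n < 3)%N ->
  let a : R := if n is 0 then 0 else 2^-1 in
  C_inv R n.+1 * (a ^+ n * (1 - a)) = 1.
Proof.
by case: n => [|[|[|//]]] _ /=; rewrite ?expr0 ?expr1 ?expr2; field.
Qed.

(* The dimension is d = n.+1. *)
Theorem lemma7p3 (R : realType) (n : nat) (hn : (n < 3)%N)
    (q : R) (hq : 0 < q) (r : nat)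
    (K : set 'rV[R]_n.+1) (hK : lipschitz_domain K)
    (nK : nat) (F KF : 'I_nK -> set 'rV[R]_n.+1) (x0 : 'I_nK -> 'rV[R]_n.+1)
    (hF : piecewise_star_shaped K F KF x0)
    (i : 'I_nK) (v : mpoly.mpoly n.+1 R) (hv : total_degree_le r v) :
  (\int[@surface_measure R n]_(x in F i) (`|poly_eval v x| `^ q)%:E <=
   (2 `^ (q + 1) * C_inv R n.+1 *
      ((2 * r%:R ^+ 2 + 1) / min_m_dot_n K (F i) (x0 i)))%:E *
   \int[lebesgue_rV R n.+1]_(x in KF i) (`|poly_eval v x| `^ q)%:E)%E.
Proof.
have [bK _ mF /(_ i)[_ subi mn0 mu0]] := hF.
have [_ _ /bounded_set_enorm[M KM] _ _] := hK.
have [oKF KFK sKF _] := subi.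
have FK : F i `<=` boundary K by rewrite bK => x Fx; exists i.
have KFfin : (lebesgue_rV R n.+1 (KF i) < +oo)%E.
  apply: (lebesgue_rV_enorm_bounded (M := M)); first exact: open_measurable_rV.
  by move=> z /KFK/KM.
pose a : R := if n is 0 then 0 else 2^-1.
have a0 : 0 <= a by rewrite /a; case: (n) => // m; rewrite invr_ge0.
have a1 : a < 1 by rewrite /a; case: (n) => // m; rewrite invf_lt1// ltr1n.
have [nu [nuE]] := exit_integral_le hq a0 a1 hv oKF sKF KFfin.
set I := (\int[lebesgue_rV R n.+1]_(z in _) _)%E; set J := (\int[nu]_y _)%E => JI.
set mu := min_m_dot_n _ _ _ in mu0 *.
have C0 : 0 <= n.+1%:R / mu by rewrite divr_ge0// ltW.
have mf : measurable_fun setT (fun x : borel_rV R n.+1 => (`|poly_eval v x| `^ q)%:E).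
  by apply/measurable_EFinP; exact: measurable_powR_poly_eval.
have f0 (x : borel_rV R n.+1) : (0 <= (`|poly_eval v x| `^ q)%:E)%E.
  by rewrite lee_fin powR_ge0.
have le1 : (\int[@surface_measure R n]_(x in F i) (`|poly_eval v x| `^ q)%:E <=
    (n.+1%:R / mu)%:E * J)%E.
  apply: (@le_trans _ _ (\int[mscale (NngNum C0) nu]_(x in F i) (`|poly_eval v x| `^ q)%:E)%E).
    apply: integral_le_of_le_measure => // [|B mB BF]; first exact: hausdorff_measure0.
    have := surface_measure_le hn hK FK subi mn0 mu0 mB BF.
    by rewrite -nuE.
  rewrite ge0_integral_mscale//; last exact: measurable_funTS.
  apply: lee_wpmul2l; first by rewrite lee_fin.
  apply: ge0_subset_integral => //.
apply: le_trans le1 _.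
set E := (n.+1%:R * _ * _) in JI.
have D0 : 0 < 2 * r%:R ^+ 2 + 1 :> R.
  by have : 0 <= r%:R ^+ 2 :> R by [exact: sqr_ge0|lra].
have k0 : 0 < 2^-1 `^ q :> R by rewrite powR_gt0// invr_gt0.
(* The constants balance exactly: the constant of the theorem times the lower factor of the volume
   integral is the surface factor (n+1) / mu. *)
have CE : 2 `^ (q + 1) * C_inv R n.+1 * ((2 * r%:R ^+ 2 + 1) / mu) * (2^-1 `^ q * E) =
    n.+1%:R / mu.
  have -> : 2 `^ (q + 1) = 2 `^ q * 2 :> R by rewrite powRD ?powRr1// pnatr_eq0 implybT.
  have kE : 2^-1 `^ q = (2 `^ q)^-1 :> R.
    apply: (mulfI (x := 2 `^ q)); first by rewrite gt_eqF// powR_gt0.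
    by rewrite -powRM ?invr_ge0// !mulfV ?powR1// gt_eqF// powR_gt0.
  have P0 : 2 `^ q != 0 :> R by rewrite gt_eqF// powR_gt0.
  have D2 : 4 * r%:R ^+ 2 + 2 = 2 * (2 * r%:R ^+ 2 + 1) :> R by ring.
  transitivity (C_inv R n.+1 * (a ^+ n * (1 - a)) * (n.+1%:R / mu)); last first.
    by rewrite (C_inv_cut R hn) mul1r.
  rewrite kE /E D2.
  move: (2 `^ q) (2 * _ + 1) (C_inv _ _) (a ^+ n) D0 P0 => P D c an /gt_eqF/negbT D0 P0.
  by field; rewrite D0 P0 gt_eqF.
rewrite -CE EFinM -muleA; apply: lee_wpmul2l => //.
rewrite lee_fin mulr_ge0// ?divr_ge0 ?(ltW D0) ?(ltW mu0)//.
by rewrite mulr_ge0 ?powR_ge0//; case: (n) => [|[|?]] /=.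
Qed.
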